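(* For all $j\ge1$, let $m_j:\bigsqcup_{n\ge0}S_n\to\mathbb{Z}_{\ge0}$ denote the function which gives the number of $j$-cycles of its input, and let $f\in\mathbb{Q}[m_1,m_2,\dots]$ be an arbitrary nonconstant polynomial. Let $d$ be the total degree of $f$, where each variable $m_j$ is treated as having degree $j$. For all integers $n\ge k\ge0$, define $$E_f(n,k):=\frac1{n!}\sum_{\pi\in S_n}f(\pi)\cdot N_{\mathrm{id}_k}(\pi).$$ Then: (i) There exist rational coefficients $\theta_f^{0,0}$ and $\theta_f^{i,\ell}$ ($1\le\ell\le d$, $1\le i\le3\ell$), independent of $n$ and $k$, such that $$E_f(n,k)=\theta_f^{0,0}\cdot\frac1{k!}\binom nk+\sum_{\substack{1\le\ell\le d\\1\le i\le3\ell}}\theta_f^{i,\ell}\cdot\frac{(n-\ell)!}{n!}\cdot\frac{(\frac i2)!}{(k-\frac i2)!}\binom{n-\ell+\frac i2}{k}$$ for all $k\ge0$ and $n\ge k+d-1$ with $(n,k)\ne(d-1,0)$. (ii) For fixed $k\ge0$, there exists a polynomial $a_f^{(k)}\in\mathbb{Q}[n]$ of degree at most $k$ such that $E_f(n,k)=a_f^{(k)}(n)$ for all $n\ge k+d-1$ with $(n,k)\ne(d-1,0)$. (iii) For all $j\ge0$, there exists a polynomial $b_f^{(j)}\in\mathbb{Q}[n]$ of degree at most $d+2j$ such that $$E_f(n,n-j)=\frac{b_f^{(j)}(n)}{n!}$$ for all $n\ge\max(j,d-1)$.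
   Context: For $\pi\in S_n$ and $k\ge0$, $N_{\mathrm{id}_k}(\pi)$ is the number of index sequences $1\le i_1<\dots<i_k\le n$ with $\pi(i_1)<\dots<\pi(i_k)$ (so $N_{\mathrm{id}_0}(\pi)=1$). For $\pi\in S_n$, $f(\pi)$ denotes the value of the polynomial $f$ at $m_1(\pi),m_2(\pi),\dots$. Conventions: $x!:=\Gamma(x+1)$ for real $x$, with $x!:=\infty$ if $x$ is a negative integer and $y/\infty:=0$ for finite $y$; $\binom xk:=\frac1{k!}\prod_{i=0}^{k-1}(x-i)$. *)

(* Defs.v *)
From HB Require Import structures.
From mathcomp Require Import all_boot all_order all_fingroup all_algebra finmap.
From mathcomp Require Import all_classical all_reals all_analysis.
(* The notations of monalg clash with those of mathcomp-analysis. *)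
From mathcomp Require Import -(notations) monalg.

Set Implicit Arguments.
Unset Strict Implicit.
Unset Printing Implicit Defensive.

Import Order.TTheory GRing.Theory Num.Theory.
Import numFieldNormedType.Exports.

Local Open Scope ring_scope.

(* Q[m_1, m_2, ...]: the index j : nat stands for the variable m_(j+1). *)
Definition cycpoly := @malg (cmonom nat) rat.

Definition wdeg (f : cycpoly) : nat :=
  (\max_(m <- msupp f) \sum_(j <- finsupp (cmonom_val m)) m j * j.+1)%N.

Definition is_const (f : cycpoly) : Prop :=
  exists c : rat, f = mkmalgU (onecm nat) c.

Definition qeval (x : nat -> rat) (f : cycpoly) : rat :=
  mmap idfun (fun m : cmonom nat => \prod_(j <- finsupp (cmonom_val m)) x j ^+ m j) f.

Definition ncycles (n j : nat) (s : 'S_n) : nat :=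
  #|[set c in porbits s | #|c| == j]|.

Definition Nid (n k : nat) (s : 'S_n) : nat :=
  #|[set t : k.-tuple 'I_n |
      sorted ltn [seq val i | i <- t] && sorted ltn [seq val (s i) | i <- t]]|.

Definition Ef (f : cycpoly) (n k : nat) : rat :=
  (n`!%:R)^-1 *
  \sum_(s : 'S_n) qeval (fun j => (ncycles j.+1 s)%:R) f * (Nid k s)%:R.

Definition gbinom (F : fieldType) (x : F) (k : nat) : F :=
  (k`!%:R)^-1 * \prod_(i < k) (x - i%:R).

Section GammaFunction.
Context {R : realType}.
Implicit Types x : R.

Definition gamma_int x : R :=
  \int[@lebesgue_measure R]_(t in `]0, +oo[%classic) (t `^ (x - 1) * expR (- t)).

(* For x <= 0 the integral diverges and Gamma is continued by
   Gamma (x + 1) = x * Gamma x, shifting x by the least N with 0 < x + N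
   (N = 0 when 0 < x). The value 0 at the poles is a junk value. *)
Definition Gamma x : R :=
  let N := Num.truncn (1 - x) in
  gamma_int (x + N%:R) / \prod_(i < N) (x + i%:R).

(* The convention x! = oo at negative integers; in \bar R, y / +oo = 0. *)
Definition gfact x : \bar R :=
  if (x \is a Num.int) && (x < 0) then +oo%E else (Gamma (x + 1))%:E.

End GammaFunction.

(* Main.v *)
Require Import Defs.
From HB Require Import structures.
From mathcomp Require Import all_boot all_order all_fingroup all_algebra finmap.
From mathcomp Require Import all_classical all_reals all_analysis.
From mathcomp Require Import -(notations) monalg.
From mathcomp Require Import measurable_realfun.
From mathcomp Require Import ring lra zify.

Set Implicit Arguments.
Unset Strict Implicit.
Unset Printing Implicit Defensive.

Import Order.TTheory GRing.Theory Num.Theory.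
Import numFieldNormedType.Exports.

Local Open Scope ring_scope.

(** The products [Gf lam] of falling factorials of the cycle counts span the
polynomials in the cycle counts, so it suffices to average [Gf lam] times the number
of increasing subsequences. Scan the points n, n - 1, ..., 1, recording for each whether
it lies in the domain I and in the image J of the subsequence. A point of J is the image
of the oldest point of I still waiting; contracting that arrow leaves a smaller
permutation whose points carry weights. The average becomes a recursion [V] over the scan,
in which an l-cycle is a composition of l into the weights of its pieces.

Peeling a mark off [V] ([V_cons_step]) yields an exchange law for the marks, which makes
[V] polynomial in n of controlled degree on the lines n - k = j: this is (iii). It also
yields, for the lists of marks that occur, a two-term recurrence in (n, k). Its initial
line n = k + l is a polynomial vanishing at 0 and -1; expanding it in the polynomials
prod_(t < i) (x + i/2 - t), which are even or odd under x -> -1 - x, solves the recurrence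
by the half-integer binomials of (i). Extending the recurrence to negative n shows that
the numerator vanishes at l consecutive integers, whence the polynomiality (ii). Finally
(ii) propagates (i) to the boundary n = k + d - 1, and the Gamma quotient is evaluated by
the functional equation. *)

(** * The scan recursion and its marks *)

(** Falling factorials suit the contraction because one more cycle of length l changes [Gf] only by
    the deletion of entries l ([Gf_shift]). The obstacle is the queue: [V] as defined runs through
    queues of unbounded length. [V_cons_step] is closed on the empty queue, and this is what yields
    recurrences in n and the marks alone. Of these recurrences, only those for [mk 0] and [mk 1]
    trade a mark for fewer marks. The exchange law turns two positive marks l1, l2 into 1 and l1 +
    l2 - 1, so these two and the single marks suffice. Each mark costs two degrees in n: the
    coefficient in the recurrence is linear, and summation adds one. With l marks and a <= l chosen
    fixed points the degree is at most a + 2 l, the source of the bound 3 l on i. The zeros 0 and -1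
    of the initial polynomial are exchanged by x -> -1 - x; this kills the coefficient i = 0, so
    that i starts at 1. *)

Section PopRep.
Context {T : Type}.
Implicit Types (e : T -> rat) (h : T -> T) (G : seq T -> rat) (s : seq T).

(** Removal is by position, so equal entries count separately: k unconstrained marks will contribute
    k!, the number of permutations of k points. *)
Fixpoint pop e G s : rat :=
  if s is x :: s' then e x * G s' + pop e (fun t => G (x :: t)) s' else 0.

Fixpoint rep h G s : rat :=
  if s is x :: s' then G (h x :: s') + rep h (fun t => G (x :: t)) s' else 0.

Lemma eq_pop e e' G G' s : e =1 e' -> G =1 G' -> pop e G s = pop e' G' s.
Proof. by move=> /funext -> /funext ->. Qed.

Lemma pop0 e s : pop e (fun=> 0) s = 0.
Proof. by elim: s => //= x s ->; rewrite mulr0 addr0. Qed.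

Lemma popD e G G' s : pop e (fun t => G t + G' t) s = pop e G s + pop e G' s.
Proof. by elim: s G G' => [|x s IH] G G' /=; rewrite ?addr0 // IH; ring. Qed.

Lemma popZ e c G s : pop e (fun t => c * G t) s = c * pop e G s.
Proof. by elim: s G => [|x s IH] G /=; rewrite ?mulr0 // IH; ring. Qed.

Lemma popB e G G' s : pop e (fun t => G t - G' t) s = pop e G s - pop e G' s.
Proof. by elim: s G G' => [|x s IH] G G' /=; rewrite ?subr0 // IH; ring. Qed.

Lemma pop_sum e I (r : seq I) (P : pred I) (F : I -> seq T -> rat) s :
  pop e (fun t => \sum_(i <- r | P i) F i t) s = \sum_(i <- r | P i) pop e (F i) s.
Proof.
elim: r => [|i r IH].
  by rewrite big_nil -[RHS](pop0 e s); apply: eq_pop => // t; rewrite big_nil.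
rewrite big_cons -IH.
have -> : (fun t => \sum_(j <- i :: r | P j) F j t) =
  (fun t => (if P i then F i t else 0) + \sum_(j <- r | P j) F j t).
  by apply/funext => t; rewrite big_cons; case: (P i); rewrite ?add0r.
by rewrite popD; case: (P i) => //; rewrite pop0 add0r.
Qed.

Lemma popDe e e' G s : pop (fun x => e x + e' x) G s = pop e G s + pop e' G s.
Proof. by elim: s G => [|x s IH] G /=; rewrite ?addr0 // IH; ring. Qed.

Lemma popZe c e G s : pop (fun x => c * e x) G s = c * pop e G s.
Proof. by elim: s G => [|x s IH] G /=; rewrite ?mulr0 // IH; ring. Qed.

Lemma pop0e G s : pop (fun=> 0) G s = 0.
Proof. by elim: s G => //= x s IH G; rewrite IH mul0r addr0. Qed.

Lemma pop_sume I (r : seq I) (P : pred I) (F : I -> T -> rat) G s :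
  pop (fun x => \sum_(i <- r | P i) F i x) G s =
  \sum_(i <- r | P i) pop (F i) G s.
Proof.
elim: r => [|i r IH].
  by rewrite big_nil -[RHS](pop0e G s); apply: eq_pop => // x; rewrite big_nil.
rewrite big_cons -IH.
have -> : (fun x => \sum_(j <- i :: r | P j) F j x) =
  (fun x => (if P i then F i x else 0) + \sum_(j <- r | P j) F j x).
  by apply/funext => x; rewrite big_cons; case: (P i) => //; rewrite add0r.
by rewrite popDe; case: (P i) => //; rewrite pop0e add0r.
Qed.

Lemma popC e e' G s : pop e (pop e' G) s = pop e' (pop e G) s.
Proof.
elim: s G => //= x s IH G; rewrite !popD !popZ.
move: (IH (fun t => G (x :: t))) => /= {}IH; rewrite [X in _ + (_ + X) = _]IH; ring.
Qed.

Lemma repD h G G' s : rep h (fun t => G t + G' t) s = rep h G s + rep h G' s.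
Proof. by elim: s G G' => [|x s IH] G G' /=; rewrite ?addr0 // IH; ring. Qed.

Lemma repZ h c G s : rep h (fun t => c * G t) s = c * rep h G s.
Proof. by elim: s G => [|x s IH] G /=; rewrite ?mulr0 // IH; ring. Qed.

(** Leibniz rule: the entry removed is either an untouched one or the one just replaced. *)
Lemma rep_pop h e G s :
  rep h (pop e G) s = pop e (rep h G) s + pop (fun x => e (h x)) G s.
Proof.
elim: s G => [|x s IH] G /=; first by rewrite addr0.
rewrite repD repZ popD.
by move: (IH (fun t => G (x :: t))) => /= ->; ring.
Qed.

Definition swap_inv G := forall s x y t, G (s ++ x :: y :: t) = G (s ++ y :: x :: t).

Lemma swap_inv_pop e G : swap_inv G -> swap_inv (pop e G).
Proof.
move=> HG s; elim: s G HG => [|a s IH] G HG x y t /=.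
  rewrite (@eq_pop e e _ (fun u => G [:: y, x & u])) //; last exact: (HG [::]).
  ring.
congr (_ * _ + _); first exact: HG.
apply: (IH (fun t => G (a :: t))) => s' x' y' t' /=; exact: (HG (a :: s')).
Qed.

Lemma swap_inv_move G s x t : swap_inv G -> G (s ++ x :: t) = G (x :: s ++ t).
Proof.
move=> HG; elim: s G HG => [|a s IH] G HG //=.
rewrite (IH (fun t => G (a :: t))); first exact: (HG [::]).
by move=> s' x' y' t'; apply: (HG (a :: s')).
Qed.

Lemma pop_eq0 e G s :
  (forall s1 x s2, s = s1 ++ x :: s2 -> e x * G (s1 ++ s2) = 0) -> pop e G s = 0.
Proof.
elim: s G => //= x s IH G H; rewrite (H [::] x s) // add0r.
by apply: IH => s1 y s2 E; apply: (H (x :: s1)); rewrite E.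
Qed.

Lemma eq_rep h h' G G' s :
  (forall s1 x s2, s = s1 ++ x :: s2 -> G (s1 ++ h x :: s2) = G' (s1 ++ h' x :: s2)) ->
  rep h G s = rep h' G' s.
Proof.
elim: s G G' => //= x s IH G G' H; rewrite (H [::] x s) //; congr (_ + _).
by apply: IH => s1 y s2 E; apply: (H (x :: s1)); rewrite E.
Qed.

End PopRep.

Lemma pop_map {T U : Type} (f : U -> T) e G (r : seq U) :
  pop e G (map f r) = pop (fun x => e (f x)) (fun t => G (map f t)) r.
Proof. by elim: r G => //= x s IH G; rewrite IH. Qed.

#[global] Arguments pop : simpl never.

(* A mark is a function of the weight of the piece that consumes it. *)
Definition wfun := nat -> rat.

Section MarkedCycles.
Implicit Types (phi : wfun) (A : seq nat) (s : seq wfun) (chi x : wfun).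

Definition shf phi : wfun := fun c => phi c.+1.

(* [V n A phi s]: n points remain to be scanned, [A] lists the weights of the waiting points
   of I (oldest first), the marks [s] must each be consumed by one finished piece, and [phi]
   is evaluated at the number of fixed points. The factor 2 joins the cases "I only" and
   "J only", which inversion of the permutation exchanges when no point is waiting. *)
Fixpoint V n A phi s : rat :=
  if n is n'.+1 then
    pop (fun x => x 1%N) (V n' A phi) s +
    (if A is q :: A' then
       V n' (rcons A 1%N) phi s + V n' (rcons A' q.+1) phi s +
       pop (fun x => x q.+1) (V n' A' phi) s
     else V n' [::] (shf phi) s + 2 * V n' [:: 1%N] phi s)
  else if A is [::] then (if s is [::] then phi 0%N else 0) else 0.

#[global] Arguments V : simpl never.

Lemma VS0 n phi s : V n.+1 [::] phi s = pop (fun x => x 1%N) (V n [::] phi) s +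
  (V n [::] (shf phi) s + 2 * V n [:: 1%N] phi s).
Proof. by []. Qed.

Lemma VS1 n q A phi s : V n.+1 (q :: A) phi s =
  pop (fun x => x 1%N) (V n (q :: A) phi) s +
  (V n (rcons (q :: A) 1%N) phi s + V n (rcons A q.+1) phi s +
   pop (fun x => x q.+1) (V n A phi) s).
Proof. by []. Qed.

Lemma VphiD n A phi phi' s :
  V n A (fun c => phi c + phi' c) s = V n A phi s + V n A phi' s.
Proof.
elim: n A phi phi' s => [|n IH] A phi phi' s.
  by case: A => [|? ?]; case: s => [|? ?] /=; rewrite ?addr0.
have E B f f' : V n B (fun c => f c + f' c) = (fun t => V n B f t + V n B f' t).
  by apply/funext.
case: A => [|q A]; rewrite !(VS0, VS1).
  rewrite (_ : shf _ = (fun c => shf phi c + shf phi' c)) //.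
  by rewrite !E !popD; ring.
by rewrite !E !popD; ring.
Qed.

Lemma VphiZ n A k phi s : V n A (fun c => k * phi c) s = k * V n A phi s.
Proof.
elim: n A phi s => [|n IH] A phi s.
  by case: A => [|? ?]; case: s => [|? ?] /=; rewrite ?mulr0.
have E B f : V n B (fun c => k * f c) = (fun t => k * V n B f t).
  by apply/funext.
case: A => [|q A]; rewrite !(VS0, VS1).
  rewrite (_ : shf _ = (fun c => k * shf phi c)) //.
  by rewrite !E !popZ; ring.
by rewrite !E !popZ; ring.
Qed.

Lemma swap_inv_V n A phi : swap_inv (V n A phi).
Proof.
elim: n A phi => [|n IH] A phi s x y t; first by case: A s => [|? ?] [|? ?].
have P w B f : pop (fun x => x w) (V n B f) (s ++ x :: y :: t) =
    pop (fun x => x w) (V n B f) (s ++ y :: x :: t) by apply: swap_inv_pop.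
by case: A => [|q A]; rewrite !(VS0, VS1) !P !(IH _ _ s x y t).
Qed.

Lemma V_move n A phi s x t : V n A phi (s ++ x :: t) = V n A phi (x :: s ++ t).
Proof. exact/swap_inv_move/swap_inv_V. Qed.

(** Contribution of the queue to [V_cons_step]. The subtracted sum cancels the cuts that [conv chi]
    makes inside the weight a waiting point already carries. The whole term vanishes for the empty
    queue, but the induction passes through nonempty ones. *)
Fixpoint aterm chi (G : seq nat -> rat) A : rat :=
  if A is q :: A' then
    chi q.+1 * G A' - \sum_(1 <= g < q) chi g.+1 * G ((q - g)%N :: A') +
    aterm chi (fun t => G (q :: t)) A'
  else 0.

Lemma atermD chi G G' A :
  aterm chi (fun t => G t + G' t) A = aterm chi G A + aterm chi G' A.
Proof.
elim: A G G' => [|q A IH] G G' /=; rewrite ?addr0 // IH.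
under eq_bigr => g _ do rewrite mulrDr; rewrite big_split /=; ring.
Qed.

Lemma pop_aterm {T} (e : T -> rat) chi (F : seq nat -> seq T -> rat) A (s : seq T) :
  pop e (fun t => aterm chi (fun B => F B t) A) s =
  aterm chi (fun B => pop e (F B) s) A.
Proof.
elim: A F => [|q A IH] F /=; first exact: pop0.
rewrite popD popB popZ pop_sum (IH (fun B => F (q :: B))).
by congr (_ - _ + _); apply: eq_bigr => g _; rewrite popZ.
Qed.

Lemma aterm_rcons chi G A (x : nat) : aterm chi G (rcons A x) =
  aterm chi (fun t => G (rcons t x)) A +
  (chi x.+1 * G A - \sum_(1 <= g < x) chi g.+1 * G (rcons A (x - g)%N)).
Proof. by elim: A G => [|q A IH] G /=; [rewrite addr0 add0r | rewrite IH addrA]. Qed.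

Definition up chi : wfun := fun w => chi w.+1.
Definition star phi : wfun := fun c => c%:R * phi c.-1.
(** A piece of weight w is cut in two: the part of weight w - g keeps the mark [x], the part of
    weight g, lengthened by one, takes [chi]. *)
Definition conv chi x : wfun := fun w => \sum_(1 <= g < w) chi g.+1 * x (w - g)%N.

Lemma pop_conv chi w (G : seq wfun -> rat) s :
  pop (fun x => conv chi x w) G s =
  \sum_(1 <= g < w) chi g.+1 * pop (fun x => x (w - g)%N) G s.
Proof. by rewrite pop_sume; apply: eq_bigr => g _; rewrite popZe. Qed.

Lemma pop_cons {T} (e : T -> rat) G y (s : seq T) :
  pop e G (y :: s) = e y * G s + pop e (fun t => G (y :: t)) s.
Proof. by []. Qed.

Lemma V0_cons A phi y s : V 0 A phi (y :: s) = 0.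
Proof. by case: A. Qed.

Lemma rep0 {T} (h : T -> T) (s : seq T) : rep h (fun=> 0) s = 0.
Proof. by elim: s => //= x s ->; rewrite addr0. Qed.

Lemma aterm0 chi A : aterm chi (fun=> 0) A = 0.
Proof.
elim: A => //= q A ->; rewrite mulr0 addr0 big1 ?subr0 // => g _.
by rewrite mulr0.
Qed.

Lemma rep_V0 h A phi s : rep h (V 0 A phi) s = 0.
Proof.
case: s => //= y s; rewrite V0_cons add0r -[RHS](rep0 h s); congr rep.
by apply/funext => t; rewrite V0_cons.
Qed.

(* Removes a step at the end of the scan instead of its beginning, so that the marks rather
   than the queue drive the recursion. *)
Lemma V_cons_step n A phi chi s : all (ltn 0) A ->
  V n.+1 A phi (chi :: s) =
  V n A phi (up chi :: s) + chi 1%N * n.+1%:R * V n A phi s +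
  chi 2%N * V n A (star phi) s + rep (conv chi) (V n A phi) s +
  aterm chi (fun B => V n B phi s) A.
Proof.
elim: n A phi s => [|n IH] A phi s A0.
  have E w B f : pop (fun x => x w) (V 0 B f) (chi :: s) = chi w * V 0 B f s.
    rewrite pop_cons -[RHS]addr0; congr (_ + _); rewrite -[RHS](pop0 (fun x => x w) s).
    by congr pop; apply/funext => t; rewrite V0_cons.
  rewrite rep_V0 V0_cons; case: A A0 => [|q A] A0.
    rewrite VS0 E !V0_cons /=.
    by case: s {E A0} => [|? ?]; rewrite /V /star /=; ring.
  rewrite VS1 !E !V0_cons /= (_ : V 0 (q :: A) _ _ = 0) // (_ : V 0 (q :: A) _ _ = 0) //.
  rewrite big1 => [|g _]; last by rewrite /V mulr0.
  rewrite (_ : (fun t => V 0 (q :: t) phi s) = fun=> 0) ?aterm0; first by ring.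
  by apply/funext.
have E w B f : all (ltn 0) B -> pop (fun x => x w) (V n.+1 B f) (chi :: s) =
   chi w * V n.+1 B f s + (pop (fun x => x w) (fun t => V n B f (up chi :: t)) s
   + chi 1%N * n.+1%:R * pop (fun x => x w) (V n B f) s +
  chi 2%N * pop (fun x => x w) (V n B (star f)) s
   + pop (fun x => x w) (rep (conv chi) (V n B f)) s +
  aterm chi (fun C => pop (fun x => x w) (V n C f) s) B).
  move=> B0; rewrite pop_cons; congr (_ + _).
  by rewrite -pop_aterm -!popZ -!popD; congr pop; apply/funext => t; apply: IH.
case: A A0 => [|q A] A0.
   rewrite [LHS]VS0 E // !IH // [V n.+1 _ _ (up chi :: s)]VS0 pop_cons.
  (* The queue [[:: 1]] yields [chi 2 * V n [::] phi s] twice through [aterm]. One copy is matched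
     by consuming [up chi] at weight 1, the other by the extra [phi] of this commutation rule. *)
  have Es : shf (star phi) = (fun c => star (shf phi) c + phi c).
    by apply/funext => -[|c]; rewrite /shf /star /=; ring.
  rewrite [V n.+1 _ (star phi) s]VS0 Es VphiD.
  rewrite (_ : V n.+1 [::] phi = (fun t => pop (fun x => x 1%N) (V n [::] phi) t +
    (V n [::] (shf phi) t + 2 * V n [:: 1%N] phi t))); last first.
    by apply/funext => t; rewrite VS0.
  rewrite !repD repZ rep_pop pop_conv big_geq //=  big_geq //.
  rewrite /up -[in n.+2%:R]addn1 natrD; ring.
have Es : V n.+1 (q :: A) phi = (fun t => pop (fun x => x 1%N) (V n (q :: A) phi) t +
    (V n (rcons (q :: A) 1%N) phi t + V n (rcons A q.+1) phi t +
     pop (fun x => x q.+1) (V n A phi) t)).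
  by apply/funext => t; rewrite VS1.
have /andP[q0 A1] := A0.
rewrite [LHS]VS1 !E ?IH ?all_rcons //= [V n.+1 _ _ (up chi :: s)]VS1 !pop_cons.
rewrite [V n.+1 _ (star phi) s]VS1 Es !repD !rep_pop !pop_conv.
rewrite -/(V n.+1 (q :: A) phi) !aterm_rcons /=.
have EA : (fun t => V n.+1 (q :: t) phi s) = (fun t =>
   pop (fun x => x 1%N) (V n (q :: t) phi) s +
   (V n (q :: rcons t 1%N) phi s + V n (rcons t q.+1) phi s +
   pop (fun x => x q.+1) (V n t phi) s)).
  by apply/funext => t; rewrite VS1.
rewrite EA !atermD.
have ES : \sum_(1 <= g < q) chi g.+1 * V n.+1 ((q - g)%N :: A) phi s =
  \sum_(1 <= g < q) chi g.+1 * pop (fun x => x 1%N) (V n ((q - g)%N :: A) phi) s +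
  (\sum_(1 <= g < q) chi g.+1 * V n ((q - g)%N :: rcons A 1%N) phi s +
   \sum_(1 <= g < q) chi g.+1 * V n (rcons A (q.+1 - g)%N) phi s +
   \sum_(1 <= g < q) chi g.+1 * pop (fun x => x (q.+1 - g)%N) (V n A phi) s).
  rewrite -!big_split; apply: eq_big_nat => g /andP[_ gq].
  by rewrite VS1 (subSn (ltnW gq)) /=; ring.
have Z (F : nat -> rat) : \sum_(1 <= i < 1) F i = 0 by rewrite big_geq.
rewrite ES !Z !big_nat_recr // subSnn /=.
by rewrite /up -[in n.+2%:R]addn1 natrD; ring.
Qed.

Lemma rep_map_sub (G : seq wfun -> rat) (f : nat -> wfun) (c : nat -> rat)
    (h h' : wfun -> wfun) ls :
  (forall s x k y t, G (s ++ (fun w => x w - k * y w) :: t) =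
     G (s ++ x :: t) - k * G (s ++ y :: t)) ->
  (forall l, h (f l) = (fun w => h' (f l) w - c l * f l w)) ->
  rep h G (map f ls) = rep h' G (map f ls) - (\sum_(l <- ls) c l) * G (map f ls).
Proof.
move=> HG Hh; elim: ls G HG => [|l ls IH] G HG /=.
  by rewrite big_nil mul0r subr0.
rewrite Hh (HG [::]) IH => [|s x k y t]; last exact: (HG (f l :: s)).
by rewrite big_cons /=; ring.
Qed.

Lemma V_ext n A phi x y s : (forall w, (0 < w)%N -> x w = y w) ->
  V n A phi (x :: s) = V n A phi (y :: s).
Proof.
move=> xy; elim: n A phi s => [|n IH] A phi s; first by rewrite !V0_cons.
have P w B f : pop (fun x => x w.+1) (V n B f) (x :: s) =
    pop (fun x => x w.+1) (V n B f) (y :: s).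
  by rewrite !pop_cons xy //; congr (_ + _); apply: eq_pop.
by case: A => [|q A]; rewrite !(VS0, VS1) !P !IH.
Qed.

Lemma V_head_sub n A phi x k y s :
  V n A phi ((fun w => x w - k * y w) :: s) =
  V n A phi (x :: s) - k * V n A phi (y :: s).
Proof.
elim: n A phi s => [|n IH] A phi s; first by rewrite !V0_cons mulr0 subr0.
have P w B f : pop (fun x => x w) (V n B f) ((fun w => x w - k * y w) :: s) =
    pop (fun x => x w) (V n B f) (x :: s) - k * pop (fun x => x w) (V n B f) (y :: s).
  rewrite !pop_cons (_ : (fun t => V n B f (_ :: t)) =
    (fun t => V n B f (x :: t) - k * V n B f (y :: t))).
    by rewrite popB popZ; ring.
  by apply/funext => t; apply: IH.
by case: A => [|q A]; rewrite !(VS0, VS1) !P !IH; ring.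
Qed.

Lemma V_sub n A phi s x k y t :
  V n A phi (s ++ (fun w => x w - k * y w) :: t) =
  V n A phi (s ++ x :: t) - k * V n A phi (s ++ y :: t).
Proof. by rewrite !V_move V_head_sub. Qed.

(* Compositions of cycle lengths give marks [ex p]; by [ex p.+1 = mk p - mk p.+1] they reduce to [mk]. *)
Definition ex (p : nat) : wfun := fun w => (w == p)%:R.
Definition mk (l : nat) : wfun := fun w => (l < w)%:R.

Lemma V_head_sum N n A phi x s : (n + sumn A < N)%N ->
  V n A phi (x :: s) = \sum_(0 <= r < N) x r * V n A phi (ex r :: s).
Proof.
elim: n A phi s => [|n IH] A phi s nN.
  by rewrite V0_cons big1 // => r _; rewrite V0_cons mulr0.
have P w B f : (n + sumn B < N)%N -> (w < N)%N ->
    pop (fun x => x w) (V n B f) (x :: s) =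
    \sum_(0 <= r < N) x r * pop (fun x => x w) (V n B f) (ex r :: s).
  move=> nB wN; rewrite pop_cons.
  under [RHS]eq_bigr => r _ do rewrite pop_cons mulrDr mulrA.
  rewrite big_split /= -mulr_suml; congr (_ * _ + _).
    rewrite (bigD1_seq w) ?mem_index_iota ?iota_uniq //= /ex eqxx mulr1.
    by rewrite big1 ?addr0 // => r rw; rewrite eq_sym (negPf rw) mulr0.
  have -> : (fun t => V n B f (x :: t)) =
     (fun t => \sum_(0 <= r < N) x r * V n B f (ex r :: t)).
    by apply/funext => t; apply: IH.
  by rewrite pop_sum; apply: eq_bigr => r _; rewrite popZ.
case: A nN => [|q A] /= nN.
  rewrite VS0 (P 1%N [::]) /=; [|lia|lia].
  rewrite (IH [::]) /=; last lia.
  rewrite (IH [:: 1%N]) /=; last lia.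
  by rewrite mulr_sumr -!big_split; apply: eq_bigr => r _; rewrite VS0 /=; ring.
rewrite VS1 (P 1%N (q :: A)) /=; [|lia|lia].
rewrite (P q.+1 A) /=; [|lia|lia].
rewrite (IH (q :: rcons A 1%N)) /= ?sumn_rcons /=; last lia.
rewrite (IH (rcons A q.+1)) ?sumn_rcons /=; last lia.
by rewrite -!big_split; apply: eq_bigr => r _; rewrite VS1 /=; ring.
Qed.

Lemma V_size n A phi s : (n < size s)%N -> V n A phi s = 0.
Proof.
elim: n A phi s => [|n IH] A phi s ns; first by case: s ns => // ? ? _; rewrite V0_cons.
have P w B f : pop (fun x => x w) (V n B f) s = 0.
  apply: pop_eq0 => s1 x s2 E; rewrite IH ?mulr0 //.
  by move: ns; rewrite E !size_cat /=; lia.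
by case: A => [|q A]; rewrite !(VS0, VS1) !P !IH //; lia || ring.
Qed.

Definition ffall (a : nat) : wfun := fun c => (c ^_ a)%:R.

Lemma star_ffall a : star (ffall a) = ffall a.+1.
Proof. by apply/funext => c; rewrite /star /ffall -natrM ffactnS. Qed.

Lemma mul_ffall a : (fun c => c%:R * ffall a c) =
  (fun c => ffall a.+1 c + a%:R * ffall a c).
Proof.
apply/funext => c; rewrite /ffall -!natrM -natrD; congr _%:R.
rewrite ffactnSr; case: (leqP a c) => [ac|ca]; first by rewrite mulnBr [(c ^_ a * a)%N]mulnC subnK 1?mulnC // leq_mul2l ac orbT.
by rewrite ffact_small // !muln0.
Qed.

Lemma shf_ffall a : shf (ffall a) = (fun c => ffall a c + a%:R * ffall a.-1 c).
Proof.
apply/funext => c; rewrite /shf /ffall -natrM -natrD; congr _%:R.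
case: a => [|a]; first by rewrite !ffactn0 mul0n addn0.
rewrite ffactnS ffactnSr /=; case: (leqP a c) => [ac|ca]; last by rewrite ffact_small // !muln0.
by rewrite -{1}(subnK ac) -addnS mulnDl [X in (X + _)%N = _]mulnC.
Qed.

(** Weight is conserved: a nonzero term needs a fixed points and weight at least l + 1 for each mark
    [mk l], out of the total [n + sumn A]. *)
Lemma V_small n A a ls : (n + sumn A < a + sumn ls + size ls)%N ->
  V n A (ffall a) (map mk ls) = 0.
Proof.
elim: n A a ls => [|n IH] A a ls H.
  case: A ls H => [|q A] [|l ls] //= H; rewrite /V /ffall ffact_small //; lia.
have P w B : (n + sumn B + w < a + sumn ls + size ls)%N ->
    pop (fun x => x w) (V n B (ffall a)) (map mk ls) = 0.
  move=> HB; rewrite pop_map; apply: pop_eq0 => s1 l s2 E.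
  rewrite /mk; case: ltnP => lw; last by rewrite mul0r.
  rewrite IH ?mulr0 //; move: HB; rewrite E !sumn_cat !size_cat /=; lia.
case: A H => [|q A] /= H.
  rewrite VS0 P ?shf_ffall ?VphiD ?VphiZ /=; last lia.
  rewrite IH /=; last lia.
  rewrite (IH [:: 1%N]) /=; last lia.
  case: a {P} IH H => [|a] IH H; first by ring.
  by rewrite IH /=; [ring | lia].
rewrite VS1 P /=; last lia.
rewrite P /=; last lia.
rewrite (IH (rcons (q :: A) 1%N)); last by rewrite sumn_rcons /=; lia.
rewrite IH; last by rewrite sumn_rcons /=; lia.
by ring.
Qed.

Definition wmul x : wfun := fun w => w%:R * x w.

(** Every unit of weight ends in a fixed point or in a finished piece; [rep wmul] is the Euler
    operator that counts the latter. *)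
Lemma V_weight_count n A phi s :
  V n A (fun c => c%:R * phi c) s + rep wmul (V n A phi) s =
  (n + sumn A)%:R * V n A phi s.
Proof.
elim: n A phi s => [|n IH] A phi s.
  rewrite rep_V0; case: A s => [|q A] [|? ?]; rewrite /V /=; ring.
have P w B f : pop (fun x => x w) (V n B (fun c => c%:R * f c)) s +
    pop (fun x => x w) (rep wmul (V n B f)) s =
    (n + sumn B)%:R * pop (fun x => x w) (V n B f) s.
  by rewrite -popD -popZ; apply: eq_pop.
have Q w B f : pop (fun x => wmul x w) (V n B f) s =
   w%:R * pop (fun x => x w) (V n B f) s by rewrite -popZe.
case: A => [|q A].
  rewrite VS0 (_ : V n.+1 [::] phi = (fun t => pop (fun x => x 1%N) (V n [::] phi) t +
    (V n [::] (shf phi) t + 2 * V n [:: 1%N] phi t))); last first.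
    by apply/funext => t; rewrite VS0.
  rewrite !repD repZ rep_pop Q.
  have := P 1%N [::] phi; have := IH [:: 1%N] phi s; have := IH [::] (shf phi) s.
  rewrite (_ : shf (fun c => c%:R * phi c) =
    (fun c => c%:R * shf phi c + shf phi c)); last first.
    by apply/funext => c; rewrite /shf -natr1; ring.
  rewrite VphiD /= !addn0 addn1 -natr1 => E1 E2 E3.
  by rewrite -(subr0 (_ + _)) -(subrr 0); lra.
rewrite VS1 (_ : V n.+1 (q :: A) phi = (fun t => pop (fun x => x 1%N) (V n (q :: A) phi) t +
    (V n (rcons (q :: A) 1%N) phi t + V n (rcons A q.+1) phi t +
     pop (fun x => x q.+1) (V n A phi) t))); last first.
  by apply/funext => t; rewrite VS1.
rewrite !repD !rep_pop !Q.
have := P 1%N (q :: A) phi; have := P q.+1 A phi.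
have := IH (rcons (q :: A) 1%N) phi s; have := IH (rcons A q.+1) phi s.
rewrite !sumn_rcons /= !natrD -!(natr1 q) -!(natr1 n) => E1 E2 E3 E4.
lra.
Qed.

Definition shift (p : nat) x : wfun := fun w => if (p < w)%N then x (w - p)%N else 0.

Lemma up_ex p : up (ex p.+1) = ex p.
Proof. by apply/funext => w; rewrite /up /ex eqSS. Qed.

Lemma conv_ex p x : (0 < p)%N -> conv (ex p.+1) x = shift p x.
Proof.
move=> p0; apply/funext => w; rewrite /conv /shift /ex; case: ltnP => pw.
  rewrite (bigD1_seq p) ?mem_index_iota ?iota_uniq ?p0 //= eqxx mul1r.
  by rewrite big1 ?addr0 // => g gp; rewrite eqSS (negPf gp) mul0r.
rewrite big_nat big1 // => g /andP[_ gw]; rewrite eqSS ltn_eqF ?mul0r //; lia.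
Qed.

Lemma shift_ex p q : (0 < q)%N -> shift p (ex q) = ex (p + q).
Proof.
move=> q0; apply/funext => w; rewrite /shift /ex; case: ltnP => pw.
  by congr (_%:R); congr (nat_of_bool _); lia.
by rewrite ltn_eqF //; lia.
Qed.

Lemma sum_shift M p x (F : nat -> rat) :
  \sum_(0 <= r < M + p) shift p x r * F r =
  \sum_(0 <= r < M) (if (0 < r)%N then x r else 0) * F (r + p)%N.
Proof.
rewrite (@big_cat_nat _ _ _ p) ?leq_addl //= [X in X + _]big_nat big1 ?add0r.
  rewrite -{1}[p]add0n big_addn addnK; apply: eq_bigr => r _.
  by rewrite /shift addnK -{1}[p]add0n ltn_add2r.
by move=> r /andP[_ rp]; rewrite /shift ltnNge (ltnW rp) mul0r.
Qed.

(* Expanding either side by [V_cons_step] gives the same terms, except those in which a third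
   mark is lengthened by p or by q: they have one mark less and agree by induction. *)
Lemma V_ex_shift n phi p q s : (1 < p)%N -> (1 < q)%N ->
  V n [::] phi (ex p.+1 :: ex q :: s) = V n [::] phi (ex p :: ex q.+1 :: s).
Proof.
have [m] := ubnP (size s); elim: m s n p q => // m IH s [|n] p q sm p1 q1.
  by rewrite !V0_cons.
have dep k s' a b c : (size s' < m)%N -> (1 < a)%N -> (1 < b)%N ->
   V k [::] phi (ex (a + c) :: ex b :: s') = V k [::] phi (ex a :: ex (b + c) :: s').
  move=> s'm a1 b1; elim: c a b a1 b1 => [|c IHc] a b a1 b1; first by rewrite !addn0.
  by rewrite addnS IH ?IHc ?addSnnS //; lia.
have E p' q' : (1 < p')%N -> V n.+1 [::] phi (ex p'.+1 :: ex q' :: s) =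
   V n [::] phi (ex p' :: ex q' :: s) + V n [::] phi (shift p' (ex q') :: s) +
   rep (shift p') (fun t => V n [::] phi (ex q' :: t)) s.
  move=> p'1; rewrite V_cons_step // up_ex /= conv_ex; last lia.
  rewrite /ex !eqn_leq; do 2?rewrite ltnNge; have -> : (p' < 1)%N = false by lia.
  have -> : (p' < 2)%N = false by lia.
  rewrite !andbF !mul0r !addr0 (_ : conv _ = shift p') ?addrA //.
  by apply/funext => x; rewrite -conv_ex //; lia.
rewrite E // (swap_inv_V n.+1 [::] phi [::]) /= E //.
rewrite !shift_ex ?(ltnW p1) ?(ltnW q1) // addnC.
rewrite (swap_inv_V n [::] phi [::] (ex p)) /=; congr (_ + _ + _).
apply: eq_rep => s1 x s2 Es.
have H p' t : V n [::] phi (shift p' x :: t) = \sum_(0 <= r < n.+1)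
    (if (0 < r)%N then x r else 0) * V n [::] phi (ex (r + p') :: t).
  by rewrite (@V_head_sum (n.+1 + p')) ?sum_shift //=; lia.
rewrite -!cat_cons !V_move /= !H; apply: eq_bigr => r _.
case: ltnP => r0; last by rewrite !mul0r.
congr (_ * _).
have s'm : (size (s1 ++ s2) < m)%N by move: sm; rewrite Es !size_cat /=; lia.
(* Moving the difference of p and q from one mark to the other turns [ex (r + q)], [ex p] into
   [ex (r + p)], [ex q]. *)
case: (leqP q p) => pq.
  have := dep n _ (r + q)%N q (p - q)%N s'm.
  by rewrite -addnA subnKC // => -> //; lia.
have := dep n _ (r + p)%N p (q - p)%N s'm.
by rewrite -addnA subnKC ?(ltnW pq) // => -> //; lia.
Qed.

(** [mk l] is the sum of [ex r] over r > l. Positive l1 and l2 keep all these r above 1, where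
    [V_ex_shift] applies. *)
Lemma V_mk_shift n phi l1 l2 s : (0 < l1)%N -> (0 < l2)%N ->
  V n [::] phi (mk l1.+1 :: mk l2 :: s) = V n [::] phi (mk l1 :: mk l2.+1 :: s).
Proof.
move=> l1_gt0 l2_gt0.
have H N1 N2 x y : (n < N1)%N -> (n < N2)%N -> V n [::] phi (x :: y :: s) =
   \sum_(0 <= r < N1) \sum_(0 <= r' < N2) x r * y r' * V n [::] phi (ex r :: ex r' :: s).
  move=> n1 n2; rewrite (@V_head_sum N1) /= ?addn0 //; apply: eq_bigr => r _.
  rewrite (swap_inv_V n [::] phi [::]) /= (@V_head_sum N2) /= ?addn0 // mulr_sumr.
  by apply: eq_bigr => r' _; rewrite mulrA (swap_inv_V n [::] phi [::] (ex r)).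
(* The ranges are unequal so that dropping a zero first term and reindexing aligns the two sides. *)
rewrite (H n.+2 n.+1) // [RHS](H n.+1 n.+2) //.
have mk00 l : mk l 0 = 0 by [].
rewrite big_nat_recl // big1 => [|r _]; last by rewrite mk00 !mul0r.
rewrite add0r; apply: eq_bigr => r _.
rewrite [RHS]big_nat_recl // mk00 mulr0 mul0r add0r.
apply: eq_bigr => r' _; rewrite /mk !ltnS.
case: ltnP => l1r; last by rewrite !mul0r.
case: ltnP => l2r'; last by rewrite !mulr0 !mul0r.
by rewrite V_ex_shift //; lia.
Qed.

Lemma mk_sub l : mk l = (fun w => mk l.+1 w - (-1) * ex l.+1 w).
Proof.
apply/funext => w; rewrite /mk /ex [(l < w)%N]leq_eqVlt eq_sym.
by case: (w =P l.+1) => [->|_]; rewrite ?ltnn /=; ring.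
Qed.

(** In [V_cons_step], a piece of weight w > l can be cut by [mk 0] in w - (l + 1) ways that respect
    [mk l]. By [V_weight_count] the terms in w and the [star] term add up to n - a; adding n + 1 and
    subtracting all l + 1 gives the coefficient. *)
Lemma V_zero_rec n a ls :
  V n.+1 [::] (ffall a) (mk 0 :: map mk ls) = V n [::] (ffall a) (mk 0 :: map mk ls) +
  ((2 * n + 1)%:R - (a + sumn ls + size ls)%:R) * V n [::] (ffall a) (map mk ls).
Proof.
rewrite V_cons_step //= star_ffall addr0 (V_ext _ _ _ (y := mk 0)) => [|w w0]; last first.
  by rewrite /up /mk w0.
have Hc l : conv (mk 0) (mk l) = (fun w => wmul (mk l) w - (l.+1)%:R * mk l w).
  apply/funext => w; rewrite /conv /wmul /mk.
  under eq_big_nat => g /andP[g0 gw] do rewrite mul1r.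
  case: ltnP => lw; last first.
    rewrite big_nat big1 ?mulr0 ?subrr // => g /andP[g1 g2]; rewrite ltnNge.
    by have -> : (w - g <= l)%N by lia.
  rewrite !mulr1 (@big_cat_nat _ _ _ (w - l)) ?leq_subr //=; last lia.
  rewrite [X in _ + X]big_nat [X in _ + X]big1 ?addr0 => [|g /andP[g1 g2]]; last first.
    by rewrite ltnNge; have -> : (w - g <= l)%N by lia.
  rewrite big_nat (eq_bigr (fun=> 1)) => [|g /andP[g1 g2]]; last first.
    by have -> : (l < w - g)%N by lia.
  rewrite -big_nat sumr_const_nat -natrB //; congr (_%:R); lia.
rewrite (rep_map_sub ls _ Hc); last by move=> *; apply: V_sub.
have := V_weight_count n [::] (ffall a) (map mk ls).
rewrite mul_ffall VphiD VphiZ /= addn0.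
have -> : \sum_(l <- ls) l.+1%:R = (sumn ls + size ls)%:R :> rat.
  elim: ls => [|l ls IH]; first by rewrite big_nil.
  by rewrite big_cons IH -natrD /=; congr _%:R; lia.
rewrite !natrD -!(natr1 n) /mk /= => E; lra.
Qed.

Lemma V_fun0 n A phi s : V n A phi ((fun=> 0) :: s) = 0.
Proof.
rewrite (_ : (fun=> 0) = (fun w => mk 0 w - 1 * mk 0 w)) ?V_head_sub; first by ring.
by apply/funext => w; ring.
Qed.

(** [mk 0] is [mk 1] plus [ex 1], and a piece of weight exactly 1 is a point outside domain and
    image, which can be inserted at any of n + 1 places. *)
Lemma V_one_rec n phi s : V n.+1 [::] phi (mk 1 :: s) =
  V n.+1 [::] phi (mk 0 :: s) - n.+1%:R * V n [::] phi s.
Proof.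
suff E : V n.+1 [::] phi (ex 1 :: s) = n.+1%:R * V n [::] phi s.
  by rewrite (mk_sub 0) V_head_sub E; ring.
rewrite V_cons_step //= up_ex (@V_ext _ _ _ _ (fun=> 0)) => [|w]; last by rewrite /ex; case: w.
rewrite V_fun0 (eq_rep (h' := fun=> fun=> 0) (G' := fun=> 0)) => [|s1 x s2 _]; last first.
  rewrite V_move (@V_ext _ _ _ _ (fun=> 0)) ?V_fun0 // => w _.
  by rewrite /conv /ex big_nat big1 // => g /andP[g0 _]; rewrite eqSS gtn_eqF ?mul0r.
by rewrite rep0 /ex /=; ring.
Qed.

(** * Polynomiality in n for a fixed list of marks *)

Definition horner_simp := (@hornerD, @hornerN, @hornerM, @hornerZ, @hornerX, @hornerC, @horner_comp).

Lemma coef_Xadd1_exp m i : (('X + 1) ^+ m : {poly rat})`_i = 'C(m, i)%:R.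
Proof.
rewrite addrC exprDn coef_sum.
under eq_bigr => j _ do rewrite expr1n mul1r coefMn coefXn.
case: (ltnP i m.+1) => im; last first.
  rewrite bin_small // big1 // => j _; rewrite gtn_eqF ?mul0rn //.
  by apply: leq_trans im; rewrite ltn_ord.
rewrite (bigD1 (Ordinal im)) //= eqxx big1 ?addr0 // => j ji.
by rewrite eq_sym; move: ji; rewrite -val_eqE /= => /negPf ->; rewrite mul0rn.
Qed.

Lemma poly_antidiff (p : {poly rat}) : exists2 q : {poly rat},
  (size q <= (size p).+1)%N & q \Po ('X + 1) - q = p.
Proof.
have [n] := ubnP (size p); elim: n p => // n IH p pn.
have [->|p0] := eqVneq p 0.
  by exists 0; rewrite ?size_poly0 // comp_poly0 subr0.
have [m sm] : exists m, size p = m.+1.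
  by exists (size p).-1; rewrite prednK // size_poly_gt0.
rewrite sm in pn *; pose c := p`_m / m.+1%:R.
have n1 : m.+1%:R != 0 :> rat by rewrite pnatr_eq0.
have sr : (size (p - c *: (('X + 1) ^+ m.+1 - 'X^(m.+1)))%R <= m)%N.
  apply/leq_sizeP => j; rewrite leq_eqVlt => /orP[/eqP <-|nj].
    rewrite coefB coefZ coefB coef_Xadd1_exp coefXn ltn_eqF // subr0 binSn.
    by rewrite /c divfK // subrr.
  rewrite coefB coefZ coefB coef_Xadd1_exp coefXn [p`_j]nth_default ?sm //.
  move: nj; rewrite leq_eqVlt => /orP[/eqP <-|nj].
    by rewrite binn eqxx subrr mulr0 subrr.
  by rewrite bin_small // gtn_eqF // subrr mulr0 subrr.
have [|q qn qp] := IH _ (leq_ltn_trans sr _); first by rewrite -ltnS.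
exists (q + c *: 'X^(m.+1)).
  apply: leq_trans (size_polyD _ _) _; rewrite geq_max.
  apply/andP; split; first by apply: leq_trans qn _; rewrite ltnS leqW.
  by apply: leq_trans (size_scale_leq _ _) _; rewrite size_polyXn.
rewrite comp_polyD comp_polyZ comp_Xn_poly -(subrK (c *: (('X + 1) ^+ m.+1 - 'X^(m.+1))) p).
by rewrite -qp scalerBr !addrA; rewrite -!mul_polyC; ring.
Qed.

Lemma poly_sum_rec (u : nat -> rat) (p : {poly rat}) n0 :
  (forall n, (n0 <= n)%N -> u n.+1 = u n + p.[n%:R]) ->
  exists2 q : {poly rat}, (size q <= (size p).+1)%N &
    forall n, (n0 <= n)%N -> u n = q.[n%:R].
Proof.
move=> up; have [q qp qE] := poly_antidiff p.
exists (q + (u n0 - q.[n0%:R])%:P).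
  apply: leq_trans (size_polyD _ _) _; rewrite geq_max qp size_polyC.
  by case: (_ != 0).
move=> n nn; rewrite -(subnKC nn); elim: (n - n0)%N => [|k IH].
  by rewrite addn0 hornerD hornerC; ring.
rewrite addnS up ?leq_addr // IH -qE -natr1 !horner_simp.
ring.
Qed.

Lemma V_perm n A phi (ls1 ls2 : seq nat) : perm_eq ls1 ls2 ->
  V n A phi (map mk ls1) = V n A phi (map mk ls2).
Proof.
suff H s : perm_eq ls1 ls2 -> V n A phi (s ++ map mk ls1) = V n A phi (s ++ map mk ls2).
  exact: (H [::]).
elim: ls1 ls2 s => [|l ls1 IH] ls2 s p12.
  by rewrite perm_sym in p12; rewrite (perm_nilP p12).
have lin : l \in ls2 by rewrite -(perm_mem p12) mem_head.
case/splitPr: {ls2}lin p12 => u v p12.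
have {}p12 : perm_eq ls1 (u ++ v).
  move: p12; rewrite -[u ++ _]/(u ++ [:: l] ++ v) perm_sym perm_catCA /= perm_cons.
  by rewrite perm_sym.
rewrite map_cat /= catA V_move [RHS]V_move -catA -map_cat.
exact: (IH (u ++ v) (mk l :: s)).
Qed.

(** A waiting point can leave the queue for good only in a finished piece, which has to consume a
    mark. *)
Lemma V_queue_nil n q A phi : V n (q :: A) phi [::] = 0.
Proof.
elim: n q A => // n IH q A; rewrite VS1 /= (IH q).
by case: A => [|q' A]; rewrite /= IH /pop /=; ring.
Qed.

Lemma V_nil n phi : V n [::] phi [::] = phi n.
Proof.
elim: n phi => // n IH phi; rewrite VS0 IH V_queue_nil /pop /shf; ring.
Qed.

(** The range starts one below [a + sumn ls] because [Sv_base] evaluates the polynomial there to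
    find its second zero. *)
Definition vpoly a ls := exists2 b : {poly rat}, (size b <= a + 2 * size ls + 1)%N &
  forall n, (a + sumn ls - 1 <= n)%N -> V n [::] (ffall a) (map mk ls) = b.[n%:R].

Lemma vpoly_perm a ls1 ls2 : perm_eq ls1 ls2 -> vpoly a ls1 -> vpoly a ls2.
Proof.
move=> p12 [b sb E]; exists b; first by rewrite -(perm_size p12).
by move=> n nn; rewrite -(V_perm _ _ _ p12) E // (perm_sumn p12).
Qed.

(** The increment in n is [b] times a linear factor, and summation raises the degree once more. *)
Lemma vpoly_zero a ls : vpoly a ls -> vpoly a (0%N :: ls).
Proof.
case=> b sb bE.
pose c : rat := 1 - (a + sumn ls + size ls)%:R.
have [q sq qE] : exists2 q : {poly rat},
    (size q <= (size ((2%:R *: 'X + c%:P) * b)%R).+1)%N &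
    forall n, (a + sumn ls - 1 <= n)%N ->
      V n [::] (ffall a) (map mk (0%N :: ls)) = q.[n%:R].
  apply: poly_sum_rec => n nn; rewrite V_zero_rec bE // !horner_simp /c (natrD _ (2 * n)) (natrM _ 2).
  by ring.
exists q => //; apply: leq_trans sq _; rewrite /= addn1 ltnS.
apply: leq_trans (size_polyMleq _ _) _.
have : (size (2%:R *: 'X + c%:P)%R <= 2)%N.
  apply: leq_trans (size_polyD _ _) _; rewrite geq_max size_polyC.
  by rewrite (leq_trans (size_scale_leq _ _)) ?size_polyX //; case: (_ != 0).
move=> s2; rewrite -subn1 leq_subLR; apply: leq_trans (leq_add s2 sb) _; lia.
Qed.

Lemma vpoly_one a ls : vpoly a ls -> vpoly a (1%N :: ls).
Proof.
move=> Hls; have [b0 sb0 E0] := vpoly_zero Hls; have [b sb E] := Hls.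
exists (b0 - 'X * (b \Po ('X - 1))).
  apply: leq_trans (size_polyD _ _) _; rewrite size_polyN geq_max sb0 /=.
  apply: leq_trans (size_polyMleq _ _) _; rewrite size_polyX /=.
  by rewrite -['X - 1]/('X - 1%:P) size_comp_poly2 ?size_XsubC // (leq_ltn_trans sb) //=; lia.
(* At n = 0 the factor ['X] removes the second term, and [V] is 0 with [mk 1] and with [mk 0]
   alike. *)
case=> [|n] nn /=.
  have := E0 0%N; rewrite !V0_cons !horner_simp mulr0n mul0r subr0; apply.
  by move: nn => /=; lia.
rewrite V_one_rec E; last by move: nn => /=; lia.
rewrite -[mk 0 :: _]/(map mk (0%N :: ls)) E0; last by move: nn => /=; lia.
by rewrite !horner_simp -natr1 addrK.
Qed.

Lemma vpoly_singleton a l : vpoly a [::] -> vpoly a [:: l].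
Proof.
move=> H0; elim: l => [|[|l] IH]; [exact: vpoly_zero | exact: vpoly_one|].
have [b sb E] := IH; exists (b \Po ('X - 1)).
  by rewrite -['X - 1]/('X - 1%:P) size_comp_poly2 ?size_XsubC.
case=> [|n] nn /=; first by move: nn => /=; lia.
(* The mark vanishes at the weights 1 and 2, so peeling merely lowers it by one together with n. *)
rewrite V_cons_step //= /mk /= !mul0r !addr0.
rewrite !horner_simp -natr1 addrK -E //; move: nn => /=; lia.
Qed.

Lemma V_mk_normalize n phi l1 l2 s : (0 < l1)%N -> (0 < l2)%N ->
  V n [::] phi (mk l1 :: mk l2 :: s) = V n [::] phi (mk 1 :: mk (l1 + l2 - 1) :: s).
Proof.
elim: l1 l2 => // -[|l1] IH l2 _ l20; first by rewrite add1n subn1.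
by rewrite V_mk_shift // IH // !addSn addnS.
Qed.

(** Induction on the number of marks. Two positive marks are normalized so that one of them becomes
    1, which preserves [sumn ls], and that one is then removed by [vpoly_one]. *)
Lemma V_vpoly a ls : vpoly a ls.
Proof.
have [n] := ubnP (size ls); elim: n ls => // n IH ls sn.
have H0 : vpoly a [::].
  exists (\prod_(i < a) ('X - i%:R%:P)).
    by rewrite size_prod_XsubC /= -[index_enum _]enumT size_enum_ord; lia.
  move=> m _; rewrite V_nil /ffall.
  elim: a {IH} => [|a IHa]; first by rewrite big_ord0 hornerE ffactn0.
  rewrite big_ord_recr /= hornerM -IHa !horner_simp ffactnSr natrM.
  case: (leqP a m) => am; first by rewrite natrB.
  by rewrite ffact_small // !mul0r.
have [/perm_to_rem p0|ls0] := boolP (0%N \in ls).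
  rewrite perm_sym in p0; apply: (vpoly_perm p0); apply: vpoly_zero; apply: IH.
  by move: sn; rewrite -(perm_size p0) /=.
case: ls ls0 sn => [|l1 [|l2 ls]] // ls0 sn; first exact: vpoly_singleton.
have [b sb E] : vpoly a (1%N :: (l1 + l2 - 1)%N :: ls).
  by apply/vpoly_one/IH.
exists b => // m mm.
rewrite /= V_mk_normalize; last 2 first.
- by move: ls0; rewrite !inE; case: (l1).
- by move: ls0; rewrite !inE; case: (l2); rewrite ?orbT.
apply: E; move: ls0 mm; rewrite !inE /=; lia.
Qed.

End MarkedCycles.

(** * Sums over compositions and cycle moments *)

Section Compositions.
Implicit Types (p : seq nat).

(* Sum of F over the compositions of l into r parts. *)
Fixpoint csumr r l (F : seq nat -> rat) : rat :=
  if r is r'.+1 then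
    \sum_(1 <= q < l.+1) csumr r' (l - q)%N (fun p => F (q :: p))
  else if l is 0 then F [::] else 0.

Lemma csumrS r l F :
  csumr r.+1 l F = \sum_(1 <= q < l.+1) csumr r (l - q)%N (fun p => F (q :: p)).
Proof. by []. Qed.

Lemma csumr_0 l F : csumr 0 l F = if l is 0 then F [::] else 0.
Proof. by []. Qed.

Lemma eq_csumr r l (F F' : seq nat -> rat) :
  (forall p, size p = r -> sumn p = l -> all (ltn 0) p -> F p = F' p) ->
  csumr r l F = csumr r l F'.
Proof.
elim: r l F F' => [|r IH] l F F' E /=; first by case: l E => // E; apply: E.
apply: eq_big_nat => q /andP[q0 ql]; apply: IH => p sp sl p0.
by apply: E; rewrite /= ?sp ?sl ?q0 //; lia.
Qed.

Lemma csumr0 r l : csumr r l (fun=> 0) = 0.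
Proof. by elim: r l => [|r IH] [|l] //=; rewrite big1 // => q _; rewrite IH. Qed.

Lemma csumrD r l F F' : csumr r l (fun p => F p + F' p) = csumr r l F + csumr r l F'.
Proof.
elim: r l F F' => [|r IH] l F F' /=; first by case: l; rewrite ?addr0.
by rewrite -big_split; apply: eq_bigr => q _; rewrite IH.
Qed.

Lemma csumrZ r l c F : csumr r l (fun p => c * F p) = c * csumr r l F.
Proof.
elim: r l F => [|r IH] l F /=; first by case: l; rewrite ?mulr0.
by rewrite mulr_sumr; apply: eq_bigr => q _; rewrite IH.
Qed.

Lemma csumr_gt r l F : (l < r)%N -> csumr r l F = 0.
Proof.
move=> lr; rewrite (@eq_csumr _ _ F (fun=> 0)) ?csumr0 // => p sp sl p0.
suff : (size p <= sumn p)%N by rewrite sp sl leqNgt lr.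
by elim: p p0 {sp sl} => //= q p IH /andP[q0 /IH]; lia.
Qed.

Definition eqn_ind (w x : nat) : rat := (x == w)%:R.

(* [dec w F p] sums F over the lists obtained by lowering one part of p by w, all parts
   staying positive. *)
Fixpoint dec w (F : seq nat -> rat) p : rat :=
  if p is q :: p' then
    (if (w < q)%N then F ((q - w)%N :: p') else 0) + dec w (fun t => F (q :: t)) p'
  else 0.

Local Arguments csumr : simpl never.

(** A part w can be inserted at r + 1 places into a composition with r parts. *)
Lemma csumr_pop w r l F : (0 < w)%N -> csumr r.+1 l (pop (eqn_ind w) F) =
  if (w <= l)%N then r.+1%:R * csumr r (l - w)%N F else 0.
Proof.
move=> w0; elim: r l F => [|r IH] l F.
  rewrite csumrS; case: leqP => wl.
    rewrite (bigD1_seq w) ?mem_index_iota ?iota_uniq ?w0 //= big1_seq ?addr0.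
      rewrite !csumr_0 mul1r; case: (l - w)%N => //.
      by rewrite pop_cons /eqn_ind eqxx mul1r; apply: addr0.
    move=> q /andP[qw _]; rewrite csumr_0; case: (l - q)%N => //.
    by rewrite pop_cons /eqn_ind (negPf qw) mul0r; apply: addr0.
  rewrite big_nat big1 // => q /andP[_ ql]; rewrite csumr_0; case: (l - q)%N => //.
  rewrite pop_cons /eqn_ind (_ : (q == w) = false) ?mul0r ?add0r //; lia.
transitivity (\sum_(1 <= q < l.+1) ((q == w)%:R * csumr r.+1 (l - q)%N F +
   csumr r.+1 (l - q)%N (pop (eqn_ind w) (fun t => F (q :: t))))).
  rewrite csumrS; apply: eq_bigr => q _.
  by rewrite -csumrZ -csumrD.
under eq_bigr => q _ do rewrite IH.
rewrite big_split /=; case: leqP => wl; last first.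
  rewrite !big_nat big1 ?add0r ?big1 // => q /andP[_ ql].
    by case: leqP => // ; lia.
  by rewrite ltn_eqF ?mul0r //; lia.
rewrite (bigD1_seq w) ?mem_index_iota ?iota_uniq ?w0 //= eqxx mul1r.
rewrite big1 ?addr0 => [|q /negPf ->]; last by rewrite mul0r.
rewrite [X in _ + X = _](_ : _ = r.+1%:R * csumr r.+1 (l - w)%N F).
  by rewrite -[r.+2]addn1 natrD /=; ring.
rewrite csumrS mulr_sumr (@big_cat_nat _ _ _ (l - w)%N.+1) //=; last by rewrite ltnS leq_subr.
rewrite [X in _ + X]big_nat [X in _ + X]big1 ?addr0 => [|q /andP[q1 q2]]; last first.
  by case: leqP => //; lia.
apply: eq_big_nat => q /andP[q1 q2]; rewrite (_ : w <= l - q)%N; last lia.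
by rewrite subnAC.
Qed.

(** Any of the r parts of a composition of l - w can be raised by w. *)
Lemma csumr_dec w r l F : (0 < w)%N -> csumr r l (dec w F) =
  if (w <= l)%N then r%:R * csumr r (l - w)%N F else 0.
Proof.
move=> w0; elim: r l F => [|r IH] l F.
  by rewrite csumr_0; case: l => [|l]; rewrite mul0r ?if_same.
transitivity (\sum_(1 <= q < l.+1)
   ((if (w < q)%N then csumr r (l - q)%N (fun t => F ((q - w)%N :: t)) else 0) +
    csumr r (l - q)%N (dec w (fun t => F (q :: t))))).
  rewrite csumrS; apply: eq_bigr => q _.
  by rewrite [LHS]csumrD; congr (_ + _); case: ifP; rewrite ?csumr0.
under eq_bigr => q _ do rewrite IH.
rewrite big_split /=; case: leqP => wl; last first.
  rewrite !big_nat big1 ?add0r ?big1 // => q /andP[_ ql]; case: ltnP => //; lia.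
rewrite -natr1 mulrDl mul1r addrC csumrS mulr_sumr; congr (_ + _).
  rewrite (@big_cat_nat _ _ _ (l - w)%N.+1) //=; last by rewrite ltnS leq_subr.
  rewrite [X in _ + X]big_nat [X in _ + X]big1 ?addr0 => [|q /andP[q1 q2]]; last first.
    by case: leqP => //; lia.
  apply: eq_big_nat => q /andP[q1 q2]; rewrite (_ : w <= l - q)%N; last lia.
  by rewrite subnAC.
rewrite (@big_cat_nat _ _ _ w.+1) //= big_nat big1 ?add0r => [|q /andP[q1 q2]]; last first.
  by case: ltnP => //; lia.
rewrite -add1n big_addn subSn //; apply: eq_big_nat => q /andP[q1 q2].
rewrite -{1}[w]add0n ltn_add2r q1 addnK; congr csumr; lia.
Qed.

(* The division by r accounts for the r cyclic rotations of a composition. *)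
Definition cavg l F : rat := \sum_(1 <= r < l.+1) r%:R^-1 * csumr r l F.

Lemma cavgD l F F' : cavg l (fun p => F p + F' p) = cavg l F + cavg l F'.
Proof. by rewrite -big_split; apply: eq_bigr => r _; rewrite csumrD mulrDr. Qed.

Lemma cavgZ l c F : cavg l (fun p => c * F p) = c * cavg l F.
Proof. by rewrite mulr_sumr; apply: eq_bigr => r _; rewrite csumrZ mulrCA. Qed.

Lemma eq_cavg l F F' :
  (forall p, (0 < size p)%N -> sumn p = l -> all (ltn 0) p -> F p = F' p) ->
  cavg l F = cavg l F'.
Proof.
move=> E; apply: eq_big_nat => r /andP[r0 _]; congr (_ * _).
by apply: eq_csumr => p sp; apply: E; rewrite sp.
Qed.

(* The sum telescopes over the number of parts. *)
Lemma cavg_pop_dec w l F : (0 < w)%N ->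
  cavg l (pop (eqn_ind w) F) = cavg l (dec w F) + (l == w)%:R * F [::].
Proof.
move=> w0; rewrite /cavg; case: (leqP w l) => wl; last first.
  rewrite ltn_eqF // mul0r addr0; apply: eq_big_nat => -[|r] // _.
  by rewrite csumr_pop // csumr_dec // leqNgt wl.
apply/eqP; rewrite addrC -subr_eq -sumrB; apply/eqP.
transitivity (\sum_(0 <= r < l) (csumr r (l - w)%N F - csumr r.+1 (l - w)%N F)).
  rewrite big_add1 /=; apply: eq_bigr => r _.
  have r0 : r.+1%:R != 0 :> rat by rewrite pnatr_eq0.
  by rewrite csumr_pop // csumr_dec // wl !mulrA !mulVf // !mul1r.
rewrite (@telescope_sumr_eq _ _ _ (fun r => - csumr r (l - w)%N F)) // => [|r _]; last by ring.
rewrite csumr_gt /=; last by rewrite ltn_subrL w0 (leq_trans w0 wl).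
rewrite oppr0 sub0r opprK csumr_0; case: eqVneq => [->|lw]; first by rewrite subnn mul1r.
by rewrite mul0r; case E: (l - w)%N => //; case/negP: lw; lia.
Qed.

End Compositions.

(** * Sums over prescribed cycles, and factorial moments of cycle counts *)

Section CycleMoments.
Implicit Types (lam mu p : seq nat) (g : nat -> seq nat -> rat).

Lemma eq_pop_in {T} (e : T -> rat) (G G' : seq T -> rat) (s : seq T) :
  (forall s1 x s2, s = s1 ++ x :: s2 -> e x * G (s1 ++ s2) = e x * G' (s1 ++ s2)) ->
  pop e G s = pop e G' s.
Proof.
move=> E; apply/eqP; rewrite -subr_eq0 -popB; apply/eqP/pop_eq0 => s1 x s2 Es.
by rewrite mulrBr E // subrr.
Qed.

Lemma pop_cat {T} (e : T -> rat) (G : seq T -> rat) (s1 s2 : seq T) :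
  pop e G (s1 ++ s2) = pop e (fun t => G (t ++ s2)) s1 + pop e (fun t => G (s1 ++ t)) s2.
Proof.
elim: s1 G => [|x s1 IH] G /=; first by rewrite [pop e _ [::]]/(0) add0r.
by rewrite !pop_cons IH addrA.
Qed.

Lemma dec_cat w G p p' :
  dec w G (p ++ p') = dec w (fun t => G (t ++ p')) p + dec w (fun t => G (p ++ t)) p'.
Proof.
elim: p G => [|x p IH] G /=; first by rewrite add0r.
by rewrite IH addrA.
Qed.

(* Each entry l of [lam] is an l-cycle: a cyclic composition of l into weights of pieces, or a
   fixed point of the permutation when l = 1; [g a p] receives the number a of chosen fixed
   points and the list p of all parts. *)
Fixpoint Tsum lam g : rat :=
  if lam is l :: lam' then
    cavg l (fun p' => Tsum lam' (fun a p => g a (p' ++ p))) +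
    (if l == 1%N then Tsum lam' (fun a p => g a.+1 p) else 0)
  else g 0%N [::].

Lemma eq_Tsum lam g g' :
  (forall a p, (a + sumn p)%N = sumn lam -> all (ltn 0) p -> g a p = g' a p) ->
  Tsum lam g = Tsum lam g'.
Proof.
elim: lam g g' => [|l lam IH] g g' E /=; first exact: E.
congr (_ + _).
  apply: eq_cavg => p' _ sp' p'0; apply: IH => a p sp p0; apply: E.
    by rewrite sumn_cat /= -sp sp'; lia.
  by rewrite all_cat p'0.
case: eqP => // l1; apply: IH => a p sp p0; apply: E => //.
by rewrite /= -sp l1.
Qed.

Lemma TsumD lam g g' : Tsum lam (fun a p => g a p + g' a p) = Tsum lam g + Tsum lam g'.
Proof.
elim: lam g g' => //= l lam IH g g'.
under [X in cavg l X]funext => p' do rewrite IH.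
rewrite cavgD; case: eqP => _; rewrite ?IH; ring.
Qed.

Lemma TsumZ lam c g : Tsum lam (fun a p => c * g a p) = c * Tsum lam g.
Proof.
elim: lam g => //= l lam IH g.
under [X in cavg l X]funext => p' do rewrite IH.
rewrite cavgZ; case: eqP => _; rewrite ?IH; ring.
Qed.

Lemma Tsum0 lam : Tsum lam (fun _ _ => 0) = 0.
Proof. by rewrite -[RHS](mul0r (Tsum lam (fun _ _ => 0))) -TsumZ; congr Tsum; do 2 apply/funext => ?; rewrite mul0r. Qed.

Lemma Tsum_pop {T} lam (e : T -> rat) (h : seq T -> nat -> seq nat -> rat) (s : seq T) :
  Tsum lam (fun a p => pop e (fun t => h t a p) s) = pop e (fun t => Tsum lam (h t)) s.
Proof.
elim: s h => [|x s IH] h; first exact: Tsum0.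
by rewrite pop_cons -IH -TsumZ -TsumD.
Qed.

Lemma Tsum_dec lam w (h : seq nat -> nat -> seq nat -> rat) q :
  Tsum lam (fun a p => dec w (fun t => h t a p) q) = dec w (fun t => Tsum lam (h t)) q.
Proof.
elim: q h => [|x q IH] h; first exact: Tsum0.
rewrite /= -IH; case: ifP => _; first by rewrite -TsumD.
by rewrite add0r; apply: eq_Tsum => a p _ _; rewrite add0r.
Qed.

Lemma cavg_popC {T} l (e : T -> rat) (h : seq T -> seq nat -> rat) (s : seq T) :
  cavg l (fun p => pop e (fun t => h t p) s) = pop e (fun t => cavg l (h t)) s.
Proof.
elim: s h => [|x s IH] h.
  rewrite [RHS]/(0) -[RHS](mul0r (cavg l (fun=> 0))) -cavgZ.
  by congr cavg; apply/funext => p; rewrite mul0r.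
by rewrite pop_cons -IH -cavgZ -cavgD.
Qed.

(** The factor a selects one of the chosen fixed points; it stems from an entry 1 of [lam], which is
    deleted. *)
Lemma Tsum_mul_fix lam g : Tsum lam (fun a p => a%:R * g a.-1 p) =
  pop (eqn_ind 1) (fun mu => Tsum mu g) lam.
Proof.
elim: lam g => [|l lam IH] g /=; first by rewrite mul0r.
rewrite pop_cons popD -cavg_popC.
under [X in cavg l X]funext => p' do rewrite (IH (fun a p => g a (p' ++ p))).
rewrite /eqn_ind; case: eqP => l1; last by rewrite mul0r pop0; ring.
rewrite mul1r (@eq_Tsum _ _ (fun a p => g a p + a%:R * g a p)); last first.
  by move=> a p _ _; rewrite -natr1 /=; ring.
rewrite TsumD (@eq_Tsum lam (fun a p => a%:R * g a p)
   (fun a p => a%:R * (fun a' p' => g a'.+1 p') a.-1 p)) => [|[|a] p _ _]; last 2 first.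
- by rewrite !mul0r.
- by [].
by rewrite (IH (fun a p => g a.+1 p)); ring.
Qed.

(** This is [cavg_pop_dec] for the cycle that owns the removed part; the extra term arises when that
    part is the whole cycle. *)
Lemma Tsum_pop_dec w lam g : (0 < w)%N ->
  Tsum lam (fun a p => pop (eqn_ind w) (g a) p) =
  Tsum lam (fun a p => dec w (g a) p) + pop (eqn_ind w) (fun mu => Tsum mu g) lam.
Proof.
move=> w0; elim: lam g => [|l lam IH] g /=; first by rewrite addr0.
rewrite pop_cons popD -cavg_popC.
have E1 p' : Tsum lam (fun a p => pop (eqn_ind w) (g a) (p' ++ p)) =
    pop (eqn_ind w) (fun t => Tsum lam (fun a p => g a (t ++ p))) p' +
    (Tsum lam (fun a p => dec w (fun t => g a (p' ++ t)) p) +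
     pop (eqn_ind w) (fun mu => Tsum mu (fun a p => g a (p' ++ p))) lam).
  rewrite -(IH (fun a p => g a (p' ++ p))) -Tsum_pop -TsumD.
  by apply: eq_Tsum => a p _ _; rewrite pop_cat.
have E2 p' : Tsum lam (fun a p => dec w (g a) (p' ++ p)) =
    dec w (fun t => Tsum lam (fun a p => g a (t ++ p))) p' +
    Tsum lam (fun a p => dec w (fun t => g a (p' ++ t)) p).
  by rewrite -Tsum_dec -TsumD; apply: eq_Tsum => a p _ _; rewrite dec_cat.
under [X in cavg l X + _ = _]funext => p' do rewrite E1.
under [X in _ = cavg l X + _ + _]funext => p' do rewrite E2.
rewrite !cavgD cavg_pop_dec // /eqn_ind /=.
case: ifP => _; last by rewrite pop0; ring.
by rewrite (IH (fun a p => g a.+1 p)); ring.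
Qed.

Lemma Tsum_eq0 l lam g : (forall a p, (0 < a + size p)%N -> g a p = 0) ->
  Tsum (l :: lam) g = 0.
Proof.
move=> g0 /=; rewrite (@eq_cavg _ _ (fun p => 0 * 0)) => [|p sp _ _]; last first.
  rewrite mul0r -[RHS](Tsum0 lam); apply: eq_Tsum => a p' _ _; apply: g0.
  by rewrite size_cat; lia.
rewrite (cavgZ l 0) mul0r add0r; case: ifP => // _.
by rewrite -[RHS](Tsum0 lam); apply: eq_Tsum => a p' _ _; apply: g0.
Qed.

(* Product over l of the falling factorial of m l, of length the multiplicity of l in lam. *)
Fixpoint Gf lam (m : nat -> rat) : rat :=
  if lam is l :: lam' then (m l - (count_mem l lam')%:R) * Gf lam' m else 1.

(** Pascal's rule for falling factorials: raising the argument by 1 adds c times the falling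
    factorial of length c - 1, and [pop] runs over the c entries equal to w. *)
Lemma Gf_shift lam (w : nat) (m : nat -> rat) : Gf lam (fun l => m l + (l == w)%:R) =
  Gf lam m + pop (eqn_ind w) (fun mu => Gf mu m) lam.
Proof.
elim: lam => [|l lam IH] /=; first by rewrite addr0.
rewrite pop_cons IH /= /eqn_ind; have [->|lw] := eqVneq l w.
  rewrite [X in _ = _ + (_ + X)](@eq_pop_in _ _ _
    (fun mu => (m w - (count_mem w lam)%:R + 1) * Gf mu m)) => [|s1 x s2 Es].
    by rewrite popZ -![true%:R]/(1 : rat); ring.
  rewrite Es !count_cat /=; case: (x == w); rewrite ?mul0r // !natrD.
  by rewrite -![true%:R]/(1 : rat); ring.
rewrite [X in _ = _ + (_ + X)](@eq_pop_in _ _ _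
    (fun mu => (m l - (count_mem l lam)%:R) * Gf mu m)) => [|s1 x s2 Es].
  by rewrite popZ -![false%:R]/(0 : rat); ring.
rewrite Es !count_cat /=; case: eqVneq => [->|xw]; last by rewrite !mul0r.
by rewrite eq_sym (negPf lw) add0n.
Qed.

Lemma Gf_cons0 l lam m : (forall l, m l = 0) -> Gf (l :: lam) m = 0.
Proof.
move=> m0; elim: lam l => [|l' lam IH] l; first by rewrite /= m0; ring.
by have := IH l'; rewrite /= => ->; rewrite mulr0.
Qed.

End CycleMoments.

(** * Contraction of weighted permutations *)

Section Contraction.
Context {T : finType}.
Implicit Types (s r : {perm T}) (w : T -> nat) (L : {set T}).

Definition wt s w t := (\sum_(y in porbit s t) w y)%N.
(* Number of cycles of total weight l, for l > 0 (the value is 0 at l = 0). *)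
Definition cyc s w : nat -> rat := fun l => (\sum_(t | wt s w t == l) w t)%:R / l%:R.

(* x is merged into z and becomes a dead point of weight 0; z = x just kills x. *)
Definition wmerge w x z t : nat := if t == x then 0%N else if t == z then (w z + w x)%N else w t.

(** The arrow from x to z is contracted: [r] sends the predecessor of x straight to z and fixes
    x. *)
Lemma perm_on_contract L x z (F : {perm T} -> rat) : x \in L -> z \in L ->
  \sum_(s | perm_on L s && (s x == z)) F s =
  \sum_(r | perm_on (L :\ x) r) F (r * tperm x z)%g.
Proof.
move=> xL zL.
rewrite (reindex_onto (fun r => r * tperm x z)%g (fun s => s * tperm x z)%g) /=; last first.
  by move=> s _; rewrite -mulgA tperm2 mulg1.
apply: eq_bigl => r; rewrite -mulgA tperm2 mulg1 eqxx andbT permM.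
apply/andP/idP => [[/fintype.subsetP sL /eqP rx]|/fintype.subsetP rL].
  apply/fintype.subsetP => y; rewrite !inE.
  have {}rx : r x = x by apply: (@perm_inj _ (tperm x z)); rewrite rx tpermL.
  move=> ry; have -> /= : y != x by apply: contraNneq ry => ->; rewrite rx.
  have [E|/sL //] := eqVneq ((r * tperm x z)%g y) y.
  move: ry; rewrite -[X in _ != X]E permM.
  by case: tpermP => [ry|ry|]; rewrite ?eqxx // => _; rewrite -E permM ry ?tpermL ?tpermR.
have rx : r x = x.
  by apply/eqP/negPn/negP => /rL; rewrite !inE eqxx.
split; last by rewrite rx tpermL.
apply/fintype.subsetP => y; rewrite !inE permM => ry.
have [E|/rL] := eqVneq (r y) y; last by rewrite !inE => /andP[].
by move: ry; rewrite E; case: tpermP => [->|->|]; rewrite ?eqxx.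
Qed.

Lemma porbit_contract r x z y t : r x = x -> t != x ->
  (y \in porbit r t) = (y != x) && (y \in porbit (r * tperm x z)%g t).
Proof.
have [->|xz] := eqVneq x z.
  rewrite tperm1 mulg1 => rx tx; case: eqVneq => //= ->.
  apply/negbTE; apply: contraNN tx; rewrite porbit_sym => /porbitP[i ->].
  elim: i => [|i /eqP IH];
    first by rewrite expg0 perm1.
  by rewrite expgSr permM IH rx.
move=> rx tx; pose s : {perm T} := (r * tperm x z)%g.
have step (u : {perm T}) i v : (u ^+ i.+1)%g v = u ((u ^+ i)%g v).
  by rewrite expgSr permM.
have rxN v : v != x -> r v != x by apply: contraNneq => rv; apply/eqP/(@perm_inj _ r); rewrite rv rx.
apply/idP/andP => [/porbitP[i ->]|[yx /porbitP[i Ei]]].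
  elim: i => [|i [IH1 IH2]]; first by rewrite expg0 perm1 tx porbit_id.
  rewrite step; split; first exact: rxN.
  set v := (r ^+ i)%g t in IH1 IH2 *.
  have [rz|rz] := eqVneq (r v) z.
    have -> : r v = (s ^+ 2)%g v.
      by rewrite expgS expg1 !permM rz tpermR rx tpermL.
    by case/porbitP: IH2 => k ->; rewrite -permM -expgD; apply/porbitP; exists (k + 2)%N.
  have -> : r v = s v by rewrite permM tpermD // eq_sym ?rxN.
  by case/porbitP: IH2 => k ->; rewrite -permM -expgSr; apply/porbitP; exists k.+1.
(* Replacing a visit to x by its successor z keeps the walk along [s] inside the orbit of [r]. *)
suff {Ei yx} H : forall i, (if (s ^+ i)%g t == x then z else (s ^+ i)%g t) \in porbit r t.
  by have := H i; rewrite -Ei (negPf yx).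
elim=> [|{}i IH]; first by rewrite expg0 perm1 (negPf tx) porbit_id.
rewrite step; set v := (s ^+ i)%g t in IH *.
have [vx|vx] := eqVneq v x.
  by rewrite vx permM rx tpermL eq_sym (negPf xz); move: IH; rewrite vx eqxx.
rewrite (negPf vx) in IH; case/porbitP: IH => k vk.
have rv : r v \in porbit r t by apply/porbitP; exists k.+1; rewrite step vk.
rewrite permM; case: tpermP => [rvx|<-|rvx rvz]; last by case: eqP.
  by have := rxN _ vx; rewrite rvx eqxx.
by rewrite eqxx.
Qed.

Lemma porbit_succ s x t : (s x \in porbit s t) = (x \in porbit s t).
Proof. by rewrite porbit_sym -{2}[s]expg1 porbit_perm porbit_sym. Qed.

Lemma wt_contract r x z w t : r x = x -> x != z -> t != x ->
  wt (r * tperm x z)%g w t = wt r (wmerge w x z) t.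
Proof.
move=> rx xz tx; set s : {perm T} := (r * tperm x z)%g.
have sx : s x = z by rewrite permM rx tpermL.
have zr : (z \in porbit r t) = (x \in porbit s t).
  by rewrite (porbit_contract z z rx tx) -/s -sx porbit_succ sx eq_sym xz.
rewrite /wt (bigID (pred1 x)) /= addnC.
rewrite (eq_bigl (fun y => y \in porbit r t)) => [|y]; last first.
  by rewrite (porbit_contract z y rx tx) andbC.
have -> : \sum_(y in porbit s t | y == x) w y = (if x \in porbit s t then w x else 0)%N.
  case: ifP => xs; last by rewrite big1 // => y /andP[ys /eqP yx]; rewrite yx xs in ys.
  by rewrite (big_pred1 x) // => y /=; case: eqP => [->|]; rewrite ?xs ?andbF.
rewrite -zr (eq_bigr (fun y => (if y == z then w x else 0) + w y)%N
   (F1 := fun y => wmerge w x z y)) => [|y yr]; last first.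
  rewrite /wmerge; move: yr; rewrite (porbit_contract z y rx tx) => /andP[/negPf -> _].
  by case: eqP => [->|]; rewrite // addnC.
rewrite big_split /= addnC; congr (_ + _)%N.
rewrite -big_mkcondr /=; case: ifP => zs.
  by rewrite (big_pred1 z) // => y /=; case: eqP => [->|]; rewrite ?zs ?andbF.
by rewrite big1 // => y /andP[ys /eqP yz]; rewrite yz zs in ys.
Qed.

Lemma cyc_contract r x z w : r x = x -> x != z ->
  cyc (r * tperm x z)%g w = cyc r (wmerge w x z).
Proof.
move=> rx xz; apply/funext => l; rewrite /cyc; congr (_%:R / _).
set s : {perm T} := (r * tperm x z)%g.
have sx : s x = z by rewrite permM rx tpermL.
have zx : z != x by rewrite eq_sym.
have wxz : wt s w x = wt s w z.
  by rewrite /wt -sx -[in porbit s (s x)](expg1 s) porbit_perm.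
rewrite big_mkcond [RHS]big_mkcond (bigD1 x) //= [RHS](bigD1 x) //=.
have mx : wmerge w x z x = 0%N by rewrite /wmerge eqxx.
have mz : wmerge w x z z = (w z + w x)%N by rewrite /wmerge (negPf zx) eqxx.
rewrite mx if_same add0n.
rewrite (bigD1 z) //= [RHS](bigD1 z) //= addnA wxz (wt_contract _ rx xz zx).
congr (_ + _)%N; last first.
  apply: eq_bigr => t /andP[tx tz].
  by rewrite (wt_contract _ rx xz tx) /wmerge (negPf tx) (negPf tz).
by rewrite mz; case: eqP => _ //; rewrite addnC.
Qed.

Lemma cyc_fix r x w l : r x = x -> (0 < w x)%N ->
  cyc r w l = cyc r (wmerge w x x) l + (l == w x)%:R.
Proof.
move=> rx wx.
have px : porbit r x = [set x].
  apply/setP => y; rewrite inE; apply/porbitP/eqP => [[i ->]|->].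
    by elim: i => [|i IH]; rewrite ?expg0 ?perm1 // expgSr permM IH.
  by exists 0%N; rewrite expg0 perm1.
have wt0 t : t != x -> wt r (wmerge w x x) t = wt r w t.
  move=> tx; apply: eq_bigr => y yr; rewrite /wmerge.
  suff /negPf -> : y != x by [].
  apply: contraNneq tx => yx.
  by have : t \in porbit r x; [rewrite porbit_sym -yx | rewrite px inE].
have wx0 v : wt r v x = v x by rewrite /wt px big_set1.
rewrite /cyc big_mkcond [in RHS]big_mkcond (bigD1 x) //= [in RHS](bigD1 x) //=.
have mx : wmerge w x x x = 0%N by rewrite /wmerge eqxx.
rewrite !wx0 mx if_same add0n natrD mulrDl addrC; congr (_ + _).
  congr (_%:R / _); apply: eq_bigr => t tx; rewrite wt0 //.
  by rewrite /wmerge (negPf tx).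
case: (eqVneq l (w x)) => [->|_]; last by rewrite mul0r.
by rewrite divff // pnatr_eq0 -lt0n.
Qed.

Lemma cycV s w : cyc s^-1 w = cyc s w.
Proof.
apply/funext => l; rewrite /cyc; congr (_%:R / _).
by apply: eq_bigl => t; rewrite /wt porbitV.
Qed.

Definition Rs lam L w : rat := \sum_(s | perm_on L s) Gf lam (cyc s w).

Lemma perm_on_split L x (F : {perm T} -> rat) : x \in L ->
  \sum_(s | perm_on L s) F s =
  \sum_(z in L) \sum_(r | perm_on (L :\ x) r) F (r * tperm x z)%g.
Proof.
move=> xL; rewrite (partition_big (fun s : {perm T} => s x) (mem L)) /=.
  by apply: eq_bigr => z zL; rewrite perm_on_contract.
by move=> s sL; rewrite perm_closed.
Qed.

Lemma perm_on_fix L x r : perm_on (L :\ x) r -> r x = x.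
Proof. by move/out_perm; apply; rewrite !inE eqxx. Qed.

Lemma Gf_fix lam L x w : (0 < w x)%N ->
  \sum_(r | perm_on (L :\ x) r) Gf lam (cyc r w) =
  Rs lam (L :\ x) (wmerge w x x) +
  pop (eqn_ind (w x)) (fun mu => Rs mu (L :\ x) (wmerge w x x)) lam.
Proof.
move=> wx; rewrite /Rs pop_sum -big_split /=; apply: eq_bigr => r rL.
by rewrite -Gf_shift; congr Gf; apply/funext => l; rewrite (cyc_fix l (perm_on_fix rL) wx).
Qed.

(** Either x is fixed and closes a cycle of weight [w x], or it is merged into its image z. *)
Lemma Rs_split lam L x w : x \in L -> (0 < w x)%N -> Rs lam L w =
  Rs lam (L :\ x) (wmerge w x x) +
  pop (eqn_ind (w x)) (fun mu => Rs mu (L :\ x) (wmerge w x x)) lam +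
  \sum_(z in L :\ x) Rs lam (L :\ x) (wmerge w x z).
Proof.
move=> xL wx; rewrite {1}/Rs (perm_on_split _ xL) (bigD1 x) //=.
under eq_bigr => r _ do rewrite tperm1 mulg1.
rewrite Gf_fix //; congr (_ + _); apply: eq_big => [z|z /andP[zL zx]].
  by rewrite !inE andbC.
apply: eq_bigr => r rL; rewrite (cyc_contract w (perm_on_fix rL)) //.
by rewrite eq_sym.
Qed.

End Contraction.

(** * Assigning the weights of finished pieces to marks *)

Section Matchings.
Implicit Types (x y : wfun) (s : seq wfun) (b p lam : seq nat).

Fixpoint popall b (H : seq wfun -> rat) : seq wfun -> rat :=
  if b is v :: b' then pop (fun x => x v) (popall b' H) else H.

Lemma popallD b H H' s : popall b (fun t => H t + H' t) s = popall b H s + popall b H' s.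
Proof.
elim: b s => //= v b IH s; rewrite -popD; congr pop.
by apply/funext => t; rewrite IH.
Qed.

Lemma popallZ b c H s : popall b (fun t => c * H t) s = c * popall b H s.
Proof.
elim: b s => //= v b IH s; rewrite -popZ; congr pop.
by apply/funext => t; rewrite IH.
Qed.

Lemma popall_pop b (e : wfun -> rat) H : popall b (pop e H) = pop e (popall b H).
Proof.
by elim: b => //= v b ->; apply/funext => s; rewrite popC.
Qed.

Lemma popall0 b s : popall b (fun=> 0) s = 0.
Proof. by rewrite -[RHS](mul0r (popall b (fun=> 0) s)) -popallZ; congr popall; apply/funext => t; rewrite mul0r. Qed.

(** Marks for j finished pieces: those on chosen cycles must have the weights in [p]; the free marks
    contribute the factorial that counts the permutations of the other pieces. *)
Definition slist j p : seq wfun := map ex p ++ nseq (j - size p) (mk 0).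
(** With more parts than pieces the truncated [j - size p] would give too long a list; the count is
    then 0. *)
Definition guard j (H : nat -> seq wfun -> rat) a p : rat :=
  if (size p <= j)%N then H a (slist j p) else 0.

Definition down v x : wfun := fun w => x (w + v)%N.

Lemma rep_pop_param {S T : Type} (h : S -> S) (e : T -> rat) (F : seq S -> seq T -> rat)
    (b0 : seq S) (t0 : seq T) :
  rep h (fun c => pop e (F c) t0) b0 = pop e (fun t => rep h (fun c => F c t) b0) t0.
Proof.
elim: b0 F => [|z b0 IH] F; first by rewrite [RHS]pop0.
by rewrite /= (IH (fun c => F (z :: c))) -popD.
Qed.

(** Raising a weight by v amounts to shifting the argument of the mark that consumes it. *)
Lemma rep_popall b v phi s :
  rep (addn v) (fun b' => popall b' (V 0 [::] phi) s) b =
  rep (down v) (popall b (V 0 [::] phi)) s.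
Proof.
elim: b s => [|v' b IH] s /=; first by rewrite rep_V0.
rewrite rep_pop addrC [(v + v')%N]addnC rep_pop_param; congr (_ + _).
by apply: eq_pop.
Qed.

(** [down v] turns [mk 0] into [mk 0], and [ex q] with q <= v into 0, only away from weight 0. *)
Definition pos_ext (H : seq wfun -> rat) := forall s1 x y s2,
  (forall w, (0 < w)%N -> x w = y w) -> H (s1 ++ x :: s2) = H (s1 ++ y :: s2).

Lemma pos_ext_pop v H : (0 < v)%N -> pos_ext H -> pos_ext (pop (fun x => x v) H).
Proof.
move=> v0 HH s1 x y s2 xy; rewrite !pop_cat !pop_cons xy //.
congr (_ + (_ + _)).
  by apply: eq_pop => // t; apply: HH.
apply: eq_pop => // t; exact: (HH s1).
Qed.

Lemma pos_ext_popall b n A phi : all (ltn 0) b -> pos_ext (popall b (V n A phi)).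
Proof.
elim: b => [_|v b IH /andP[v0 /IH]] /=; last exact: pos_ext_pop.
by move=> s1 x y s2 xy; rewrite !V_move; apply: V_ext.
Qed.

Lemma popall_fun0 b n A phi s1 s2 : popall b (V n A phi) (s1 ++ (fun=> 0) :: s2) = 0.
Proof.
elim: b s1 s2 => [|v b IH] s1 s2 /=; first by rewrite V_move V_fun0.
rewrite pop_cat pop_cons mul0r add0r.
rewrite (_ : (fun t => popall b _ (t ++ _ :: s2)) = fun=> 0); last first.
  by apply/funext => t; apply: IH.
rewrite (_ : (fun t => popall b _ (s1 ++ _ :: t)) = fun=> 0); last first.
  by apply/funext => t; apply: IH.
by rewrite !pop0 addr0.
Qed.

Lemma pop_nseq {T} (e : T -> rat) G k (z : T) :
  pop e G (nseq k z) = k%:R * (e z * G (nseq k.-1 z)).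
Proof.
elim: k G => [|k IH] G; first by rewrite mul0r.
rewrite /= pop_cons IH -natr1.
by case: k {IH} => [|k] /=; ring.
Qed.

Lemma rep_cat {T} (h : T -> T) G (s1 s2 : seq T) :
  rep h G (s1 ++ s2) = rep h (fun t => G (t ++ s2)) s1 + rep h (fun t => G (s1 ++ t)) s2.
Proof. by elim: s1 G => [|z s1 IH] G /=; rewrite ?add0r // IH addrA. Qed.

Lemma pop_slist v H p k : (0 < v)%N ->
  pop (fun x => x v) H (map ex p ++ nseq k (mk 0)) =
  pop (eqn_ind v) (fun t => H (map ex t ++ nseq k (mk 0))) p +
  k%:R * H (map ex p ++ nseq k.-1 (mk 0)).
Proof.
move=> v0; rewrite pop_cat pop_map pop_nseq /mk v0 mul1r; congr (_ + _).
by apply: eq_pop => // q; rewrite /ex /eqn_ind eq_sym.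
Qed.

Lemma rep_down_nseq v G k : pos_ext G ->
  rep (down v) G (nseq k (mk 0)) = k%:R * G (nseq k (mk 0)).
Proof.
elim: k G => [|k IH] G HG; first by rewrite mul0r.
have -> z : rep (down v) G (nseq k.+1 z) =
  G (down v z :: nseq k z) + rep (down v) (fun t => G (z :: t)) (nseq k z) by [].
rewrite (IH (fun t => G (mk 0 :: t))); last by move=> s1; apply: (HG (mk 0 :: s1)).
rewrite (HG [::] _ (mk 0)) => [|w w0]; last by rewrite /down /mk w0 ltn_addr.
by rewrite -natr1 /=; ring.
Qed.

Lemma rep_down_slist v H p k : pos_ext H ->
  (forall s1 s2, H (s1 ++ (fun=> 0) :: s2) = 0) ->
  rep (down v) H (map ex p ++ nseq k (mk 0)) =
  dec v (fun t => H (map ex t ++ nseq k (mk 0))) p +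
  k%:R * H (map ex p ++ nseq k (mk 0)).
Proof.
move=> HH H0; rewrite rep_cat; congr (_ + _).
  elim: p H HH H0 => //= q p IH H HH H0.
  rewrite (IH (fun t => H (ex q :: t))); last 2 first.
  - by move=> s1; apply: (HH (ex q :: s1)).
  - by move=> s1; apply: (H0 (ex q :: s1)).
  congr (_ + _); case: ltnP => vq.
    congr H; congr (_ :: _); apply/funext => w; rewrite /down /ex.
    by congr (_%:R); congr (nat_of_bool _); lia.
  rewrite -[RHS](H0 [::] (map ex p ++ nseq k (mk 0))); apply: (HH [::]) => w w0; rewrite /down /ex.
  by rewrite gtn_eqF //; lia.
rewrite rep_down_nseq // => s1 x y s2 xy; rewrite !catA; exact: HH.
Qed.

Lemma eq_dec w (F F' : seq nat -> rat) p :
  (forall t, size t = size p -> F t = F' t) -> dec w F p = dec w F' p.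
Proof.
elim: p F F' => //= q p IH F F' E; congr (_ + _); first by case: ifP => // _; apply: E.
by apply: IH => t st; apply: E; rewrite /= st.
Qed.

Lemma eq_rep_size {T} (h : T -> T) (G G' : seq T -> rat) (t0 : seq T) :
  (forall t, size t = size t0 -> G t = G' t) -> rep h G t0 = rep h G' t0.
Proof.
elim: t0 G G' => //= q p IH F F' E; congr (_ + _); first exact: E.
by apply: IH => t st; apply: E; rewrite /= st.
Qed.

Definition matchings b : nat -> seq nat -> rat :=
  guard (size b) (fun a => popall b (V 0 [::] (ffall a))).

(** The new weight v takes a part equal to v or one of the [(size b).+1 - size p] free marks. One of
    these accounts for [matchings b], the others for v merged into a weight that takes a free mark;
    [dec] discards the mergers into weights that take a part. *)
Lemma matchings_cons v b a p : (0 < v)%N -> all (ltn 0) b ->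
  matchings (v :: b) a p = matchings b a p + rep (addn v) (fun b' => matchings b' a p) b +
    pop (eqn_ind v) (matchings b a) p - dec v (matchings b a) p.
Proof.
move=> v0 b0; set H := popall b (V 0 [::] (ffall a)).
have HH : pos_ext H by apply: pos_ext_popall.
have E1 : rep (addn v) (fun b' => matchings b' a p) b =
  if (size p <= size b)%N then rep (down v) H (slist (size b) p) else 0.
  rewrite (@eq_rep_size _ _ _ (fun b' => if (size p <= size b)%N then
     popall b' (V 0 [::] (ffall a)) (slist (size b) p) else 0)) => [|t st].
    by case: ifP => _; rewrite ?rep0 // rep_popall.
  by rewrite /matchings /guard st.
have E2 : pop (eqn_ind v) (matchings b a) p = if (size p <= (size b).+1)%N then
   pop (eqn_ind v) (fun t => H (map ex t ++ nseq ((size b).+1 - size p) (mk 0))) p else 0.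
  case: ifP => sp; last first.
    apply: pop_eq0 => s1 q s2 Ep; rewrite /matchings /guard.
    rewrite ifF ?mulr0 //; move: sp; rewrite Ep !size_cat /=; lia.
  apply: eq_pop_in => s1 q s2 Ep; congr (_ * _); rewrite /matchings /guard /slist.
  have -> : (size (s1 ++ s2) <= size b)%N by move: sp; rewrite Ep !size_cat /=; lia.
  rewrite -/H; congr (H (_ ++ nseq _ _)); move: sp; rewrite Ep !size_cat /=; lia.
have E3 : dec v (matchings b a) p = if (size p <= size b)%N then
   dec v (fun t => H (map ex t ++ nseq (size b - size p) (mk 0))) p else 0.
  case: ifP => sp.
    by apply: eq_dec => t st; rewrite /matchings /guard /slist st sp.
  rewrite (@eq_dec _ _ (fun=> 0)) => [|t st]; last by rewrite /matchings /guard st sp.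
  by elim: p {sp E1 E2} => //= q p ->; rewrite if_same addr0.
rewrite E1 E2 E3 /matchings {1 2}/guard /= -/H.
case: (ltngtP (size p) (size b).+1) => [sp|sp|sp].
- rewrite -ltnS sp /slist (pop_slist _ _ _ v0) subSn //= rep_down_slist //; last first.
    exact: popall_fun0.
  by rewrite -natr1; ring.
- by rewrite leqNgt (ltnW sp) /=; ring.
- by rewrite sp ltnn /slist sp subnn /= (pop_slist _ _ 0 v0); ring.
Qed.

Lemma Tsum_rep {T} lam (h : T -> T) (g : seq T -> nat -> seq nat -> rat) (t0 : seq T) :
  Tsum lam (fun a p => rep h (fun t => g t a p) t0) = rep h (fun t => Tsum lam (g t)) t0.
Proof.
elim: t0 g => [|x t0 IH] g; first exact: Tsum0.
by rewrite /= -IH -TsumD.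
Qed.

End Matchings.

(** * End of the scan: free permutations of the finished pieces *)

Section Base.
Context {T : finType}.
Implicit Types (w : T -> nat) (l : seq T) (lam : seq nat).

Lemma sum_merge_rep (H : seq nat -> rat) w x l : uniq (x :: l) ->
  \sum_(z <- l) H (map (wmerge w x z) l) = rep (addn (w x)) H (map w l).
Proof.
elim: l H => [|z l IH] H /=; first by rewrite big_nil.
rewrite inE negb_or => /and3P[/andP[xz xl] zl ul].
rewrite big_cons /= {1}/wmerge eq_sym (negPf xz) eqxx addnC; congr (H (_ :: _) + _).
  apply/eq_in_map => t tl; rewrite /wmerge.
  by rewrite (negPf (memPn xl t tl)) (negPf (memPn zl t tl)).
have ux : uniq (x :: l) by rewrite /= xl.
rewrite -(IH (fun t => H (w z :: t)) ux) big_seq [RHS]big_seq.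
apply: eq_bigr => t tl; congr (H (_ :: _)).
by rewrite /wmerge eq_sym (negPf xz) eq_sym (negPf (memPn zl t tl)).
Qed.

(** [Rs_split] and [matchings_cons] run in parallel: [Tsum_pop_dec] turns the difference of the
    [pop] and [dec] terms into the deletion of an entry of [lam]. *)
Lemma Rs_matchings lam w l : uniq l ->
  (forall t, t \notin l -> w t = 0%N) -> (forall t, t \in l -> (0 < w t)%N) ->
  Rs lam [set t in l] w = Tsum lam (matchings (map w l)).
Proof.
elim: l lam w => [|x l IH] lam w ul w0 w1.
  rewrite /Rs (big_pred1 1%g) => [|r]; last first.
    apply/idP/eqP => [/fintype.subsetP rL|->]; last exact: perm_on1.
    apply/permP => t; rewrite perm1; apply/eqP/negPn/negP => /rL.
    by rewrite !inE.
  have c0 m : cyc 1%g w m = 0.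
    by rewrite /cyc big1 ?mul0r // => t _; apply: w0.
  case: lam => [|m lam].
    by rewrite /= /matchings /guard /slist /= /V /ffall.
  rewrite Gf_cons0 // Tsum_eq0 // => a p ap; rewrite /matchings /guard /slist /=.
  case: p ap => [|q p] //=; rewrite addn0 /V /ffall; case: a => //.
have /andP[xl ul'] := ul.
have xL : x \in [set t in x :: l] by rewrite !inE eqxx.
have Lx : [set t in x :: l] :\ x = [set t in l].
  apply/setP => t; rewrite !inE; case: eqVneq => [->|] //=.
  by rewrite (negPf xl).
have wx : (0 < w x)%N by apply: w1; rewrite mem_head.
have IHw mu z : (z == x) || (z \in l) ->
    Rs mu [set t in l] (wmerge w x z) = Tsum mu (matchings (map (wmerge w x z) l)).
  move=> zxl; apply: IH => // t tl; rewrite /wmerge; case: eqVneq => // tx.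
  - case: eqVneq => [tz|_]; last by apply: w0; rewrite inE negb_or tx.
    by move: zxl; rewrite -tz (negPf tx) (negPf tl).
  - by rewrite tx (negPf xl) in tl.
  - by case: eqP => _; [rewrite addn_gt0 wx orbT | apply: w1; rewrite inE tl orbT].
rewrite (Rs_split _ xL wx) Lx.
have mx : map (wmerge w x x) l = map w l.
  apply/eq_in_map => t tl; rewrite /wmerge.
  by case: eqVneq => // tx; rewrite tx (negPf xl) in tl.
rewrite IHw ?eqxx // mx.
rewrite (@eq_pop _ _ (eqn_ind (w x)) _ (fun mu => Tsum mu (matchings (map w l)))) //; last first.
  by move=> mu; rewrite IHw ?eqxx // mx.
rewrite (eq_bigl (fun z => z \in l)) => [|z]; last by rewrite inE.
rewrite -big_uniq //= big_seq (eq_bigr (fun z => Tsum lam (matchings (map (wmerge w x z) l)))).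
  rewrite -big_seq (sum_merge_rep (fun b => Tsum lam (matchings b))) //.
  rewrite -Tsum_rep /= [RHS](@eq_Tsum _ _ (fun a p => matchings (map w l) a p +
    rep (addn (w x)) (fun b' => matchings b' a p) (map w l) +
    pop (eqn_ind (w x)) (matchings (map w l) a) p +
    -1 * dec (w x) (matchings (map w l) a) p)).
    by rewrite !TsumD TsumZ Tsum_pop_dec //; ring.
  move=> a p _ _; rewrite matchings_cons ?mulN1r //.
  by apply/allP => v /mapP[t tl ->]; apply: w1; rewrite inE tl orbT.
by move=> z zl; rewrite IHw // zl orbT.
Qed.

End Base.

(** * The sum over permutations satisfies the scan recursion *)

Section Link.
Context {T : finType}.
Implicit Types (w : T -> nat) (l u v A B U W : seq T) (s r : {perm T}) (lam mu : seq nat).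

Lemma popall_size b phi (t : seq wfun) : size t != size b -> popall b (V 0 [::] phi) t = 0.
Proof.
elim: b t => [|m b IH] t st /=; first by case: t st => // y t _; rewrite V0_cons.
apply: pop_eq0 => s1 y s2 Et; rewrite IH ?mulr0 //.
by move: st; rewrite Et !size_cat /=; lia.
Qed.

Lemma size_slist j p : (size p <= j)%N -> size (slist j p) = j.
Proof. by move=> pj; rewrite size_cat size_map size_nseq subnKC. Qed.

(* All subsequences of the reversal of u: u lists the unscanned points from the top. *)
Fixpoint subl u : seq (seq T) :=
  if u is z :: v then subl v ++ [seq rcons U z | U <- subl v] else [:: [::]].

Lemma subl_sub u U : U \in subl u -> {subset U <= u}.
Proof.
elim: u U => [|z u IH] U /=; first by rewrite inE => /eqP ->.
rewrite mem_cat => /orP[/IH uI t /uI|/mapP[U' /IH uI ->] t]; first by rewrite inE orbC => ->.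
by rewrite mem_rcons !inE => /orP[->//|/uI ->]; rewrite orbT.
Qed.

(* Pairs (I, J) of subsets of the unscanned points such that s maps I followed by the waiting
   points A increasingly onto J; m is the number of points that have left the queue, and the
   size condition says that j points of the whole set lie outside the subsequence. *)
Definition npairs j u A m s : rat :=
  \sum_(U <- subl u) \sum_(W <- subl u)
     ((size U + j == m + size u)%N && (map s (U ++ rev A) == W))%:R.

Lemma npairs_split j z v A m s : npairs j (z :: v) A m s =
  npairs j v A m.+1 s + npairs j v (rcons A z) m s +
  \sum_(U <- subl v) \sum_(W <- subl v)
     ((size U + j == m.+1 + size v)%N && (map s (U ++ rev A) == rcons W z))%:R +
  \sum_(U <- subl v) \sum_(W <- subl v)
     ((size U + j == m + size v)%N && (map s (U ++ rev (rcons A z)) == rcons W z))%:R.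
Proof.
rewrite /npairs /= big_cat /= big_map -!big_split /=; apply: eq_bigr => U _.
rewrite !big_cat !big_map /= size_rcons !(addnS, addSn) eqSS rev_rcons cat_rcons; ring.
Qed.

(** If z lies in the image, it is the largest value still to be attained, so it is attained at x,
    the oldest and hence largest waiting point. *)
Lemma npairs_cons j z v x A m s : npairs j (z :: v) (x :: A) m s =
  npairs j v (x :: A) m.+1 s + npairs j v (rcons (x :: A) z) m s +
  (s x == z)%:R * npairs j v A m.+1 s + (s x == z)%:R * npairs j v (rcons A z) m s.
Proof.
rewrite npairs_split; congr (_ + _ + _ + _); rewrite /npairs mulr_sumr;
  apply: eq_bigr => U _; rewrite mulr_sumr; apply: eq_bigr => W _.
- rewrite rev_cons -rcons_cat map_rcons eqseq_rcons andbA -natrM mulnC; by do 3?case: (_ == _).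
- by rewrite rcons_cons rev_cons -rcons_cat map_rcons eqseq_rcons andbA; do 3?case: (_ == _); rewrite ?mulr1 ?mulr0 ?mul0r.
Qed.

(** With no point waiting, z in both domain and image is fixed, and the image-only case for [s] is
    the domain-only case for its inverse. *)
Lemma npairs_nil j z v m s : npairs j (z :: v) [::] m s =
  npairs j v [::] m.+1 s + npairs j v [:: z] m s +
  npairs j v [:: z] m s^-1%g + (s z == z)%:R * npairs j v [::] m s.
Proof.
rewrite npairs_split; congr (_ + _ + _ + _); last first.
  rewrite /npairs mulr_sumr; apply: eq_bigr => U _; rewrite mulr_sumr.
  apply: eq_bigr => W _; rewrite /= cats1 map_rcons eqseq_rcons cats0 andbA.
  by do 3?case: (_ == _); rewrite ?mulr1 ?mulr0 ?mul0r.
rewrite /npairs exchange_big; apply: eq_bigr => U _; apply: eq_bigr => W _.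
congr (nat_of_bool _)%:R; rewrite cats0 /= cats1.
have E : (map s W == rcons U z) = (map s^-1%g (rcons U z) == W).
  apply/eqP/eqP => <-; rewrite -map_comp -[RHS]map_id; apply: eq_map => t /=.
    by rewrite permK.
  by rewrite permKV.
rewrite E; case: (_ =P W) => [EW|_]; last by rewrite !andbF.
by rewrite -EW size_map size_rcons !addSn eqSS.
Qed.

(** The two permutations differ only in where they take the values x and z, and an image inside [v]
    contains neither. *)
Lemma npairs_contract j x z v A m r : x \notin v -> z \notin v ->
  npairs j v A m (r * tperm x z)%g = npairs j v A m r.
Proof.
move=> xv zv; apply: eq_bigr => U _; rewrite big_seq [RHS]big_seq.
apply: eq_bigr => W Jv; congr (nat_of_bool (_ && _))%:R.
have tJ : map (tperm x z) W = W.
  rewrite -[RHS]map_id; apply/eq_in_map => t /(subl_sub Jv) tv.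
  by apply: tpermD; [apply: contraNneq xv => -> | apply: contraNneq zv => ->].
rewrite -[RHS](inj_eq (inj_map (@perm_inj _ (tperm x z)))) tJ -map_comp.
by congr (_ == _); apply: eq_map => t; rewrite permM.
Qed.

Definition state l u w := [/\ uniq l, forall t, t \notin l -> w t = 0%N,
  forall t, t \in l -> (0 < w t)%N & forall t, t \in u -> w t = 1%N].

Lemma state_perm l l' u u' w : perm_eq l l' -> {subset u' <= u} ->
  state l u w -> state l' u' w.
Proof.
move=> ll uu [ul w0 w1 wu]; split; first by rewrite -(perm_uniq ll).
- by move=> t tl; apply: w0; rewrite (perm_mem ll).
- by move=> t tl; apply: w1; rewrite (perm_mem ll).
by move=> t /uu /wu.
Qed.

Lemma state_wmerge l u w x z : state (x :: l) u w -> (z == x) || (z \in l) ->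
  x \notin u -> z \notin u -> state l u (wmerge w x z).
Proof.
move=> [/= /andP[xl ul] w0 w1 wu] zxl xu zu; split=> // t tl; rewrite /wmerge.
- case: eqVneq => // tx; case: eqVneq => [tz|_].
    by move: zxl; rewrite -tz (negPf tx) (negPf tl).
  by apply: w0; rewrite inE negb_or tx.
- case: eqVneq => [tx|_]; first by rewrite -tx tl in xl.
  case: eqP => _; last by apply: w1; rewrite inE tl orbT.
  by rewrite addn_gt0 (w1 x) ?orbT // mem_head.
rewrite (negPf (memPn xu t tl)) (negPf (memPn zu t tl)); exact: wu.
Qed.

Definition Ssum lam j u A B w : rat :=
  \sum_(s | perm_on [set t in u ++ A ++ B] s) npairs j u A (size B) s * Gf lam (cyc s w).

Definition Tval lam j u A B w : rat :=
  Tsum lam (guard j (fun a => popall (map w B) (V (size u) (map w A) (ffall a)))).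

Lemma map_wmerge w x z l : x \notin l -> z \notin l -> map (wmerge w x z) l = map w l.
Proof.
move=> xl zl; apply/eq_in_map => t tl.
by rewrite /wmerge (negPf (memPn xl t tl)) (negPf (memPn zl t tl)).
Qed.

Lemma eq_popall b (H H' : seq wfun -> rat) : H =1 H' -> popall b H = popall b H'.
Proof. by move=> /funext ->. Qed.

Lemma Tval_cons lam j z v x A B w : w z = 1%N ->
  Tval lam j (z :: v) (x :: A) B w =
  Tval lam j v (x :: A) (z :: B) w + Tval lam j v (rcons (x :: A) z) B w +
  Tsum lam (guard j (fun a => popall ((w x).+1 :: map w B) (V (size v) (map w A) (ffall a)))) +
  Tsum lam (guard j (fun a => popall (map w B)
     (V (size v) (rcons (map w A) (w x).+1) (ffall a)))).
Proof.
move=> wz; rewrite /Tval -!TsumD; apply: eq_Tsum => a p _ _.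
rewrite -/(map w) /= map_rcons wz /guard; case: ifP => _; last by rewrite !addr0.
rewrite -!popall_pop -!popallD; apply: (congr1 (fun H => H _)).
by apply: eq_popall => t; rewrite VS1 /=; ring.
Qed.

Lemma Tval_nil lam j z v B w : w z = 1%N ->
  Tval lam j (z :: v) [::] B w =
  Tval lam j v [::] (z :: B) w + 2 * Tval lam j v [:: z] B w +
  (Tval lam j v [::] B w + pop (eqn_ind 1) (fun mu => Tval mu j v [::] B w) lam).
Proof.
move=> wz; rewrite /Tval -Tsum_mul_fix -!TsumZ -!TsumD; apply: eq_Tsum => a p _ _.
rewrite /= wz /guard; case: ifP => _; last by rewrite !mulr0 !addr0.
rewrite -!popall_pop -!popallZ -!popallD; apply: (congr1 (fun H => H _)).
by apply: eq_popall => t; rewrite VS0 shf_ffall VphiD VphiZ; ring.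
Qed.

Lemma sum_contract l l' x z j v A m lam w : perm_eq l (x :: l') -> uniq l ->
  z \in l -> x \notin v -> z \notin v ->
  \sum_(s | perm_on [set t in l] s)
     (s x == z)%:R * npairs j v A m s * Gf lam (cyc s w) =
  \sum_(r | perm_on [set t in l'] r)
     npairs j v A m r * Gf lam (cyc (r * tperm x z)%g w).
Proof.
move=> ll ul zl xv zv; have Lx : [set t in l'] = [set t in l] :\ x.
  apply/setP => t; rewrite !inE (perm_mem ll) inE; case: eqVneq => [->|] //=.
  by move: ul; rewrite (perm_uniq ll) /= => /andP[/negPf].
rewrite Lx; transitivity (\sum_(s | perm_on [set t in l] s && (s x == z))
     npairs j v A m s * Gf lam (cyc s w)).
  rewrite big_mkcondr; apply: eq_bigr => s _.
  by case: eqP => _; rewrite ?mul1r ?mul0r.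
rewrite perm_on_contract ?inE ?(perm_mem ll) ?mem_head //.
  by apply: eq_bigr => r _; rewrite npairs_contract.
by rewrite -(perm_mem ll).
Qed.

Lemma perm_on_not_in l' l x r : perm_eq l (x :: l') -> uniq l ->
  perm_on [set t in l'] r -> r x = x.
Proof.
move=> ll; rewrite (perm_uniq ll) => /andP[xl _] /out_perm; apply; by rewrite inE.
Qed.

Lemma Ssum_eq lam j u A B m w (l : seq T) : perm_eq l (u ++ A ++ B) -> m = size B ->
  \sum_(s | perm_on [set t in l] s) npairs j u A m s * Gf lam (cyc s w) =
  Ssum lam j u A B w.
Proof.
move=> ll ->; apply: eq_bigl => s; congr (perm_on _ _).
by apply/setP => t; rewrite !inE (perm_mem ll).
Qed.

(** Each choice for the next point z matches one term of [V], an arrow from the queue to z being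
    contracted. When no point is left, [Rs_matchings] evaluates the sum over permutations of [B]. *)
Lemma npairs_Gf_sum lam j u A B w : state (u ++ A ++ B) u w ->
  Ssum lam j u A B w = Tval lam j u A B w.
Proof.
elim: u lam A B w => [|z v IH] lam A B w st.
  case: A st => [|x A] /= st; last first.
    rewrite /Ssum big1 => [|s _].
      rewrite /Tval (@eq_Tsum _ _ (fun _ _ => 0)) ?Tsum0 // => a p _ _.
      by rewrite /guard; case: ifP => // _; rewrite -[RHS](popall0 (map w B) (slist j p)).
    rewrite /npairs /= !big_seq1 /= rev_cons map_rcons.
    by case: (map s _) => [|? ?]; rewrite andbF mul0r.
  have [jB|jB] := eqVneq j (size B); last first.
    rewrite /Ssum big1 => [|s _].
      rewrite /Tval (@eq_Tsum _ _ (fun _ _ => 0)) ?Tsum0 // => a p _ _.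
      rewrite /guard; case: ifP => // pj; rewrite popall_size //.
      by rewrite size_slist // size_map.
    by rewrite /npairs /= !big_seq1 /= addn0 add0n (negPf jB) mul0r.
  have [ul w0 w1 _] := st.
  have := Rs_matchings lam ul w0 w1; rewrite /matchings size_map /Tval jB => <-.
  apply: eq_bigr => s _.
  by rewrite /npairs /= !big_seq1 /= addn0 add0n eqxx mul1r.
have [/= /andP[zl ul] w0 w1 wu] := st.
have wz : w z = 1%N by apply: wu; rewrite mem_head.
have zv : z \notin v by apply: contraNN zl; rewrite !mem_cat => ->.
have vsub : {subset v <= z :: v} by move=> t tv; rewrite inE tv orbT.
have P1 A' : perm_eq (z :: v ++ A' ++ B) (v ++ A' ++ z :: B).
  by apply/seq.permP => e; rewrite /= !count_cat /=; lia.
have P2 A' : perm_eq (z :: v ++ A' ++ B) (v ++ rcons A' z ++ B).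
  by apply/seq.permP => e; rewrite /= cat_rcons !count_cat /=; lia.
have S1 : state (v ++ A ++ z :: B) v w by apply: state_perm st => //; apply: P1.
have S2 : state (v ++ rcons A z ++ B) v w by apply: state_perm st => //; apply: P2.
case: A st zl ul w0 w1 P1 P2 S1 S2 => [|x A] st zl ul w0 w1 P1 P2 S1 S2.
  have S3 : state (v ++ [::] ++ B) v (wmerge w z z).
    apply: state_wmerge => //; last by rewrite eqxx.
    by apply: state_perm st.
  have zB : z \notin B by apply: contraNN zl; rewrite mem_cat orbC => ->.
  have EB mu : Tval mu j v [::] B w = Ssum mu j v [::] B (wmerge w z z).
    by rewrite IH // /Tval /= map_wmerge.
  rewrite Tval_nil // EB -(IH lam [::] (z :: B)) // -(IH lam [:: z] B) //.
  rewrite (@eq_pop _ _ (eqn_ind 1) _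
    (fun mu => Ssum mu j v [::] B (wmerge w z z))) //.
  (* Inversion preserves the cycle weights, so the image-only case equals the domain-only one: this
     is the factor 2 in [V]. *)
  have E (F : {perm T} -> rat) : \sum_(s | perm_on [set t in z :: v ++ B] s) F s^-1%g =
      \sum_(s | perm_on [set t in z :: v ++ B] s) F s.
    rewrite [RHS](reindex_inj invg_inj) /=; apply: eq_bigl => s.
    by apply/idP/idP => /perm_onV; rewrite ?invgK.
  transitivity (Ssum lam j v [::] (z :: B) w + Ssum lam j v [:: z] B w +
     Ssum lam j v [:: z] B w + \sum_(s | perm_on [set t in z :: v ++ B] s)
       (s z == z)%:R * npairs j v [::] (size B) s * Gf lam (cyc s w)).
    have e1 : perm_eq (z :: v ++ B) (v ++ [::] ++ z :: B) := P1 [::].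
    have e2 : perm_eq (z :: v ++ B) (v ++ [:: z] ++ B) := P2 [::].
    rewrite -(Ssum_eq lam j w e1 (erefl _)) -(Ssum_eq lam j w e2 (erefl _)).
    rewrite -[X in _ = _ + X + _]E -!big_split; apply: eq_bigr => s _ /=.
    by rewrite npairs_nil cycV; ring.
  rewrite (@sum_contract (z :: v ++ B) (v ++ B) z z) ?mem_head //=; last by rewrite zl.
  rewrite (eq_bigr (fun r => npairs j v [::] (size B) r * Gf lam (cyc r (wmerge w z z)) +
     pop (eqn_ind 1) (fun mu => npairs j v [::] (size B) r * Gf mu (cyc r (wmerge w z z))) lam)).
    by rewrite big_split -pop_sum /=; rewrite /Ssum /=; ring.
  move=> r rL; rewrite tperm1 mulg1 popZ -mulrDr -Gf_shift; congr (_ * Gf _ _).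
  apply/funext => l; rewrite -wz; apply: cyc_fix; last by rewrite wz.
  apply: (perm_on_not_in _ _ rL) => //; by rewrite /= zl.
have [xz xl] : x != z /\ x \notin v.
  split; first by apply: contraNneq zl => <-; rewrite !mem_cat mem_head orbT.
  apply/negP => xv; move: ul; rewrite cat_uniq => /and3P[_ /hasPn/(_ x) H _].
  by have := H (mem_head _ _); rewrite /= xv.
have xzl : z \in z :: v ++ (x :: A) ++ B by rewrite mem_head.
have P3 : perm_eq (z :: v ++ (x :: A) ++ B) (x :: v ++ A ++ z :: B).
  by apply/seq.permP => e; rewrite /= !count_cat /= !count_cat /=; lia.
have P4 : perm_eq (z :: v ++ (x :: A) ++ B) (x :: v ++ rcons A z ++ B).
  by apply/seq.permP => e; rewrite /= cat_rcons !count_cat /= !count_cat /=; lia.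
have S3 : state (v ++ A ++ z :: B) v (wmerge w x z).
  apply: state_wmerge => //; first by apply: state_perm st.
  by rewrite !mem_cat mem_head !orbT.
have S4 : state (v ++ rcons A z ++ B) v (wmerge w x z).
  apply: state_wmerge => //; first by apply: state_perm st.
  by rewrite !mem_cat mem_rcons mem_head !orbT.
have [xA zA xB zB] : [/\ x \notin A, z \notin A, x \notin B & z \notin B].
  move: zl ul; rewrite !mem_cat inE !negb_or cat_uniq /= mem_cat negb_or.
  case/andP=> _ /andP[/andP[_ ->] ->] /and4P[_ _ + _].
  by rewrite negb_or => /andP[-> ->].
have mz : wmerge w x z z = (w x).+1.
  by rewrite /wmerge eq_sym (negPf xz) eqxx wz add1n.
rewrite Tval_cons // -!IH //.
have -> : Tsum lam (guard j (fun a => popall ((w x).+1 :: map w B) (V (size v) (map w A) (ffall a))))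
   = Ssum lam j v A (z :: B) (wmerge w x z).
  by rewrite IH // /Tval /= mz !map_wmerge.
have -> : Tsum lam (guard j (fun a => popall (map w B)
     (V (size v) (rcons (map w A) (w x).+1) (ffall a)))) = Ssum lam j v (rcons A z) B (wmerge w x z).
  by rewrite IH // /Tval map_rcons mz !map_wmerge.
transitivity (Ssum lam j v (x :: A) (z :: B) w + Ssum lam j v (rcons (x :: A) z) B w +
   \sum_(s | perm_on [set t in z :: v ++ (x :: A) ++ B] s)
      (s x == z)%:R * npairs j v A (size B).+1 s * Gf lam (cyc s w) +
   \sum_(s | perm_on [set t in z :: v ++ (x :: A) ++ B] s)
      (s x == z)%:R * npairs j v (rcons A z) (size B) s * Gf lam (cyc s w)).
  rewrite -(Ssum_eq lam j w (P1 (x :: A)) (erefl _)) -(Ssum_eq lam j w (P2 (x :: A)) (erefl _)).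
  rewrite -!big_split; apply: eq_bigr => s _ /=.
  by rewrite npairs_cons; ring.
rewrite (sum_contract _ _ _ _ _ P3) //; last by rewrite /= zl.
rewrite (sum_contract _ _ _ _ _ P4) //; last by rewrite /= zl.
congr (_ + _ + _ + _); apply: eq_bigr => r rL; rewrite cyc_contract //.
  by apply: (perm_on_not_in P3 _ rL); rewrite /= zl.
by apply: (perm_on_not_in P4 _ rL); rewrite /= zl.
Qed.

End Link.

(** * Specialization to unit weights and the symmetric group *)

Section Symmetric.
Implicit Types (n k j : nat) (lam : seq nat).

Lemma mem_subl {T : finType} (u U : seq T) : (U \in subl u) = subseq U (rev u).
Proof.
elim: u U => [|z v IH] U /=; first by rewrite inE; case: U.
rewrite mem_cat rev_cons; apply/orP/idP => [[|/mapP[U' + ->]]|/subseqP[m sm ->]].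
- by rewrite IH => /subseq_trans; apply; apply: subseq_rcons.
- by rewrite IH => UU; rewrite -!cats1 cat_subseq.
case/lastP: m sm => [|m b]; first by rewrite size_rcons.
rewrite !size_rcons => -[sm]; rewrite mask_rcons //; case: b.
  by right; apply/mapP; exists (mask m (rev v)); rewrite ?cats1 // IH mask_subseq.
by left; rewrite cats0 IH mask_subseq.
Qed.

Lemma subl_uniq {T : finType} (u : seq T) : uniq u -> uniq (subl u).
Proof.
elim: u => //= z v IH /andP[zv /IH uv]; rewrite cat_uniq uv /=.
rewrite map_inj_uniq ?uv ?andbT; last by move=> a b /rcons_inj[].
apply/hasPn => U /mapP[U' _ ->]; apply/negP => /subl_sub/(_ z).
by rewrite mem_rcons mem_head (negPf zv) => /(_ isT).
Qed.

Lemma mem_subl_ord n (U : seq 'I_n) :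
  (U \in subl (rev (enum 'I_n))) = sorted ltn (map val U).
Proof.
rewrite mem_subl revK; apply/idP/idP => [UE|sU].
  have : subseq (map val U) (map val (enum 'I_n)) by apply: map_subseq.
  rewrite val_enum_ord => /subseq_sorted; apply; [exact: ltn_trans | exact: iota_ltn_sorted].
have -> : U = [seq i <- enum 'I_n | i \in U]; last exact: filter_subseq.
apply: (inj_map val_inj); apply: (@irr_sorted_eq _ ltn) => //.
- exact: ltn_trans.
- exact: ltnn.
- have : subseq (map val [seq i <- enum 'I_n | i \in U]) (map val (enum 'I_n)).
    by apply/map_subseq/filter_subseq.
  rewrite val_enum_ord => /subseq_sorted; apply; [exact: ltn_trans | exact: iota_ltn_sorted].
move=> i; apply/mapP/mapP => -[t tU ->]; exists t => //.
  by rewrite mem_filter tU mem_enum.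
by move: tU; rewrite mem_filter => /andP[].
Qed.

Lemma npairs_Nid n k (s : 'S_n) : (k <= n)%N ->
  npairs (n - k) (rev (enum 'I_n)) [::] 0 s = (Nid k s)%:R.
Proof.
move=> kn; rewrite /npairs size_rev size_enum_ord add0n.
have ul : uniq (subl (rev (enum 'I_n))) by rewrite subl_uniq // rev_uniq enum_uniq.
pose P (U : seq 'I_n) := (size U == k) && sorted ltn (map val (map s U)).
transitivity (\sum_(U <- subl (rev (enum 'I_n))) (P U)%:R : rat).
  apply: eq_bigr => U _; rewrite /= cats0 /P -mem_subl_ord.
  have -> : (size U + (n - k) == n)%N = (size U == k) by lia.
  case: (size U == k) => /=; last by rewrite big1.
  rewrite -natr_sum; congr (_%:R).
  elim: (subl _) ul => [|W L IH] /=; first by rewrite big_nil.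
  move=> /andP[WL uL]; rewrite big_cons inE IH //; case: eqVneq => [->|] //=.
  by rewrite (negPf WL).
rewrite -natr_sum; congr (_%:R); rewrite -big_mkcond /= sum1_count -size_filter.
rewrite /Nid cardE -(size_map val); apply: perm_size; apply: uniq_perm.
- exact: filter_uniq.
- by rewrite map_inj_uniq ?enum_uniq //; apply: val_inj.
move=> U; rewrite mem_filter mem_subl_ord /P; apply/idP/mapP.
  case/andP=> /andP[sU sU1] sU2; exists (Tuple sU) => //.
  by rewrite mem_enum inE /= sU2 /= -map_comp in sU1 *.
case=> t; rewrite mem_enum inE => /andP[t1 t2] ->.
by rewrite size_tuple eqxx t1 -map_comp t2.
Qed.

Lemma cyc_ncycles n (s : 'S_n) l : cyc s (fun=> 1%N) l = (ncycles l s)%:R.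
Proof.
have wtE t : wt s (fun=> 1%N) t = #|porbit s t| by rewrite /wt sum1_card.
have E : (\sum_(t | wt s (fun=> 1%N) t == l) 1 = ncycles l s * l)%N.
  rewrite (partition_big (porbit s) (fun c => (c \in porbits s) && (#|c| == l))) /=; last first.
    by move=> t; rewrite wtE => ->; rewrite imset_f.
  rewrite /ncycles -sum_nat_const; apply: eq_big => [c|c /andP[]]; first by rewrite !inE.
  case/imsetP => t _ -> /eqP ct; rewrite -[RHS]ct -[RHS]sum1_card; apply: eq_bigl => y.
  rewrite wtE -eq_porbit_mem; case: (porbit s y =P _) => [->|_]; last by rewrite andbF.
  by rewrite ct eqxx.
rewrite /cyc E; case: l E => [|l] _; last by rewrite natrM mulfK // pnatr_eq0.
rewrite muln0 mul0r /ncycles eq_card0 // => c; rewrite !inE.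
by apply/negP => /andP[/imsetP[t _ ->]]; rewrite (cardD1 t) porbit_id.
Qed.

Definition linkval n j : nat -> seq nat -> rat :=
  guard j (fun a => V n [::] (ffall a)).

Lemma sum_Gf_Nid n k lam : (k <= n)%N ->
  \sum_(s : 'S_n) Gf lam (fun l => (ncycles l s)%:R) * (Nid k s)%:R =
  Tsum lam (linkval n (n - k)).
Proof.
move=> kn; have st : state (rev (enum 'I_n) ++ [::] ++ [::]) (rev (enum 'I_n)) (fun=> 1%N).
  split=> //; first by rewrite !cats0 rev_uniq enum_uniq.
  by move=> t; rewrite !cats0 mem_rev mem_enum.
have := npairs_Gf_sum lam (n - k) st; rewrite /Tval /= size_rev size_enum_ord => <-.
rewrite /Ssum /=; apply: eq_big => [s|s _].
  apply/esym/fintype.subsetP => t _; by rewrite inE !cats0 mem_rev mem_enum.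
rewrite npairs_Nid // mulrC; congr (_ * Gf _ _).
by apply/funext => l; rewrite cyc_ncycles.
Qed.

End Symmetric.

(** * Half-integer binomials *)

Section HalfIntegerBinomials.
Implicit Types (i k n m : nat) (x : rat) (th : nat -> rat).

Definition halfr i : rat := i%:R / 2.

(** The falling factorial of x + i/2 of length i; its zeros are symmetric about -1/2. *)
Definition ppol i : {poly rat} := \prod_(t < i) ('X - (t%:R - halfr i)%:P).

(* (i/2)! / (k - i/2)!, which is 0 when k - i/2 is a negative integer. *)
Definition rho i k : rat :=
  (\prod_(t < i) (k%:R + halfr i - t%:R)) / \prod_(t < k) (k%:R + halfr i - t%:R).

Definition Qv th m k x : rat :=
  \sum_(i < m.+1) th i * rho i k * gbinom (x + halfr i) k.

Lemma halfr_ge0 i : 0 <= halfr i.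
Proof. by rewrite divr_ge0. Qed.

Lemma gbinom0 x : gbinom x 0 = 1.
Proof. by rewrite /gbinom big_ord0 invr1 mulr1. Qed.

Lemma gbinomS x k : k.+1%:R * gbinom x k.+1 = (x - k%:R) * gbinom x k.
Proof.
rewrite /gbinom big_ord_recr /= factS natrM invfM !mulrA divff ?pnatr_eq0 //.
by rewrite mul1r; ring.
Qed.

Lemma gbinomSS x k : k.+1%:R * gbinom (x + 1) k.+1 = (x + 1) * gbinom x k.
Proof.
rewrite /gbinom big_ord_recl /= factS natrM invfM !mulrA divff ?pnatr_eq0 //.
rewrite mul1r subr0 [_^-1 * _]mulrC -!mulrA; congr (_ * (_ * _)).
by apply: eq_bigr => t _; rewrite /bump /= add1n -natr1; ring.
Qed.

Lemma gbinom_nat n k : gbinom (n%:R : rat) k = 'C(n, k)%:R.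
Proof.
elim: k n => [|k IH] n; first by rewrite gbinom0 bin0.
have k0 : k.+1%:R != 0 :> rat by rewrite pnatr_eq0.
apply: (mulfI k0); rewrite gbinomS IH -natrM mul_bin_left natrM.
case: (leqP k n) => kn; first by rewrite natrB.
by rewrite bin_small // !mulr0.
Qed.

Lemma rho_den_gt0 i k : 0 < \prod_(t < k) (k%:R + halfr i - t%:R).
Proof.
apply: prodr_gt0 => t _; rewrite addrAC ltr_wpDr ?halfr_ge0 //.
by rewrite subr_gt0 ltr_nat.
Qed.

(** The rule x! = x (x - 1)! at x = k + 1 - i/2, in a form that also covers the zeros of [rho]. *)
Lemma rho_step i k : rho i k.+1 * (k.+1%:R - halfr i) = rho i k.
Proof.
have E : (\prod_(t < i) (k.+1%:R + halfr i - t%:R)) * (k.+1%:R - halfr i) =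
    (k.+1%:R + halfr i) * \prod_(t < i) (k%:R + halfr i - t%:R).
  transitivity (\prod_(t < i.+1) (k.+1%:R + halfr i - t%:R)).
    by rewrite big_ord_recr /=; congr (_ * _); rewrite /halfr; field.
  rewrite big_ord_recl /= subr0; congr (_ * _); apply: eq_bigr => t _.
  by rewrite /bump /= add1n -!natr1; ring.
have D : \prod_(t < k.+1) (k.+1%:R + halfr i - t%:R) =
    (k.+1%:R + halfr i) * \prod_(t < k) (k%:R + halfr i - t%:R).
  rewrite big_ord_recl /= subr0; congr (_ * _); apply: eq_bigr => t _.
  by rewrite /bump /= add1n -!natr1; ring.
have kh : k.+1%:R + halfr i != 0.
  by rewrite gt_eqF // ltr_pwDl ?halfr_ge0.
rewrite /rho D mulrAC E invfM !mulrA [_ * _ / _]mulrAC.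
by rewrite [_ * (_^-1)]mulrC !mulrA mulVf // mul1r.
Qed.

Lemma Qv0_step th m x : (x + 1) * Qv th m 0 (x + 1) = (x + 1) * Qv th m 0 x.
Proof. by congr (_ * _); apply: eq_bigr => i _; rewrite !gbinom0. Qed.

(** The recurrence [Sv_rec] stripped of a factorial. It holds for each i: the binomials leave over
    the factor k + 1 - i/2, which [rho_step] absorbs. *)
Lemma Qv_step th m k x : (x + 1) * Qv th m k.+1 (x + 1) =
  (x + k.+2%:R) * Qv th m k.+1 x + Qv th m k x.
Proof.
rewrite /Qv !mulr_sumr -big_split /=; apply: eq_bigr => i _.
rewrite -(rho_step i k); have k0 : k.+1%:R != 0 :> rat by rewrite pnatr_eq0.
have E1 := gbinomSS (x + halfr i) k; have E2 := gbinomS (x + halfr i) k.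
have {}E1 : gbinom (x + 1 + halfr i) k.+1 = (x + halfr i + 1) * gbinom (x + halfr i) k / k.+1%:R.
  by rewrite -E1 addrAC mulrC mulKf.
have {}E2 : gbinom (x + halfr i) k.+1 = (x + halfr i - k%:R) * gbinom (x + halfr i) k / k.+1%:R.
  by rewrite -E2 mulrC mulKf.
by rewrite E1 E2 -!natr1 in k0 *; field.
Qed.

Lemma ppol_basis m (p : {poly rat}) : (size p <= m.+1)%N ->
  exists th : nat -> rat, p = \sum_(i < m.+1) th i *: ppol i.
Proof.
have sp i : size (ppol i) = i.+1.
  by rewrite /ppol size_prod_XsubC /= -[index_enum _]enumT size_enum_ord.
have mp i : lead_coef (ppol i) = 1 by apply/monicP/monic_prod_XsubC.
elim: m p => [|m IH] p pm.
  exists (fun=> p`_0); rewrite big_ord1 /ppol big_ord0 alg_polyC.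
  exact: size1_polyC.
have [|th Eth] := IH (p - p`_m.+1 *: ppol m.+1).
  apply/leq_sizeP => j mj; rewrite coefB coefZ; move: mj.
  rewrite leq_eqVlt => /orP[/eqP <-|mj].
    by have := mp m.+1; rewrite lead_coefE sp /= => ->; rewrite mulr1 subrr.
  rewrite [p`_j]nth_default ?(leq_trans pm) // [(ppol _)`_j]nth_default ?sp //.
  by rewrite mulr0 subrr.
exists (fun i => if i == m.+1 then p`_m.+1 else th i).
rewrite big_ord_recr /= eqxx -[LHS](subrK (p`_m.+1 *: ppol m.+1)) Eth; congr (_ + _).
by apply: eq_bigr => i _; rewrite ltn_eqF.
Qed.

Lemma ppol_nat i k : (ppol i).[k%:R] = \prod_(t < i) (k%:R + halfr i - t%:R).
Proof. by rewrite horner_prod; apply: eq_bigr => t _; rewrite hornerXsubC; ring. Qed.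

(* The symmetry x -> - 1 - x multiplies ppol i by (-1) ^ i. *)
Lemma ppol_sym i : (0 < i)%N -> (ppol i).[0] + (ppol i).[-1] = 0.
Proof.
move=> i0; have E : (ppol i).[-1] = (-1) ^+ i * (ppol i).[0].
  rewrite /ppol !horner_prod -[X in (-1) ^+ X](card_ord i) -prodrN.
  rewrite (reindex_inj rev_ord_inj) /=; apply: eq_bigr => t _.
  by rewrite !hornerXsubC natrB ?ltn_ord // -natr1 /halfr; field.
case oi : (odd i); first by rewrite E -signr_odd oi expr1 mulN1r subrr.
rewrite E; suff -> : (ppol i).[0] = 0 by rewrite mulr0 addr0.
have hi : (i./2 < i)%N by rewrite -divn2 ltn_Pdiv.
rewrite /ppol horner_prod (bigD1 (Ordinal hi)) //= hornerXsubC.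
rewrite (_ : 0 - _ = 0) ?mul0r // sub0r /halfr -{2}(odd_double_half i) oi add0n.
by rewrite -muln2 natrM; field.
Qed.

(** At x = k the denominator of [rho] cancels the product in the binomial, so an expansion in [ppol]
    supplies the coefficients. *)
Lemma Qv_diag th m k : k`!%:R * Qv th m k k%:R =
  (\sum_(i < m.+1) th i *: ppol i).[k%:R].
Proof.
rewrite horner_sum mulr_sumr; apply: eq_bigr => i _; rewrite hornerZ ppol_nat.
have k0 : k`!%:R != 0 :> rat by rewrite pnatr_eq0 -lt0n fact_gt0.
have := rho_den_gt0 i k; rewrite lt_def => /andP[d0 _].
by rewrite /rho /gbinom; field; rewrite k0.
Qed.

Lemma Qv_poly th m k : exists2 p : {poly rat}, (size p <= k.+1)%N &
  forall x, p.[x] = Qv th m k x.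
Proof.
exists (\sum_(i < m.+1) (th i * rho i k / k`!%:R) *: \prod_(t < k) ('X - (t%:R - halfr i)%:P)).
  apply: leq_trans (size_sum _ _ _) _; apply/bigmax_leqP => i _.
  apply: leq_trans (size_scale_leq _ _) _.
  by rewrite size_prod_XsubC /= -[index_enum _]enumT size_enum_ord.
move=> x; rewrite horner_sum; apply: eq_bigr => i _; rewrite hornerZ horner_prod.
rewrite /gbinom [RHS]mulrA; congr (_ * _); apply: eq_bigr => t _.
by rewrite hornerXsubC; ring.
Qed.

Lemma poly_nat_eq0 (p : {poly rat}) n0 :
  (forall n, (n0 <= n)%N -> p.[n%:R] = 0) -> p = 0.
Proof.
move=> p0; apply/eqP/negPn/negP => pN0.
have := max_poly_roots (rs := [seq (n0 + n)%:R | n <- iota 0 (size p)]) pN0.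
rewrite size_map size_iota ltnn => H; suff : false by [].
apply: H.
  by apply/allP => y /mapP[n _ ->]; rewrite rootE p0 ?leq_addr.
rewrite map_inj_uniq ?iota_uniq // => a b /eqP.
by rewrite eqr_nat eqn_add2l => /eqP.
Qed.

End HalfIntegerBinomials.

(** * Marked sums and their two-term recurrence *)

Section MarkedSums.
Implicit Types (n k a : nat) (ls : seq nat).

(** Padded to n - k marks, one for each point outside the domain of the subsequence; [mk 0] imposes
    no condition on a piece. *)
Definition Sv a ls n k : rat :=
  V n [::] (ffall a) (map mk (ls ++ nseq (n - k - size ls) 0%N)).

(** [V_zero_rec] for one padding mark: deleting it keeps k, keeping it lowers k by one. For k = 0
    the kept marks outnumber the points. *)
Lemma Sv_rec a ls n k : (k + size ls <= n)%N ->
  Sv a ls n.+1 k = ((n + k.+1)%:R - (a + sumn ls)%:R) * Sv a ls n k +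
    (if k is k'.+1 then Sv a ls n k' else 0).
Proof.
move=> kn; set m := (n - k - size ls)%N.
have E : Sv a ls n.+1 k = V n.+1 [::] (ffall a) (map mk (0%N :: ls ++ nseq m 0%N)).
  rewrite /Sv (_ : (n.+1 - k - size ls)%N = m.+1); last by rewrite /m; lia.
  by apply: V_perm; apply/seq.permP => e; rewrite /= !count_cat /=; lia.
rewrite E V_zero_rec addrC; congr (_ + _).
  rewrite -/(Sv a ls n k) !(sumn_cat, sumn_nseq, size_cat, size_nseq) mul0n addn0.
  congr (_ * _); rewrite (_ : (size ls + m = n - k)%N); last by rewrite /m; lia.
  rewrite !natrD natrB; last by lia.
  by rewrite -natr1; ring.
case: k kn @m {E} => [|k] kn m.
  by rewrite V_size //= size_map size_cat size_nseq /m; lia.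
rewrite /Sv (_ : (n - k - size ls)%N = m.+1); last by rewrite /m; lia.
by apply: (@V_perm _ _ _ (0%N :: _)); apply/seq.permP => e; rewrite /= !count_cat /=; lia.
Qed.

Lemma Sv_small a ls n k : (k + size ls <= n)%N -> (k < a + sumn ls)%N -> Sv a ls n k = 0.
Proof.
move=> kn kl; apply: V_small.
rewrite sumn_cat sumn_nseq size_cat size_nseq mul0n /=; lia.
Qed.

Lemma size_le_sumn ls : all (ltn 0) ls -> (size ls <= sumn ls)%N.
Proof. by elim: ls => //= q ls IH /andP[q0 /IH]; lia. Qed.

Lemma Sv_base a ls : all (ltn 0) ls -> exists th : nat -> rat,
  (forall k, Sv a ls (k + (a + sumn ls)) k =
     (\sum_(i < (3 * (a + sumn ls)).+1) th i *: ppol i).[k%:R]) /\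
  ((0 < a + sumn ls)%N -> th 0%N = 0).
Proof.
move=> ls0; have sl := size_le_sumn ls0; set ell := (a + sumn ls)%N.
pose L := ls ++ nseq (ell - size ls) 0%N.
have sL : size L = ell by rewrite size_cat size_nseq subnKC // /ell; lia.
have [b sb bE] := V_vpoly a L.
have sumL : sumn L = sumn ls by rewrite sumn_cat sumn_nseq mul0n addn0.
have [|th Eth] := @ppol_basis (3 * ell) (b \Po ('X - (- ell%:R)%:P)).
  rewrite size_comp_poly2 ?size_XsubC // (leq_trans sb) // sL /ell; lia.
exists th; have Eb x : (\sum_(i < (3 * ell).+1) th i *: ppol i).[x] = b.[x + ell%:R].
  by rewrite -Eth !horner_simp opprK.
split=> [k|ell0].
  rewrite Eb -natrD -bE; last by rewrite sumL /ell; lia.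
  by rewrite /Sv addKn.
have B0 : (\sum_(i < (3 * ell).+1) th i *: ppol i).[0] = 0.
  rewrite Eb add0r -bE; last by rewrite sumL /ell; lia.
  by apply: V_small; rewrite sumL sL addn0 -/ell; lia.
(* The range of [V_vpoly] just reaches ell - 1, where ell marks exceed the number of points. *)
have B1 : (\sum_(i < (3 * ell).+1) th i *: ppol i).[-1] = 0.
  have -> : (-1 : rat) = (ell - 1)%:R - ell%:R by rewrite natrB //; ring.
  rewrite Eb subrK -bE; last by rewrite sumL /ell; lia.
  by rewrite V_size // size_map sL; lia.
(* By symmetry only i = 0 survives, the constant 1 counted twice. *)
have : (\sum_(i < (3 * ell).+1) th i *: ppol i).[0] +
    (\sum_(i < (3 * ell).+1) th i *: ppol i).[-1] = 2 * th 0%N.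
  rewrite !horner_sum -big_split big_ord_recl /= big1 => [|i _].
    by rewrite /ppol big_ord0 alg_polyC !hornerC; ring.
  by rewrite !hornerZ -mulrDr ppol_sym ?mulr0.
rewrite B0 B1 addr0 => /esym/eqP; rewrite mulf_eq0 pnatr_eq0 /= => /eqP //.
Qed.

(** The recurrence propagates the line N = k to k <= N. The line k = N + 1, required at the boundary
    of (ii), is recovered by solving the recurrence backwards. *)
Lemma Sv_formula a ls : all (ltn 0) ls -> exists th : nat -> rat,
  (forall k N, (k <= N)%N || (k == N.+1) && (size ls < a + sumn ls)%N ->
    Sv a ls (N + (a + sumn ls)) k = N`!%:R * Qv th (3 * (a + sumn ls)) k N%:R) /\
  ((0 < a + sumn ls)%N -> th 0%N = 0).
Proof.
move=> ls0; have sl := size_le_sumn ls0.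
have [th [Sb th0]] := Sv_base a ls0; exists th; split=> //.
set ell := (a + sumn ls)%N; rewrite -/ell in Sb.
have H k : forall N, (k <= N)%N ->
    Sv a ls (N + ell) k = N`!%:R * Qv th (3 * ell) k N%:R.
  have base i : Sv a ls (i + ell) i = i`!%:R * Qv th (3 * ell) i i%:R.
    by rewrite Qv_diag -Sb.
  elim: k => [|k IHk].
    elim=> [|N IH] _; first exact: base.
    rewrite addSn Sv_rec ?IH //; last by rewrite /ell; lia.
    transitivity (N`!%:R * ((N%:R + 1) * Qv th (3 * ell) 0 (N%:R + 1))).
      by rewrite Qv0_step -/ell !natrD; ring.
    by rewrite factS natrM -natr1; ring.
  elim=> [|N IH] //; rewrite leq_eqVlt => /orP[/eqP <-|kN]; first exact: base.
  have kN' : (k <= N)%N by lia.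
  rewrite addSn Sv_rec ?IH ?IHk //; last by rewrite /ell; lia.
  transitivity (N`!%:R * ((N%:R + 1) * Qv th (3 * ell) k.+1 (N%:R + 1))).
    by rewrite Qv_step -/ell !natrD; ring.
  by rewrite factS natrM -natr1; ring.
move=> k N /orP[kN|/andP[/eqP -> sell]]; first exact: H.
(* The coefficient of the unknown value in [Sv_rec] at [N + ell] and [N.+1]. *)
have N0 : (2 * N.+1)%:R != 0 :> rat by rewrite pnatr_eq0.
have := @Sv_rec a ls (N + ell) N.+1; rewrite -addSn (H N.+1 N.+1) // (H N N) // -/ell => E.
apply: (mulfI N0).
have -> : (2 * N.+1)%:R * Sv a ls (N + ell) N.+1 =
    N.+1`!%:R * Qv th (3 * ell) N.+1 N.+1%:R - N`!%:R * Qv th (3 * ell) N N%:R.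
  rewrite E ?addrK; last by rewrite /ell; lia.
  by congr (_ * _); rewrite natrM !natrD -!natr1; ring.
transitivity (N`!%:R * ((N%:R + 1) * Qv th (3 * ell) N.+1 (N%:R + 1)) -
    N`!%:R * Qv th (3 * ell) N N%:R).
  by rewrite factS natrM -natr1; ring.
by rewrite Qv_step (natrM _ 2) -!natr1; ring.
Qed.

End MarkedSums.

(** * The three forms of the average *)

Section QuasiPolynomials.
Implicit Types (n k a d : nat) (ls p : seq nat) (E : nat -> nat -> rat).

Definition thetaform d (th0 : rat) (th : nat -> nat -> rat) n k : rat :=
  th0 * ((k`!%:R)^-1 * 'C(n, k)%:R) +
  \sum_(1 <= l < d.+1) \sum_(1 <= i < (3 * l).+1)
    th i l * ((n - l)`!%:R / n`!%:R) * rho i k * gbinom (n%:R - l%:R + halfr i) k.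

(** The range stops one line short of (i), since the expansion in marks is only controlled there;
    [theta_boundary] adds the last line. *)
Definition has_theta d E := exists th0 th, forall n k, (k + d <= n)%N ->
  E n k = thetaform d th0 th n k.

Definition fixed_k_poly d E := forall k, exists2 p : {poly rat}, (size p <= k.+1)%N &
  forall n, (k + d - 1 <= n)%N -> (n, k) <> ((d - 1)%N, 0%N) -> E n k = p.[n%:R].

Definition fixed_codim_poly d E := forall j, exists2 p : {poly rat},
  (size p <= (d + 2 * j).+1)%N &
  forall n, (maxn j (d - 1) <= n)%N -> E n (n - j)%N = p.[n%:R] / n`!%:R.

Definition regular d E := [/\ has_theta d E, fixed_k_poly d E & fixed_codim_poly d E].

Definition lin_closed (P : (nat -> nat -> rat) -> Prop) :=
  forall c E E', P E -> P E' -> P (fun n k => E n k + c * E' n k).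

Lemma thetaformD d c th0 th th0' th' n k :
  thetaform d (th0 + c * th0') (fun i l => th i l + c * th' i l) n k =
  thetaform d th0 th n k + c * thetaform d th0' th' n k.
Proof.
rewrite /thetaform mulrDr !mulr_sumr mulrDl addrACA -mulrA; congr (_ + _).
rewrite -big_split; apply: eq_bigr => l _; rewrite mulr_sumr -big_split /=.
by apply: eq_bigr => i _; ring.
Qed.

Lemma has_theta_lin d : lin_closed (has_theta d).
Proof.
move=> c E E' [th0 [th H]] [th0' [th' H']].
exists (th0 + c * th0'), (fun i l => th i l + c * th' i l) => n k nk.
by rewrite thetaformD H // H'.
Qed.

Lemma size_lin (p q : {poly rat}) c m : (size p <= m)%N -> (size q <= m)%N ->
  (size (p + c *: q)%R <= m)%N.
Proof.
move=> pm qm; apply: leq_trans (size_polyD _ _) _; rewrite geq_max pm.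
exact: leq_trans (size_scale_leq _ _) qm.
Qed.

Lemma fixed_k_poly_lin d : lin_closed (fixed_k_poly d).
Proof.
move=> c E E' H H' k; have [p sp pE] := H k; have [q sq qE] := H' k.
exists (p + c *: q); first exact: size_lin.
by move=> n nk nk'; rewrite pE // qE // !horner_simp.
Qed.

Lemma fixed_codim_poly_lin d : lin_closed (fixed_codim_poly d).
Proof.
move=> c E E' H H' j; have [p sp pE] := H j; have [q sq qE] := H' j.
exists (p + c *: q); first exact: size_lin.
by move=> n nj; rewrite pE // qE // !horner_simp; ring.
Qed.

Lemma regular_lin d : lin_closed (regular d).
Proof.
move=> c E E' [H1 H2 H3] [H1' H2' H3'].
by split; [exact: has_theta_lin | exact: fixed_k_poly_lin | exact: fixed_codim_poly_lin].
Qed.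

Lemma regular_ext d E E' : (0 < d)%N -> (forall n k, (k <= n)%N -> E n k = E' n k) ->
  regular d E -> regular d E'.
Proof.
move=> d0 EE [[th0 [th H1]] H2 H3]; split.
- by exists th0, th => n k nk; rewrite -EE ?H1 //; lia.
- move=> k; have [p sp pE] := H2 k; exists p => // n nk nk'; rewrite -EE ?pE //; lia.
move=> j; have [p sp pE] := H3 j; exists p => // n nj; rewrite -EE ?pE //; exact: leq_subr.
Qed.

Lemma regular0 d : regular d (fun _ _ => 0).
Proof.
split.
- exists 0, (fun _ _ => 0) => n k _; rewrite /thetaform mul0r big1 ?addr0 // => l _.
  by rewrite big1 // => i _; rewrite !mul0r.
- by move=> k; exists 0; rewrite ?size_poly0 // => n _ _; rewrite hornerC.
by move=> j; exists 0; rewrite ?size_poly0 // => n _; rewrite hornerC mul0r.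
Qed.

Lemma rho0 k : rho 0 k = (k`!%:R)^-1.
Proof.
elim: k => [|k IH]; first by rewrite /rho !big_ord0 mul1r.
have := rho_step 0 k; rewrite IH /halfr mul0r subr0 factS natrM invfM => <-.
by rewrite mulrC mulfK // pnatr_eq0.
Qed.

Lemma Sv_has_theta a ls d : all (ltn 0) ls -> (a + sumn ls <= d)%N ->
  has_theta d (fun n k => Sv a ls n k / n`!%:R).
Proof.
move=> ls0 ld; have [th [Sth th0]] := Sv_formula a ls0; set ell := (a + sumn ls)%N in ld Sth th0.
have E n k : (k + d <= n)%N ->
    Sv a ls n k / n`!%:R = (n - ell)`!%:R / n`!%:R * Qv th (3 * ell) k (n%:R - ell%:R).
  move=> nk; have le : (ell <= n)%N by lia.
  rewrite -{1}(subnK le) Sth; last by apply/orP; left; lia.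
  by rewrite natrB // mulrAC.
have [ell0|ell0] := posnP ell.
  exists (th 0%N), (fun _ _ => 0) => n k nk.
  rewrite E // ell0 /thetaform muln0 /Qv big_ord1 rho0 /halfr mul0r addr0 subr0 gbinom_nat.
  rewrite subn0 divff ?pnatr_eq0 -?lt0n ?fact_gt0 // mul1r mulrA.
  rewrite big1 ?addr0 // => l _; rewrite big1 // => i _; by rewrite !mul0r.
(* For positive ell the coefficient [th 0] is 0, so the sum may start at i = 1; only ell = 0 feeds
   [th0]. *)
exists 0, (fun i l => if l == ell then th i else 0) => n k nk.
rewrite E // /thetaform mul0r add0r (bigD1_seq ell) ?mem_index_iota ?iota_uniq ?ell0 //=.
rewrite [X in _ = _ + X]big1 ?addr0 => [|l /negPf le]; last first.
  by rewrite big1 // => i _; rewrite le !mul0r.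
rewrite eqxx /Qv mulr_sumr -(big_mkord xpredT (fun i => _ * (th i * rho i k *
  gbinom (n%:R - ell%:R + halfr i) k))) big_ltn // th0 // !mul0r mulr0 add0r.
by apply: eq_bigr => i _; ring.
Qed.

(* At x = - 1 the left side of [Qv_step] vanishes; then move one step left at a time. *)
Lemma Qv_zero th m ell : (forall k x, (k < ell)%N -> Qv th m k x = 0) ->
  forall j k, (j < ell)%N -> Qv th m k (- j.+1%:R) = 0.
Proof.
move=> Q0; elim=> [|j IHj]; elim=> [|k IHk] jl.
- by rewrite Q0.
- have := Qv_step th m k (-1); rewrite addNr mul0r IHk // addr0 => /esym/eqP.
  rewrite mulf_eq0 => /orP[|/eqP //].
  by rewrite (_ : -1 + _ = k.+1%:R) ?pnatr_eq0 // -[k.+2%:R]natr1; ring.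
- by rewrite Q0 // (leq_ltn_trans _ jl).
have [kl|kl] := ltnP k.+1 ell; first by rewrite Q0.
have := Qv_step th m k (- j.+2%:R).
have -> : - j.+2%:R + 1 = - j.+1%:R :> rat by rewrite -(natr1 j.+1); ring.
rewrite IHj ?IHk //; last by lia.
rewrite mulr0 addr0 => /esym/eqP; rewrite mulf_eq0 => /orP[|/eqP //].
by rewrite addrC -natrB ?pnatr_eq0; lia.
Qed.

(** For k < ell too little weight is available, so [Qv] vanishes identically; [Qv_zero] then gives
    the roots -1, ..., -ell for every k. The product of the corresponding linear factors at N is (N
    + ell)! / N!. *)
Lemma Sv_fixed_k a ls : all (ltn 0) ls -> forall k, exists2 p : {poly rat},
  (size p <= k.+1)%N &
  forall N, (k <= N)%N || (k == N.+1) && (size ls < a + sumn ls)%N ->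
    Sv a ls (N + (a + sumn ls)) k / (N + (a + sumn ls))`!%:R = p.[(N + (a + sumn ls))%:R].
Proof.
move=> ls0 k; have sl := size_le_sumn ls0.
have [th [Sth _]] := Sv_formula a ls0; set ell := (a + sumn ls)%N in Sth *.
set M := (3 * ell)%N in Sth.
have Q0 k' x : (k' < ell)%N -> Qv th M k' x = 0.
  move=> kl; have [p _ pE] := Qv_poly th M k'; rewrite -pE.
  suff -> : p = 0 by rewrite hornerC.
  apply: (@poly_nat_eq0 p k') => N kN; rewrite pE.
  have N0 : N`!%:R != 0 :> rat by rewrite pnatr_eq0 -lt0n fact_gt0.
  apply: (mulfI N0); rewrite -Sth ?kN // mulr0 Sv_small //; rewrite -/ell //; lia.
have [p sp pE] := Qv_poly th M k.
pose rs := [seq - j.+1%:R | j <- iota 0 ell] : seq rat.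
have urs : uniq rs.
  rewrite map_inj_uniq ?iota_uniq // => i j /eqP.
  by rewrite eqr_opp eqr_nat => /eqP[].
have rrs : all (root p) rs.
  by apply/allP => y /mapP[j]; rewrite mem_iota => /= jl ->; rewrite rootE pE (Qv_zero Q0).
have [|q pq] := uniq_roots_prod_XsubC rrs; first by rewrite uniq_rootsE.
exists (q \Po ('X - ell%:R%:P)).
  rewrite size_comp_poly2 ?size_XsubC //; apply: leq_trans sp.
  have [->|qN0] := eqVneq q 0; first by rewrite size_poly0.
  rewrite pq size_Mmonic ?monic_prod_XsubC // size_prod_XsubC addnS /=.
  exact: leq_addr.
move=> N kN; rewrite Sth // -pE pq !horner_simp natrD addrK horner_prod.
have -> : \prod_(z <- rs) ('X - z%:P).[N%:R] = (N + ell)`!%:R / N`!%:R :> rat.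
  rewrite /rs; elim: ell {Sth M Q0 sp pE urs rrs pq kN} rs => [|l IH] rs.
    by rewrite big_nil addn0 divff // pnatr_eq0 -lt0n fact_gt0.
  rewrite -addn1 iotaD map_cat big_cat IH //= big_seq1 hornerXsubC add0n.
  by rewrite addn1 addnS factS natrM -addnS natrD; ring.
have f0 m : m`!%:R != 0 :> rat by rewrite pnatr_eq0 -lt0n fact_gt0.
by field; rewrite !f0.
Qed.

End QuasiPolynomials.

(** * Expansion of the factorial moments in marked sums *)

Section Expansion.
Implicit Types (n k a d : nat) (ls p : seq nat) (E : nat -> nat -> rat).

(* Interpolates between marks [ex], as they come from [Tsum], and marks [mk], for which the
   recurrence is available. *)
Definition mixed a p ls n k : rat :=
  (if (size p + size ls <= n - k)%N then
    V n [::] (ffall a) (map ex p ++ map mk (ls ++ nseq (n - k - (size p + size ls)) 0%N))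
  else 0) / n`!%:R.

Lemma mixed_cons a q p ls n k : (0 < q)%N ->
  mixed a (q :: p) ls n k = mixed a p (q.-1 :: ls) n k + -1 * mixed a p (q :: ls) n k.
Proof.
move=> q0; rewrite /mixed /= !addnS addSn; case: ifP => _; last by rewrite mul0r mulr0 addr0.
have -> : ex q = (fun w => mk q.-1 w - 1 * mk q w).
  apply/funext => w; by rewrite (mk_sub q.-1) prednK //; ring.
by rewrite V_head_sub !V_move -mulN1r; ring.
Qed.

(** Replacing [ex q] by [mk q.-1] minus [mk q] keeps the number of marks and never raises their
    total. *)
Lemma mixed_ind P a s D : lin_closed P ->
  (forall ls, size ls = s -> (a + sumn ls <= D)%N -> P (mixed a [::] ls)) ->
  forall p ls, all (ltn 0) p -> (size p + size ls)%N = s ->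
    (a + sumn p + sumn ls <= D)%N -> P (mixed a p ls).
Proof.
move=> Plin P0; elim=> [|q p IH] ls /=; first by move=> _ sl Dl; apply: P0 => //; lia.
move=> /andP[q0 p0] sl Dl.
have -> : mixed a (q :: p) ls =
    (fun n k => mixed a p (q.-1 :: ls) n k + -1 * mixed a p (q :: ls) n k).
  by apply/funext => n; apply/funext => k; apply: mixed_cons.
by apply: Plin; apply: IH => //=; lia.
Qed.

Lemma count_filter_pos (e : pred nat) ls : count e ls =
  (count e (seq.filter (ltn 0) ls) + (size ls - size (seq.filter (ltn 0) ls)) * e 0%N)%N.
Proof.
elim: ls => [|[|l] ls IH] //=; rewrite IH.
  have : (size (seq.filter (ltn 0) ls) <= size ls)%N by rewrite size_filter count_size.
  by move=> H; rewrite subSn // mulSn; lia.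
by rewrite subSS; lia.
Qed.

(** Zeros among [ls] are indistinguishable from padding. *)
Lemma mixed_Sv a ls n k : (size ls <= n - k)%N ->
  mixed a [::] ls n k = Sv a (seq.filter (ltn 0) ls) n k / n`!%:R.
Proof.
move=> sl; rewrite /mixed add0n sl /Sv; congr (_ / _); apply: V_perm.
have H : (size (seq.filter (ltn 0) ls) <= size ls)%N by rewrite size_filter count_size.
apply/seq.permP => e; rewrite !count_cat count_filter_pos !count_nseq.
rewrite -addnA; congr (_ + _)%N; rewrite [(_ * e _)%N]mulnC -mulnDr; congr (_ * _)%N.
by move: (size (seq.filter _ _)) H => A H; lia.
Qed.

Lemma sumn_filter_pos ls : sumn (seq.filter (ltn 0) ls) = sumn ls.
Proof. by elim: ls => [|[|l] ls IH] //=; rewrite IH. Qed.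

Lemma mixed_has_theta a p d : all (ltn 0) p -> (a + sumn p <= d)%N ->
  has_theta d (mixed a p [::]).
Proof.
move=> p0 pd; have sp := size_le_sumn p0.
refine (@mixed_ind _ a (size p) d (@has_theta_lin d) _ p [::] p0 (addn0 _) _); last by rewrite addn0.
move=> ls sl ld; have [th0 [th H]] := @Sv_has_theta a (seq.filter (ltn 0) ls) d
  (filter_all _ _) (eq_ind_r (fun m => a + m <= d)%N ld (sumn_filter_pos ls)).
by exists th0, th => n k nk; rewrite mixed_Sv ?H //; lia.
Qed.

Lemma mixed_fixed_codim a p d : all (ltn 0) p -> (a + sumn p <= d)%N ->
  fixed_codim_poly d (mixed a p [::]).
Proof.
move=> p0 pd.
refine (@mixed_ind _ a (size p) d (@fixed_codim_poly_lin d) _ p [::] p0 (addn0 _) _); last by rewrite addn0.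
move=> ls sl ld j; have [lj|lj] := leqP (size ls) j; last first.
  exists 0 => [|n nj]; first by rewrite size_poly0.
  rewrite hornerC /mixed subKn; last by lia.
  by rewrite add0n leqNgt lj mul0r.
have [b sb bE] := V_vpoly a (ls ++ nseq (j - size ls) 0%N).
exists b.
  apply: leq_trans sb _; rewrite size_cat size_nseq; lia.
move=> n nj; rewrite /mixed add0n subKn ?lj -?bE //; last by lia.
by rewrite sumn_cat sumn_nseq mul0n; lia.
Qed.

Lemma leq_boundary d n k : (k + d - 1 <= n)%N -> (n, k) <> ((d - 1)%N, 0%N) -> (d <= n)%N.
Proof.
case: k => [|k] nk nk'; last by lia.
have : n <> (d - 1)%N by move=> E; case: nk'; rewrite E.
lia.
Qed.

(** The bound on [size p] leaves room for all marks even when n - k is only d - 1. *)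
Lemma mixed_fixed_k a p d : all (ltn 0) p -> (a + sumn p <= d)%N -> (size p < d)%N ->
  fixed_k_poly d (mixed a p [::]).
Proof.
move=> p0 pd sp.
refine (@mixed_ind _ a (size p) d (@fixed_k_poly_lin d) _ p [::] p0 (addn0 _) _); last by rewrite addn0.
move=> ls sl ld k; have fp : all (ltn 0) (seq.filter (ltn 0) ls) by apply: filter_all.
have [q sq qE] := @Sv_fixed_k a _ fp k; exists q => // n nk nk'.
have H : (size (seq.filter (ltn 0) ls) <= size ls)%N by rewrite size_filter count_size.
rewrite mixed_Sv; last by lia.
move: qE; rewrite sumn_filter_pos => qE.
have [ldd|ldd] := ltnP (a + sumn ls) d.
  by have := qE (n - (a + sumn ls))%N; rewrite subnK; [apply; apply/orP; left|]; lia.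
have nd : (d <= n)%N by apply: leq_boundary nk'.
(* Here [a + sumn ls] is d, and the line n = k + d - 1 falls under the case k = N + 1 of
   [Sv_fixed_k]. *)
have := qE (n - (a + sumn ls))%N; rewrite subnK; last by lia.
apply; apply/orP; have [kn|kn] := leqP (k + (a + sumn ls)) n; [left; lia | right].
apply/andP; split; first by lia.
by apply: leq_ltn_trans H _; lia.
Qed.

Lemma V_ex1 n phi (s : seq wfun) :
  V n.+1 [::] phi (ex 1 :: s) = n.+1%:R * V n [::] phi s.
Proof.
by have := V_one_rec n phi s; rewrite {1}(mk_sub 0) V_head_sub => H; lra.
Qed.

Lemma V_nseq_ex1 d n phi (s : seq wfun) : (d <= n)%N ->
  V n [::] phi (nseq d (ex 1) ++ s) = n`!%:R / (n - d)`!%:R * V (n - d) [::] phi s.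
Proof.
have f0 m : m`!%:R != 0 :> rat by rewrite pnatr_eq0 -lt0n fact_gt0.
elim: d n => [|d IH] n dn; first by rewrite subn0 divff ?mul1r.
case: n dn => // n dn; rewrite /= V_ex1 IH // factS natrM subSS; ring.
Qed.

Lemma ones_of_size p : all (ltn 0) p -> (sumn p <= size p)%N -> p = nseq (size p) 1%N.
Proof.
elim: p => //= q p IH /andP[q0 p0] H; have := size_le_sumn p0 => sp.
by rewrite -IH //; [congr (_ :: _)|]; lia.
Qed.

(* The only case in which [mk] marks would need more than n - k points on the boundary line. *)
Lemma ones_fixed_k d : (0 < d)%N -> fixed_k_poly d (mixed 0 (nseq d 1%N) [::]).
Proof.
move=> d0 k; have [th [Sth _]] := Sv_formula 0 (isT : all (ltn 0) [::]).
have [q sq qE] := Qv_poly th 0 k; exists (q \Po ('X - d%:R%:P)).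
  by rewrite size_comp_poly2 ?size_XsubC.
move=> n nk nk'.
have nd : (d <= n)%N by apply: leq_boundary nk'.
rewrite !horner_simp -natrB // qE /mixed size_nseq addn0.
case: leqP => dnk; last first.
  rewrite mul0r /Qv big_ord1 /halfr mul0r addr0 gbinom_nat bin_small ?mulr0 //; lia.
have f0 m : m`!%:R != 0 :> rat by rewrite pnatr_eq0 -lt0n fact_gt0.
have Sq : Sv 0 [::] (n - d) k = (n - d)`!%:R * Qv th 0 k (n - d)%:R.
  have := Sth k (n - d)%N; rewrite /= !addn0 muln0; apply; apply/orP; left; lia.
rewrite map_nseq V_nseq_ex1 // -[V _ _ _ _]/(V (n - d) [::] (ffall 0) (map mk ([::] ++ nseq (n - k - d) 0%N))).
have -> : V (n - d) [::] (ffall 0) (map mk ([::] ++ nseq (n - k - d) 0%N)) = Sv 0 [::] (n - d) k.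
  by rewrite /Sv subn0 subnAC.
rewrite Sq; by field; rewrite !f0.
Qed.

Lemma mixed_regular a p d : all (ltn 0) p -> (a + sumn p <= d)%N -> (0 < d)%N ->
  regular d (mixed a p [::]).
Proof.
move=> p0 pd d0; split; [exact: mixed_has_theta | | exact: mixed_fixed_codim].
have sp := size_le_sumn p0; have [pdd|pdd] := ltnP (size p) d; first exact: mixed_fixed_k.
have -> : a = 0%N by lia.
have sd : size p = d by lia.
by rewrite (ones_of_size p0) ?sd; [exact: ones_fixed_k | lia].
Qed.

(** For fixed [lam], [Tsum] is a finite linear combination whose coefficients do not depend on n and
    k. *)
Lemma Tsum_closed (P : (nat -> nat -> rat) -> Prop) lam (g : nat -> nat -> nat -> seq nat -> rat) :
  lin_closed P -> P (fun _ _ => 0) ->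
  (forall a p, (a + sumn p)%N = sumn lam -> all (ltn 0) p -> P (fun n k => g n k a p)) ->
  P (fun n k => Tsum lam (g n k)).
Proof.
move=> Plin P0.
have PD E E' : P E -> P E' -> P (fun n k => E n k + E' n k).
  move=> H H'; rewrite (_ : (fun n k => _) = (fun n k => E n k + 1 * E' n k)); first exact: Plin.
  by do 2 apply/funext => ?; rewrite mul1r.
have PZ c E : P E -> P (fun n k => c * E n k).
  move=> H; rewrite (_ : (fun n k => _) = (fun n k => 0 + c * E n k)); first exact: Plin.
  by do 2 apply/funext => ?; rewrite add0r.
have PS (I : Type) (r : seq I) (F : I -> nat -> nat -> rat) :
    (forall i, P (F i)) -> P (fun n k => \sum_(i <- r) F i n k).
  move=> H; elim: r => [|i r IH].
    by rewrite (_ : (fun n k => _) = (fun _ _ => 0)) //; do 2 apply/funext => ?; rewrite big_nil.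
  rewrite (_ : (fun n k => _) = (fun n k => F i n k + \sum_(i <- r) F i n k)); first exact: PD.
  by do 2 apply/funext => ?; rewrite big_cons.
have Pc r l (F : nat -> nat -> seq nat -> rat) :
    (forall p, sumn p = l -> all (ltn 0) p -> P (fun n k => F n k p)) ->
    P (fun n k => csumr r l (F n k)).
  elim: r l F => [|r IH] l F H; first by case: l H => // H; apply: H.
  rewrite (_ : (fun n k => _) = (fun n k => \sum_(q <- index_iota 1 l.+1)
    if (0 < q <= l)%N then csumr r (l - q) (fun p => F n k (q :: p)) else 0)); last first.
    do 2 apply/funext => ?; rewrite csumrS; apply: eq_big_nat => q /andP[q1 q2].
    by rewrite q1 -ltnS q2.
  apply: PS => q; case Eq: (0 < q <= l)%N => //; have /andP[q1 q2] := Eq; apply: (IH _ (fun n k p => F n k (q :: p))).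
  by move=> p sp p0; apply: H => /=; rewrite ?q1 // sp subnKC.
elim: lam g => [|l lam IH] g H; first exact: H.
rewrite /=; apply: PD.
  apply: PS => r; apply: PZ; apply: (Pc _ _ (fun n k p' => Tsum lam (fun a p => g n k a (p' ++ p)))).
  move=> p' sp' p'0; apply: (IH (fun n k a p => g n k a (p' ++ p))) => a p sp p0.
  apply: H; first by rewrite sumn_cat /= -sp sp'; lia.
  by rewrite all_cat p'0.
case: eqP => // l1; apply: (IH (fun n k a p => g n k a.+1 p)) => a p sp p0.
by apply: H => //; rewrite /= -sp l1.
Qed.

Lemma Tsum_regular d lam : (0 < d)%N -> (sumn lam <= d)%N ->
  regular d (fun n k => Tsum lam (linkval n (n - k)) / n`!%:R).
Proof.
move=> d0 ld.
rewrite (_ : (fun n k => _) = (fun n k => Tsum lam (fun a p => mixed a p [::] n k))); last first.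
  do 2 apply/funext => ?; rewrite mulrC -TsumZ; apply: eq_Tsum => a p _ _.
  by rewrite mulrC /linkval /guard /mixed addn0 /slist map_nseq.
apply: (Tsum_closed (g := fun n k a p => mixed a p [::] n k)); [exact: regular_lin | exact: regular0 |].
by move=> a p sp p0; apply: mixed_regular; rewrite ?sp.
Qed.

End Expansion.

(** * Passage to arbitrary polynomials in the cycle counts *)

Section Expectation.
Implicit Types (phi : (nat -> rat) -> rat) (M : nat -> rat).

Definition Gspan D phi := exists2 L : seq (rat * seq nat),
  all (fun cl => (sumn cl.2 <= D)%N) L & forall M, phi M = \sum_(cl <- L) cl.1 * Gf cl.2 M.

Lemma Gspan_leq D D' phi : (D <= D')%N -> Gspan D phi -> Gspan D' phi.
Proof.
move=> DD [L LD LE]; exists L => //; apply: sub_all LD => cl H; exact: leq_trans DD.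
Qed.

Lemma Gspan1 : Gspan 0 (fun=> 1).
Proof. by exists [:: (1, [::])] => //= M; rewrite big_seq1 mulr1. Qed.

Lemma Gspan0 D : Gspan D (fun=> 0).
Proof. by exists [::] => // M; rewrite big_nil. Qed.

Lemma GspanD D phi phi' : Gspan D phi -> Gspan D phi' -> Gspan D (fun M => phi M + phi' M).
Proof.
move=> [L LD LE] [L' LD' LE']; exists (L ++ L'); first by rewrite all_cat LD.
by move=> M; rewrite big_cat LE LE'.
Qed.

Lemma GspanZ D c phi : Gspan D phi -> Gspan D (fun M => c * phi M).
Proof.
move=> [L LD LE]; exists [seq (c * cl.1, cl.2) | cl <- L]; first by rewrite all_map.
by move=> M; rewrite LE big_map mulr_sumr; apply: eq_bigr => cl _; rewrite mulrA.
Qed.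

(** [M l] times [Gf lam M] is [Gf (l :: lam) M] plus [count_mem l lam] times [Gf lam M]. *)
Lemma GspanX D l phi : Gspan D phi -> Gspan (D + l) (fun M => M l * phi M).
Proof.
move=> [L LD LE]; exists ([seq (cl.1, l :: cl.2) | cl <- L] ++
    [seq (cl.1 * (count_mem l cl.2)%:R, cl.2) | cl <- L]).
  rewrite all_cat !all_map; apply/andP; split; apply: sub_all LD => cl /=; lia.
move=> M; rewrite big_cat !big_map LE mulr_sumr /= -big_split /=.
by apply: eq_bigr => cl _; ring.
Qed.

Lemma Gspan_monomial (r : seq nat) (e : nat -> nat) :
  Gspan (\sum_(j <- r) e j * j.+1)%N (fun M => \prod_(j <- r) M j.+1 ^+ e j).
Proof.
elim: r => [|j r IH].
  rewrite big_nil; have -> : (fun M => \prod_(j <- [::]) M j.+1 ^+ e j) = fun=> 1.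
    by apply/funext => M; rewrite big_nil.
  exact: Gspan1.
rewrite big_cons; have -> : (fun M => \prod_(j <- j :: r) M j.+1 ^+ e j) =
    (fun M => M j.+1 ^+ e j * \prod_(j <- r) M j.+1 ^+ e j).
  by apply/funext => M; rewrite big_cons.
elim: (e j) => [|m IHm].
  rewrite mul0n add0n; have -> : (fun M => M j.+1 ^+ 0 * \prod_(j <- r) M j.+1 ^+ e j) =
    (fun M => \prod_(j <- r) M j.+1 ^+ e j).
    by apply/funext => M; rewrite mul1r.
  exact: IH.
have -> : (fun M => M j.+1 ^+ m.+1 * \prod_(j <- r) M j.+1 ^+ e j) =
    (fun M => M j.+1 * (M j.+1 ^+ m * \prod_(j <- r) M j.+1 ^+ e j)).
  by apply/funext => M; rewrite exprS mulrA.
by apply: Gspan_leq (GspanX j.+1 IHm); rewrite mulSn; lia.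
Qed.

Lemma Gspan_qeval (f : cycpoly) :
  Gspan (wdeg f) (fun M => qeval (fun j => M j.+1) f).
Proof.
have -> : (fun M => qeval (fun j => M j.+1) f) = (fun M =>
    \sum_(m <- msupp f) mcoeff m f * \prod_(j <- finsupp (cmonom_val m)) M j.+1 ^+ m j).
  by apply/funext => M; rewrite /qeval mmapE.
rewrite /wdeg; elim: (enum_fset (msupp f)) => [|m r IH].
  have -> : (fun M => \sum_(m <- [::]) mcoeff m f * \prod_(j <- finsupp (cmonom_val m)) M j.+1 ^+ m j)
    = fun=> 0 by apply/funext => M; rewrite big_nil.
  exact: Gspan0.
have -> : (fun M => \sum_(m <- m :: r) mcoeff m f * \prod_(j <- finsupp (cmonom_val m)) M j.+1 ^+ m j)
  = (fun M => mcoeff m f * \prod_(j <- finsupp (cmonom_val m)) M j.+1 ^+ m j +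
   \sum_(m <- r) mcoeff m f * \prod_(j <- finsupp (cmonom_val m)) M j.+1 ^+ m j).
  by apply/funext => M; rewrite big_cons.
apply: GspanD; last by apply: Gspan_leq IH; rewrite big_cons leq_maxr.
apply: GspanZ; apply: Gspan_leq (Gspan_monomial _ _).
by rewrite big_cons leq_maxl.
Qed.

End Expectation.

Lemma wdeg_gt0 (f : cycpoly) : ~ is_const f -> (0 < wdeg f)%N.
Proof.
move=> fc; rewrite lt0n; apply/negP => /eqP w0; apply: fc.
exists (mcoeff (onecm nat) f); apply/malgP => m; rewrite mcoeffU.
have [->|mN1] := eqVneq m (onecm nat); first by rewrite mulr1n.
rewrite mulr0n; apply/mcoeff_outdom/negP => mf.
case/negP: mN1; apply/cmP => j; rewrite onecmE.
have : (\sum_(j <- finsupp (cmonom_val m)) m j * j.+1 <= wdeg f)%N.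
  by rewrite /wdeg (big_rem m) //= leq_maxl.
rewrite w0 leqn0 => /eqP/eqP; rewrite sum_nat_seq_eq0 => /allP H.
have [jm|] := boolP (j \in finsupp (cmonom_val m)); last by rewrite memNfinsupp => /eqP.
by have := H j jm; rewrite /= muln_eq0 orbF => /eqP.
Qed.

Lemma Ef_regular (f : cycpoly) : (0 < wdeg f)%N -> regular (wdeg f) (Ef f).
Proof.
move=> d0; have [L LD LE] := Gspan_qeval f.
apply: (@regular_ext _ (fun n k =>
  \sum_(cl <- L) cl.1 * (Tsum cl.2 (linkval n (n - k)) / n`!%:R))) => // [n k kn|].
  rewrite /Ef mulrC mulr_suml.
  under [in RHS]eq_bigr => s _ do rewrite (LE (fun j => (ncycles j s)%:R)) mulr_suml.
  rewrite -mulr_suml exchange_big /= mulr_suml; apply: eq_bigr => cl _.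
  rewrite -sum_Gf_Nid // mulrA mulr_sumr; congr (_ / _).
  by apply: eq_bigr => s _; rewrite mulrA.
elim: L LD {LE} => [|cl L IH] /= LD.
  rewrite (_ : (fun n k => _) = (fun _ _ => 0)); first exact: regular0.
  by do 2 apply/funext => ?; rewrite big_nil.
move: LD => /andP[cD LD].
rewrite (_ : (fun n k => _) = (fun n k => \sum_(cl <- L) cl.1 *
  (Tsum cl.2 (linkval n (n - k)) / n`!%:R) +
  cl.1 * (Tsum cl.2 (linkval n (n - k)) / n`!%:R))); last first.
  by do 2 apply/funext => ?; rewrite big_cons addrC.
apply: (@regular_lin _ cl.1 _ (fun n k => Tsum cl.2 (linkval n (n - k)) / n`!%:R)).
  exact: IH.
exact: Tsum_regular.
Qed.

(* Multiplied by the falling factorial of n of length d, both sides of (i) become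
   polynomials in n that agree for n >= k + d, hence also at n = k + d - 1. *)
Lemma theta_boundary d E : (0 < d)%N -> regular d E -> exists th0 th, forall n k,
  (k + d - 1 <= n)%N -> (n, k) <> ((d - 1)%N, 0%N) -> E n k = thetaform d th0 th n k.
Proof.
move=> d0 [[th0 [th Hth]] Hk _]; exists th0, th => n k nk nk'.
have nd := leq_boundary nk nk'.
have [a _ aE] := Hk k; rewrite aE //.
pose ff l (m : nat) : {poly rat} := \prod_(l <= i < m) ('X - i%:R%:P).
pose gb c : {poly rat} := (k`!%:R)^-1 *: \prod_(i < k) ('X - (i%:R - c)%:P).
pose P : {poly rat} := th0 *: (ff 0%N d * ((k`!%:R)^-1 *: gb 0)) +
  \sum_(1 <= l < d.+1) \sum_(1 <= i < (3 * l).+1)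
    (th i l * rho i k) *: (ff l d * gb (halfr i - l%:R)).
have ffE l m n' : (ff l m).[n'%:R] = \prod_(l <= i < m) (n'%:R - i%:R).
  by rewrite horner_prod; apply: eq_bigr => i _; rewrite hornerXsubC.
have gbE c n' : (gb c).[n'%:R] = gbinom (n'%:R + c) k.
  rewrite hornerZ horner_prod; congr (_ * _); apply: eq_bigr => i _.
  by rewrite hornerXsubC; ring.
have fact_ff l n' : (l <= d)%N -> (d <= n')%N ->
    (n' - l)`!%:R / n'`!%:R * (ff 0%N d).[n'%:R] = (ff l d).[n'%:R].
  move=> ld dn; rewrite !ffE [X in _ * X = _](@big_cat_nat _ _ _ l) //=.
  have E1 : \prod_(0 <= i < l) (n'%:R - i%:R) * (n' - l)`!%:R = n'`!%:R :> rat.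
    elim: l {ld} (leq_trans ld dn) => [|l IH] ln; first by rewrite big_geq // mul1r subn0.
    rewrite big_nat_recr //= -mulrA -natrB ?(ltnW ln) // -natrM.
    by rewrite -{1}(subnSK ln) -factS subnSK // IH // ltnW.
  have f0 m : m`!%:R != 0 :> rat by rewrite pnatr_eq0 -lt0n fact_gt0.
  move: E1; move: (\prod_(0 <= i < l) _) (\prod_(l <= i < d) _) => A B E1.
  have A0 : A != 0 by apply: contraNneq (f0 n') => A0; rewrite -E1 A0 mul0r.
  by rewrite -E1; field; rewrite f0.
have PE n' : (d <= n')%N -> P.[n'%:R] = (ff 0%N d).[n'%:R] * thetaform d th0 th n' k.
  move=> dn; rewrite /P hornerD !hornerZ hornerM hornerZ gbE addr0 gbinom_nat.
  rewrite /thetaform mulrDr mulrCA; congr (_ + _).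
  rewrite horner_sum mulr_sumr; apply: eq_big_nat => l /andP[l1 ld].
  rewrite horner_sum mulr_sumr; apply: eq_bigr => i _.
  rewrite hornerZ hornerM gbE -(fact_ff l) // addrA addrAC; ring.
have P0 : P - ff 0%N d * a = 0.
  apply: (@poly_nat_eq0 _ (k + d)) => n' nk2; rewrite hornerD hornerN hornerM PE; last by lia.
  rewrite -Hth // aE ?subrr //; first by lia.
  by case=> E1 E2; lia.
have : (P - ff 0%N d * a).[n%:R] = 0 by rewrite P0 hornerC.
rewrite hornerD hornerN hornerM PE // => /eqP; rewrite subr_eq0 => /eqP H.
have ff0 : (ff 0%N d).[n%:R] != 0.
  rewrite ffE prodf_seq_neq0; apply/allP => i; rewrite mem_index_iota => /andP[_ id].
  by rewrite subr_eq0 eqr_nat; lia.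
by apply/esym/(mulfI ff0).
Qed.

(** * The Gamma function *)

Section GammaRecurrence.
Context {R : realType}.
Implicit Types (x y t : R).
Local Notation mu := (@lebesgue_measure R).
Local Open Scope classical_set_scope.

Definition powexp y t : R := t `^ y * expR (- t).

Lemma powexp_ge0 y t : 0 <= powexp y t.
Proof. by rewrite mulr_ge0 ?powR_ge0 ?expR_ge0. Qed.

Lemma is_derive_powexp y t : 0 < t ->
  is_derive t 1 (powexp y) (y * powexp (y - 1) t - powexp y t).
Proof.
move=> t0; have H1 := is_derive1_powR y t0.
have H2 : is_derive t 1 (fun t : R => expR (- t)) (- expR (- t)).
  apply: is_derive_eq; rewrite mulrN mulr1; done.
have H := is_deriveM H1 H2; apply: (is_derive_eq H).
rewrite /powexp /GRing.scale /=. ring.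
Qed.

Lemma continuous_powexp y t : 0 < t -> {for t, continuous (powexp y)}.
Proof.
move=> t0; apply: differentiable_continuous; apply/derivable1_diffP.
by have [] := is_derive_powexp y t0.
Qed.

Lemma measurable_powexp y : measurable_fun [set: R] (powexp y).
Proof.
apply: measurable_funM; first exact: measurable_powR.
apply: continuous_measurable_fun => t.
by apply: continuous_comp; [exact: oppr_continuous | exact: continuous_expR].
Qed.

Lemma powexp_cvg0 y : 0 < y -> powexp y t @[t --> 0^'+] --> (0 : R).
Proof.
move=> y0; suff : powexp y t @[t --> 0^'+] --> 0 * expR (- 0) by rewrite mul0r.
apply: cvgM; first exact: powR_cvg0.
apply: cvg_at_right_filter; apply: continuous_comp; [exact: oppr_continuous | exact: continuous_expR].
Qed.

Lemma powexp_cvgy y : powexp y t @[t --> +oo] --> (0 : R).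
Proof.
(* An integer above y, so that t^y <= t^n for t >= 1, while exp t exceeds t^(n+1) / (n+1)!. *)
pose n := (Num.truncn y).+1.
apply: (@squeeze_cvgr _ _ _ _ (fun=> 0) (fun t => n.+1`!%:R * t^-1)).
- near=> t; have t1 : 1 <= t by near: t; exact: nbhs_pinfty_ge.
  rewrite powexp_ge0 /= /powexp expRN.
  have t0 : 0 < t by apply: lt_le_trans t1.
  rewrite ler_pdivrMr ?expR_gt0 //.
  apply: (@le_trans _ _ (t ^+ n)).
    by rewrite -powR_mulrn ?(ltW t0) //; apply: (ler_powR t1); rewrite ltW // truncnS_gt.
  have := expR_ge1Dxn n (ltW t0) => H.
  have f0 : n.+1`!%:R != 0 :> R by rewrite pnatr_eq0 -lt0n fact_gt0.
  have -> : t ^+ n = (n.+1`!%:R * t^-1) * (t ^+ n.+1 / n.+1`!%:R).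
    by rewrite exprS; field; rewrite f0 gt_eqF.
  apply: ler_wpM2l; first by rewrite mulr_ge0 // invr_ge0 ltW.
  by apply: le_trans H; rewrite lerDr.
- exact: cvg_cst.
suff : (fun t : R => n.+1`!%:R * t^-1) t @[t --> +oo] --> (n.+1`!%:R * 0 : R) by rewrite mulr0.
by apply: cvgMr; apply/gtr0_cvgV0 => //; exact: nbhs_pinfty_gt.
Unshelve. all: by end_near. Qed.

Lemma powexpE y t : 0 < y -> 0 <= t -> powexp y t = t * powexp (y - 1) t.
Proof. by move=> y0 t0; rewrite /powexp mulrA mulr_powRB1. Qed.

Let diff y t : R := y * powexp (y - 1) t - powexp y t.

Let diffE y t : 0 < y -> 0 <= t -> diff y t = (y - t) * powexp (y - 1) t.
Proof. by move=> y0 t0; rewrite /diff (powexpE y0 t0) mulrBl. Qed.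

Let continuous_diff y t : 0 < t -> {for t, continuous (diff y)}.
Proof.
move=> t0; apply: continuousB; last exact: continuous_powexp.
by apply: continuousM; [exact: cvg_cst | exact: continuous_powexp].
Qed.

Let measurable_diff y : measurable_fun [set: R] (diff y).
Proof.
apply: measurable_funB; last exact: measurable_powexp.
by apply: measurable_funM => //; exact: measurable_powexp.
Qed.

Let integral_diff_right y : 0 < y ->
  (\int[mu]_(t in `]y, +oo[) (- diff y t)%:E = (powexp y y)%:E)%E.
Proof.
move=> y0; rewrite integral_itv_obnd_cbnd; last first.
  apply: measurable_funTS; apply/measurable_EFinP; apply: measurableT_comp => //.
rewrite (@ge0_continuous_FTC2y _ _ (fun t => - powexp y t) _ 0).
- by rewrite EFinN oppeK add0e.
- move=> t yt; have t0 := lt_le_trans y0 yt.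
  by rewrite diffE ?(ltW t0) // -mulNr opprB mulr_ge0 ?subr_ge0 // powexp_ge0.
- apply: continuous_in_subspaceT => t; rewrite inE /= in_itv /= andbT => yt.
  by apply: continuousN; apply: continuous_diff; exact: lt_le_trans yt.
- by rewrite -oppr0; apply: cvgN; exact: powexp_cvgy.
- move=> t yt; apply: derivableN.
  by have [] := is_derive_powexp y (lt_trans y0 yt).
- by apply: cvgN; apply: cvg_at_right_filter; exact: continuous_powexp.
move=> t; rewrite in_itv /= andbT => yt; have [d1 d2] := is_derive_powexp y (lt_trans y0 yt).
by rewrite derive1E deriveN // d2.
Qed.

(** For y < 1 the integrand is unbounded at 0, so the fundamental theorem is applied on intervals
    exhausting ]0, y], followed by monotone convergence. *)
Let integral_diff_left y : 0 < y ->
  (\int[mu]_(t in `]0%R, y]) (diff y t)%:E = (powexp y y)%:E)%E.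
Proof.
move=> y0; pose A n : set R := `[y / n.+2%:R, y]%classic.
have yn0 n : 0 < y / n.+2%:R by rewrite divr_gt0.
have yny n : y / n.+2%:R < y.
  by rewrite ltr_pdivrMr // ltr_pMr // ltr1n.
have AU : \bigcup_n A n = `]0%R, y]%classic.
  apply/seteqP; split=> t.
    move=> [n _]; rewrite /A /= !in_itv /= => /andP[nt ty].
    by rewrite ty andbT; exact: lt_le_trans nt.
  rewrite /= in_itv /= => /andP[t0 ty]; exists (Num.truncn (y / t)) => //.
  rewrite /A /= in_itv /= ty andbT ler_pdivrMr // mulrC -ler_pdivrMr //.
  apply/ltW/(lt_trans (truncnS_gt _)); by rewrite ltr_nat.
have FA n : (\int[mu]_(t in A n) (diff y t)%:E = (powexp y y)%:E - (powexp y (y / n.+2%:R))%:E)%E.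
  apply: continuous_FTC2 => //.
  - apply: continuous_in_subspaceT => t; rewrite inE /= in_itv /= => /andP[yt _].
    by apply: continuous_diff; exact: lt_le_trans yt.
  - split.
    + move=> t; rewrite in_itv /= => /andP[yt _].
      by have [] := is_derive_powexp y (lt_trans (yn0 n) yt).
    + by apply: cvg_at_right_filter; exact: continuous_powexp.
    + by apply: cvg_at_left_filter; exact: continuous_powexp.
  move=> t; rewrite in_itv /= => /andP[yt _].
  have [d1 d2] := is_derive_powexp y (lt_trans (yn0 n) yt).
  by rewrite derive1E d2.
have H1 : (\int[mu]_(x in A i) (diff y x)%:E @[i --> \oo] -->
    \int[mu]_(x in `]0%R, y]) (diff y x)%:E)%E.
  rewrite -AU; apply: ge0_nondecreasing_set_cvg_integral.
  - move=> n m nm; apply/subsetPset => t; rewrite /A /= !in_itv /= => /andP[nt ty].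
    rewrite ty andbT; apply: le_trans nt; rewrite ler_pM2l // lef_pV2 ?posrE //.
    by rewrite ler_nat.
  - by move=> i; exact: measurable_itv.
  - move=> i; apply: measurable_funTS; apply/measurable_EFinP. exact: measurable_diff.
  - move=> i t; rewrite /A /= in_itv /= => /andP[it ty].
    have t0 := lt_le_trans (yn0 i) it.
    by rewrite lee_fin diffE ?(ltW t0) // mulr_ge0 ?subr_ge0 // powexp_ge0.
apply: (cvg_unique _ H1) => //.
rewrite (_ : (fun i => _) = (fun n => (powexp y y - powexp y (y / n.+2%:R))%:E)); last first.
  by apply/funext => n; apply: etrans (FA n) _; rewrite EFinB.
apply: cvg_EFin; first exact: nearW.
rewrite /= -[X in _ --> X](subr0 (powexp y y)); apply: cvgB; first exact: cvg_cst.
move/cvg_at_rightP : (powexp_cvg0 y0); apply; split => // .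
have H0 : [sequence @harmonic R n.+1]_n @ \oo --> (0 : R).
  by rewrite (cvg_shiftS (@harmonic R)); exact: cvg_harmonic.
have H : (y * harmonic n.+1) @[n --> \oo] --> y * 0 by apply: cvgMr; exact: H0.
by rewrite mulr0 in H.
Qed.

Definition gamma_ext y : \bar R := (\int[mu]_(t in `]0%R, +oo[) (powexp (y - 1) t)%:E)%E.

Lemma gamma_intE y : gamma_int y = fine (gamma_ext y).
Proof. by []. Qed.

(* The derivative of t^y exp (- t) is positive before t = y and negative after; splitting there
   keeps every integral nonnegative, so that finiteness is not needed. *)
Lemma gamma_extS y : 0 < y -> gamma_ext (y + 1) = (y%:E * gamma_ext y)%E.
Proof.
move=> y0; rewrite /gamma_ext addrK.
have mE z D : measurable_fun D (fun t => (powexp z t)%:E).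
  by apply: measurable_funTS; apply/measurable_EFinP; exact: measurable_powexp.
have U : `]0, +oo[%classic = `]0, y]%classic `|` `]y, +oo[%classic :> set R.
  by apply/seteqP; split=> t; rewrite /= !in_itv /= ?andbT; lra.
have ge0E z (D : set R) t : D t -> (0 <= (powexp z t)%:E)%E.
  by move=> _; rewrite lee_fin powexp_ge0.
have dj : [disjoint `]0, y]%classic & `]y, +oo[%classic : set R].
  apply/disj_setPS => t [] /=; rewrite !in_itv /= => /andP[_ ty]; rewrite andbT.
  by rewrite ltNge ty.
have Zl (D : set R) : measurable D ->
    (y%:E * \int[mu]_(t in D) (powexp (y - 1) t)%:E =
     \int[mu]_(t in D) (y%:E * (powexp (y - 1) t)%:E))%E.
  move=> mD; rewrite ge0_integralZl_EFin //; [|exact: mE|exact: ltW].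
  by move=> t _; rewrite lee_fin powexp_ge0.
have E1 : (y%:E * \int[mu]_(t in `]0%R, y]) (powexp (y - 1) t)%:E =
    \int[mu]_(t in `]0%R, y]) (powexp y t)%:E + (powexp y y)%:E)%E.
  rewrite Zl // -(integral_diff_left y0) -ge0_integralD //.
  - by apply: eq_integral => t _; rewrite -EFinM -EFinD /diff; congr EFin; ring.
  - by move=> t _; rewrite lee_fin powexp_ge0.
  - exact: mE.
  - move=> t; rewrite /= in_itv /= => /andP[t0 ty].
    by rewrite lee_fin diffE ?(ltW t0) // mulr_ge0 ?subr_ge0 // powexp_ge0.
  - by apply: measurable_funTS; apply/measurable_EFinP; exact: measurable_diff.
have E2 : (\int[mu]_(t in `]y, +oo[) (powexp y t)%:E =
    y%:E * \int[mu]_(t in `]y, +oo[) (powexp (y - 1) t)%:E + (powexp y y)%:E)%E.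
  rewrite Zl // -(integral_diff_right y0) -ge0_integralD //.
  - by apply: eq_integral => t _; rewrite -EFinM -EFinD /diff; congr EFin; ring.
  - by move=> t _; rewrite mule_ge0 // lee_fin ?powexp_ge0 // ltW.
  - by apply: measurable_funTS; apply/measurable_EFinP; apply: measurable_funM => //; exact: measurable_powexp.
  - move=> t; rewrite /= in_itv /= andbT => yt.
    have t0 : 0 <= t by rewrite ltW // (lt_trans y0).
    by rewrite lee_fin diffE // -mulNr opprB mulr_ge0 ?powexp_ge0 // subr_ge0 ltW.
  - by apply: measurable_funTS; apply/measurable_EFinP; apply: measurableT_comp => //; exact: measurable_diff.
have SU z : (\int[mu]_(t in `]0%R, y] `|` `]y, +oo[) (powexp z t)%:E =
    \int[mu]_(t in `]0%R, y]) (powexp z t)%:E + \int[mu]_(t in `]y, +oo[) (powexp z t)%:E)%E.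
  rewrite ge0_integral_setU //; first exact: mE.
  by move=> t _; rewrite lee_fin powexp_ge0.
rewrite U !SU.
rewrite muleDr ?E1 ?E2 //; last first.
  by apply: ge0_adde_def; rewrite inE integral_ge0 // => t _; rewrite lee_fin powexp_ge0.
by rewrite -[RHS]addeA [X in _ = (_ + X)%E]addeC.
Qed.

Lemma gamma_ext1 : gamma_ext 1 = 1%E.
Proof.
rewrite /gamma_ext subrr integral_itv_obnd_cbnd; last first.
  by apply: measurable_funTS; apply/measurable_EFinP; exact: measurable_powexp.
rewrite (@ge0_continuous_FTC2y _ _ (fun t => - expR (- t)) _ 0).
- by rewrite oppr0 expR0 EFinN oppeK add0e.
- by move=> t _; exact: powexp_ge0.
- apply: continuous_in_subspaceT => t _.
  have -> : powexp 0 = (fun t => expR (- t)).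
    by apply/funext => z; rewrite /powexp powRr0 mul1r.
  by apply: continuous_comp; [exact: oppr_continuous | exact: continuous_expR].
- by rewrite -oppr0; apply: cvgN; exact: cvgr_expR.
- by move=> t _; exact: ex_derive.
- apply: cvgN; apply: cvg_at_right_filter.
  by apply: continuous_comp; [exact: oppr_continuous | exact: continuous_expR].
move=> t _; rewrite derive1E deriveN //.
rewrite /powexp powRr0 mul1r; apply/eqP; rewrite eqr_oppLR; apply/eqP.
have H2 : is_derive t 1 (fun t : R => expR (- t)) (- expR (- t)).
  by apply: is_derive_eq; rewrite mulrN mulr1.
by have [_ ->] := H2.
Qed.

Lemma gamma_ext_gt0 y : 1 <= y -> (0 < gamma_ext y)%E.
Proof.
move=> y1; apply: (@lt_le_trans _ _ (\int[mu]_(t in `[1%R, 2%R]) (expR (- 2))%:E)%E).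
  rewrite integral_cst //= lebesgue_measure_itv /= lte_fin ltr1n -EFinD -EFinM lte_fin.
  by rewrite mulr_gt0 ?expR_gt0 // subr_gt0 ltr1n.
apply: (@le_trans _ _ (\int[mu]_(t in `[1%R, 2%R]) (powexp (y - 1) t)%:E)%E).
  apply: ge0_le_integral => //.
  - by apply: measurable_funTS; apply/measurable_EFinP; exact: measurable_powexp.
  move=> t; rewrite /= in_itv /= => /andP[t1 t2]; rewrite lee_fin /powexp.
  rewrite -[X in X <= _]mul1r ler_pM ?expR_ge0 ?ler_expR ?lerN2 //.
  by rewrite -[X in X <= _](powRr0 t); apply: (ler_powR t1); rewrite subr_ge0.
apply: ge0_subset_integral => //.
- by apply: measurable_funTS; apply/measurable_EFinP; exact: measurable_powexp.
- by move=> t _; rewrite lee_fin powexp_ge0.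
move=> t; rewrite /= !in_itv /= andbT => /andP[t1 _]; exact: lt_le_trans t1.
Qed.

(** For these y, t^(y-1) <= 1 + t, which bounds the integral by Gamma(1) + Gamma(2). *)
Lemma gamma_ext_lty y : 1 <= y <= 2 -> (gamma_ext y < +oo)%E.
Proof.
move=> /andP[y1 y2]; have g2 : gamma_ext 2 = 1%E.
  by rewrite (_ : 2 = 1 + 1) // gamma_extS // gamma_ext1 mule1.
apply: (@le_lt_trans _ _ (gamma_ext 1 + gamma_ext 2)); last first.
  by rewrite gamma_ext1 g2 -EFinD ltry.
rewrite /gamma_ext -ge0_integralD //.
- apply: ge0_le_integral => //.
  + by move=> t _; rewrite lee_fin powexp_ge0.
  + by apply: measurable_funTS; apply/measurable_EFinP; exact: measurable_powexp.
  + by apply: measurable_funTS; apply/measurable_EFinP; apply: measurable_funD; exact: measurable_powexp.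
  move=> t; rewrite /= in_itv /= andbT => t0; rewrite -EFinD lee_fin /powexp -mulrDl.
  apply: ler_wpM2r; first exact: expR_ge0.
  have -> : 2 - 1 = 1 :> R by ring.
  rewrite subrr powRr0 powRr1 ?(ltW t0) //.
  have [t1|t1] := leP 1 t.
    apply: (@le_trans _ _ t); last by rewrite lerDr.
    rewrite -[X in _ <= X](powRr1 (ltW t0)); apply: (ler_powR t1); lra.
  apply: (@le_trans _ _ 1); last by rewrite lerDl ltW.
  rewrite -[X in _ <= X](powRr0 t); apply: ger_powR; first by rewrite t0 ltW.
  by rewrite subr_ge0.
- by move=> t _; rewrite lee_fin powexp_ge0.
- by apply: measurable_funTS; apply/measurable_EFinP; exact: measurable_powexp.
- by move=> t _; rewrite lee_fin powexp_ge0.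
- by apply: measurable_funTS; apply/measurable_EFinP; exact: measurable_powexp.
Qed.

End GammaRecurrence.

(** * Quotients of Gamma values *)

Section GammaRatio.
Context {R : realType}.
Implicit Types (x y z : R) (i k m : nat).

(** [fine] sends infinite values to 0, so the equation persists through [gamma_extS] in every
    case. *)
Lemma gamma_intS x : 0 < x -> gamma_int (x + 1) = x * gamma_int x.
Proof.
move=> x0; rewrite !gamma_intE gamma_extS //.
by case: (gamma_ext x) => [r| |] //=; rewrite ?gt0_muley ?gt0_muleNy ?lte_fin ?mulr0.
Qed.

Lemma Gamma_pos x : 0 < x -> Gamma x = gamma_int x.
Proof.
move=> x0; rewrite /Gamma (_ : Num.truncn (1 - x) = 0%N) ?big_ord0 ?addr0 ?divr1 //.
by apply/Num.Theory.truncn0Pn; rewrite -ltNge ltrBlDr ltrDl.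
Qed.

(* Holds at negative integers too, both sides being junk zeros. *)
Lemma GammaS x : x != 0 -> Gamma (x + 1) = x * Gamma x.
Proof.
move=> xN0; have [x0|x0|x0] := ltrgtP 0 x; last by rewrite x0 eqxx in xN0.
  by rewrite !Gamma_pos ?gamma_intS // addr_gt0.
rewrite /Gamma (_ : 1 - (x + 1) = - x); last by ring.
have -> : Num.truncn (1 - x) = (Num.truncn (- x)).+1.
  apply: truncn_def; have nx : 0 <= - x by rewrite oppr_ge0 ltW.
  have := truncn_itv nx; rewrite -!natr1 => /andP[h1 h2]; apply/andP; split; lra.
set N := Num.truncn (- x); rewrite big_ord_recl /= addr0.
rewrite (_ : x + 1 + N%:R = x + N.+1%:R); last by rewrite -natr1; ring.
rewrite (eq_bigr (fun i : 'I_N => x + (bump 0 i)%:R)) => [|i _]; last first.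
  by rewrite /bump /= add1n -natr1; ring.
by rewrite invfM mulrCA [x * _]mulrA mulfV // mul1r.
Qed.

Lemma Gamma_fall z m : (forall t, (t < m)%N -> z - t%:R != 0) ->
  Gamma (z + 1) = \prod_(t < m) (z - t%:R) * Gamma (z - m%:R + 1).
Proof.
elim: m => [|m IH] H; first by rewrite big_ord0 mul1r subr0.
rewrite IH => [|t tm]; last by apply: H; rewrite ltnS ltnW.
rewrite GammaS ?H // big_ord_recr /= -mulrA; congr (_ * (_ * Gamma _)).
by rewrite -natr1; ring.
Qed.

Lemma gamma_int_half_gt0 m : 0 < gamma_int (1 + m%:R / 2 : R).
Proof.
(* Two consecutive half-integers are carried along because the functional equation moves by 1. *)
suff H : 0 < gamma_int (1 + m%:R / 2 : R) /\ 0 < gamma_int (1 + m.+1%:R / 2 : R) by case: H.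
have base y : 1 <= y <= 2 -> 0 < gamma_int y.
  move=> y12; rewrite gamma_intE fine_gt0 // gamma_ext_lty // gamma_ext_gt0 //.
  by case/andP: y12.
elim: m => [|m [IH1 IH2]]; first by split; apply: base; lra.
split; first exact: IH2.
rewrite (_ : 1 + m.+2%:R / 2 = (1 + m%:R / 2) + 1); last first.
  by rewrite -!natr1; field.
have m0 : 0 < 1 + m%:R / 2 :> R by rewrite ltr_pwDl // divr_ge0.
by rewrite (gamma_intS m0); apply: mulr_gt0.
Qed.

(** With z = k + i/2, the factorials of i/2 and k - i/2 are z! divided by falling factorials of z,
    of lengths k and i; [rho] is the quotient of these. *)
Lemma gfact_ratio i k :
  fine (gfact (i%:R / 2 : R) / gfact (k%:R - i%:R / 2))%E = ratr (rho i k) :> R.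
Proof.
have hge0 : 0 <= i%:R / 2 :> R by rewrite divr_ge0.
have -> : gfact (i%:R / 2 : R) = (Gamma (i%:R / 2 + 1))%:E.
  by rewrite /gfact ltNge hge0 andbF.
pose z : R := k%:R + i%:R / 2.
have rhoE : ratr (rho i k) = \prod_(t < i) (z - t%:R) / \prod_(t < k) (z - t%:R) :> R.
  rewrite /rho fmorph_div /= !rmorph_prod /z; congr (_ / _); apply: eq_bigr => t _;
    by rewrite rmorphB rmorphD /= /halfr fmorph_div /= !ratr_nat.
have zN0 t : (t < k)%N -> z - t%:R != 0.
  move=> tk; rewrite gt_eqF // subr_gt0 /z ltr_wpDr // ltr_nat //.
have zi : z - i%:R = k%:R - i%:R / 2 by rewrite /z; field.
have zk : z - k%:R = i%:R / 2 by rewrite /z; ring.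
have den0 : \prod_(t < k) (z - t%:R) != 0 by apply/prodf_neq0 => t _; apply: zN0.
rewrite rhoE /gfact; case: ifP => [/andP[zint zlt0]|zN].
  rewrite invey mule0 /=.
  (* If z - i is a negative integer, then z is a natural number below i, and a factor of the
     numerator of [rho] vanishes, in agreement with the convention y / oo = 0. *)
  have [t [ti zt]] : exists t, (t < i)%N /\ z = t%:R.
    move: zint zlt0 => /intrP[a]; rewrite -zi => za; rewrite za ltrz0 => a0.
    have zE : z = (i%:Z + a)%:~R by rewrite intrD -za; ring.
    have : 0 <= i%:Z + a.
      by rewrite -(ler0z R) -zE addr_ge0.
    case E : (i%:Z + a) zE => [t|t] // zE _; exists t; split=> //.
    by rewrite -ltz_nat -E; lia.
  rewrite (bigD1 (Ordinal ti)) //= zt subrr !mul0r //.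
have ziN0 t : (t < i)%N -> z - t%:R != 0.
  move=> ti; apply: contraFneq zN => /eqP; rewrite subr_eq0 => /eqP zt.
  rewrite -zi zt -(opprB i%:R) -natrB ?(ltnW ti) // rpredN.
  by rewrite natr_int oppr_lt0 ltr0n subn_gt0.
have G0 : Gamma (z + 1) != 0.
  have z0 : 0 < z + 1 by rewrite ltr_wpDl // addr_ge0.
  rewrite Gamma_pos // gt_eqF // (_ : z + 1 = 1 + (2 * k + i)%:R / 2) ?gamma_int_half_gt0 //.
  by rewrite /z natrD natrM; field.
have E1 := Gamma_fall zN0; have E2 := Gamma_fall ziN0.
rewrite zk in E1; rewrite zi in E2.
have Gi : Gamma (k%:R - i%:R / 2 + 1 : R) != 0.
  by apply: contraNneq G0 => G0; rewrite E2 G0 mulr0.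
rewrite inver (negPf Gi) /=; apply/eqP; rewrite eqr_div //.
by rewrite [X in X == _]mulrC -E1 E2.
Qed.

End GammaRatio.

Lemma ratr_natV (R : realType) m : ratr (m%:R^-1) = m%:R^-1 :> R.
Proof. by rewrite fmorphV /= ratr_nat. Qed.

Lemma ratr_gbinom (R : realType) (x : rat) k : ratr (gbinom x k) = gbinom (ratr x) k :> R.
Proof.
rewrite /gbinom rmorphM /= ratr_natV rmorph_prod; congr (_ * _).
by apply: eq_bigr => t _; rewrite rmorphB /= ratr_nat.
Qed.

Lemma ratr_thetaform (R : realType) d th0 th n k :
  ratr (thetaform d th0 th n k) =
    ratr th0 * ((k`!%:R)^-1 * 'C(n, k)%:R)
    + \sum_(1 <= l < d.+1) \sum_(1 <= i < (3 * l).+1)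
        ratr (th i l) * ((n - l)`!%:R / n`!%:R)
        * fine (gfact (i%:R / 2) / gfact (k%:R - i%:R / 2))%E
        * gbinom (n%:R - l%:R + i%:R / 2) k :> R.
Proof.
rewrite /thetaform rmorphD !rmorphM /= ratr_natV ratr_nat; congr (_ + _).
rewrite rmorph_sum; apply: eq_bigr => l _; rewrite rmorph_sum; apply: eq_bigr => i _.
rewrite [LHS]rmorphM /= ratr_gbinom gfact_ratio; congr (_ * gbinom _ k); last first.
  by rewrite rmorphD rmorphB /= !ratr_nat /halfr rmorphM /= ratr_natV ratr_nat.
rewrite [LHS]rmorphM /=; congr (_ * _); rewrite [LHS]rmorphM /=; congr (_ * _).
by rewrite [LHS]rmorphM /= ratr_nat ratr_natV.
Qed.

Theorem theorem1p13 (R : realType) (f : cycpoly) (hf : ~ is_const f) :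
  let d := wdeg f in
  [/\ exists (theta0 : rat) (theta : nat -> nat -> rat),
        forall n k : nat, (k + d - 1 <= n)%N -> (n, k) <> ((d - 1)%N, 0%N) ->
          ratr (Ef f n k) =
            ratr theta0 * ((k`!%:R)^-1 * 'C(n, k)%:R)
            + \sum_(1 <= l < d.+1) \sum_(1 <= i < (3 * l).+1)
                ratr (theta i l) * ((n - l)`!%:R / n`!%:R)
                * fine (gfact (i%:R / 2) / gfact (k%:R - i%:R / 2))%E
                * gbinom (n%:R - l%:R + i%:R / 2) k
          :> R,
      forall k : nat, exists a : {poly rat},
        (size a <= k.+1)%N /\
        forall n : nat, (k + d - 1 <= n)%N -> (n, k) <> ((d - 1)%N, 0%N) ->
          Ef f n k = a.[n%:R]
    & forall j : nat, exists b : {poly rat},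
        (size b <= (d + 2 * j).+1)%N /\
        forall n : nat, (maxn j (d - 1) <= n)%N ->
          Ef f n (n - j)%N = b.[n%:R] / n`!%:R].
Proof.
move=> d; have d0 : (0 < d)%N := wdeg_gt0 hf.
have Ereg := Ef_regular d0; have [_ Hk Hj] := Ereg; split.
- have [th0 [th H]] := theta_boundary d0 Ereg; exists th0, th => n k nk nk'.
  by rewrite H // ratr_thetaform.
- by move=> k; have [a sa aE] := Hk k; exists a.
by move=> j; have [b sb bE] := Hj j; exists b.
Qed.
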